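(* Suppose conditions (R1)-(R3) of the context hold. Fix $\mathcal{S}_n\subset\mathbb{R}^n$. Suppose there exist $z\in\mathbb{R}$, $\rho_0>0$ and $\epsilon_n\in[0,1/4)$ such that $$\mathbb{P}\Big(\min_{w\in\mathbb{R}^n}H^{\mathsf R}(w,G,\xi)\ge z+\rho_0\Big)\vee\mathbb{P}\Big(\min_{w\in\mathcal{S}_n}H^{\mathsf R}(w,G,\xi)\le z+2\rho_0\Big)\le\epsilon_n.$$ Then there exists $K=K(\sigma,\lambda,\tau,M_2)>0$ such that $$\mathbb{P}\big(\hat w_A^{\mathsf R}\in\mathcal{S}_n\big)\le4\epsilon_n+K\,(1\vee\rho_0^{-3})(1\vee\lVert\mu_0\rVert_\infty^2)\,n^{-1/6}\log^2n.$$
   Context: Linear model: $Y=A\mu_0+\xi$, with $\mu_0\in\mathbb{R}^n$, $A\in\mathbb{R}^{m\times n}$, $\xi\in\mathbb{R}^m$. Ridge cost and Ridge error: $$H^{\mathsf R}(w,A,\xi)\equiv\frac1m\Big\{\frac12\lVert Aw-\xi\rVert^2+\frac\lambda2\lVert w+\mu_0\rVert^2\Big\},\qquad\hat w_A^{\mathsf R}\equiv\arg\min_{w\in\mathbb{R}^n}H^{\mathsf R}(w,A,\xi)=(A^\top A+\lambda I)^{-1}(A^\top\xi-\lambda\mu_0).$$ $G\in\mathbb{R}^{m\times n}$ has i.i.d. $\mathcal N(0,1/m)$ entries and is independent of $\xi$. $\lVert\cdot\rVert$ is the Euclidean norm, $a\vee b=\max\{a,b\}$. Conditions: (R1) $\tau\le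 m/n\le1/\tau$ for some $\tau\in(0,1)$, and $\lambda>0$. (R2) $\lVert\mu_0\rVert^2/n\le M_2$ for some $M_2>0$. (R3) $A_0=\sqrt mA$ and $\xi_0=\xi/\sigma$ ($\sigma>0$) are independent, and their entries are all independent, mean $0$, variance $1$ and uniformly sub-Gaussian, i.e. $\sup_n\max_{i,j}(\lVert A_{0,ij}\rVert_{\psi_2}+\lVert\xi_{0,i}\rVert_{\psi_2})<\infty$ with $\lVert\cdot\rVert_{\psi_2}$ the sub-Gaussian (Orlicz-2) norm. This uniform sub-Gaussian bound is regarded as fixed, and constants may depend on it.
   Formalization: The bound is stated for n ≥ 2; at n = 1 the factor log² n vanishes and the printed inequality P ≤ 4ε_n fails (e.g. m = n = 1, μ_0 = 0, Rademacher A and ξ, small λ and ρ_0). *)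

(* Defs.v *)
From HB Require Import structures.
From mathcomp Require Import all_boot all_order all_algebra.
From mathcomp Require Import all_classical all_reals all_analysis.
From mathcomp Require Import ring lra.

Set Implicit Arguments.
Unset Strict Implicit.
Unset Printing Implicit Defensive.

Import Order.TTheory GRing.Theory Num.Theory.
Import numFieldNormedType.Exports.

Local Open Scope classical_set_scope.
Local Open Scope ring_scope.

(* The norm carried by matrices in mathcomp-analysis is the sup norm, so the
   Euclidean norm is defined separately. *)
Definition enorm (R : realType) (n : nat) (x : 'cV[R]_n) : R :=
  Num.sqrt (\sum_(i < n) x i 0 ^+ 2).

Definition ridge_cost (R : realType) (m n : nat) (lambda : R) (mu0 w : 'cV[R]_n)
    (A : 'M[R]_(m, n)) (xi : 'cV[R]_m) : R :=
  m%:R^-1 * (2^-1 * enorm (A *m w - xi) ^+ 2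
             + lambda / 2 * enorm (w + mu0) ^+ 2).

(* "min" over an arbitrary set [S], read as an infimum; it is +oo when [S] is
   empty. *)
Definition ridge_min (R : realType) (m n : nat) (lambda : R) (mu0 : 'cV[R]_n)
    (S : set 'cV[R]_n) (A : 'M[R]_(m, n)) (xi : 'cV[R]_m) : \bar R :=
  ereal_inf [set (ridge_cost lambda mu0 w A xi)%:E | w in S].

(* See [ridge_errorE] below for existence, uniqueness and the closed form. *)
Definition ridge_error (R : realType) (m n : nat) (lambda : R) (mu0 : 'cV[R]_n)
    (A : 'M[R]_(m, n)) (xi : 'cV[R]_m) : 'cV[R]_n :=
  get [set w | forall v,
    ridge_cost lambda mu0 w A xi <= ridge_cost lambda mu0 v A xi].

Section probability_notions.
Context {d : measure_display} {T : measurableType d} {R : realType}.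
Variable P : probability T R.

Definition mutually_independent (I : finType) (X : I -> T -> R) : Prop :=
  forall (J : {set I}) (B : I -> set R), (forall i, measurable (B i)) ->
    P (\bigcap_(i in [set` J]) (X i @^-1` B i))
    = (\prod_(i in J) P (X i @^-1` B i))%E.

Definition sigma_of (I : Type) (X : I -> T -> R) : set (set T) :=
  <<s [set E | exists i (B : set R), measurable B /\ E = X i @^-1` B] >>.

Definition independent_families (I J : Type) (X : I -> T -> R)
    (Y : J -> T -> R) : Prop :=
  forall E F, sigma_of X E -> sigma_of Y F -> P (E `&` F) = (P E * P F)%E.

(* The Orlicz norm inf {t > 0 : E exp(X^2 / t^2) <= 2}; it is +oo when no such
   t exists. *)
Definition psi2_norm (X : T -> R) : \bar R :=
  ereal_inf [set t%:E | t in
    [set t : R | 0 < t /\ ('E_P[fun w => expR (X w ^+ 2 / t ^+ 2)] <= 2%:E)%E]].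

(* [s] is the standard deviation. *)
Definition has_normal_law (mean s : R) (X : T -> R) : Prop :=
  forall B : set R, measurable B -> P (X @^-1` B) = normal_prob mean s B.

End probability_notions.

Definition entries (T R : Type) (m n : nat) (A : T -> 'M[R]_(m, n))
    (k : 'I_m * 'I_n) (t : T) : R := A t k.1 k.2.

Definition entries_pair (T R : Type) (m n : nat) (A : T -> 'M[R]_(m, n))
    (xi : T -> 'cV[R]_m) (k : 'I_m * 'I_n + 'I_m) (t : T) : R :=
  match k with inl ij => A t ij.1 ij.2 | inr i => xi t i 0 end.

Definition measurable_entries (d : measure_display) (T : measurableType d)
    (R : realType) (m n : nat) (A : T -> 'M[R]_(m, n)) : Prop :=
  forall i j, measurable_fun [set: T] (fun t => A t i j).

(* [L] is the uniform sub-Gaussian bound. *)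
Definition design_condition (d : measure_display) (T : measurableType d)
    (R : realType) (P : probability T R) (m n : nat) (sigma L : R)
    (A : T -> 'M[R]_(m, n)) (xi : T -> 'cV[R]_m) : Prop :=
  let A0 := fun t => Num.sqrt m%:R *: A t in
  let xi0 := fun t => sigma^-1 *: xi t in
  [/\ measurable_entries A /\ measurable_entries xi,
      mutually_independent P (entries_pair A0 xi0),
      forall k, ('E_P[entries_pair A0 xi0 k] = 0)%E,
      forall k, ('V_P[entries_pair A0 xi0 k] = 1)%E
    & forall i j, (psi2_norm P (entries_pair A0 xi0 (inl (i, j)))
                   + psi2_norm P (entries_pair A0 xi0 (inr i)) <= L%:E)%E].

Definition gaussian_design (d : measure_display) (T : measurableType d)
    (R : realType) (P : probability T R) (m n : nat)
    (G : T -> 'M[R]_(m, n)) (xi : T -> 'cV[R]_m) : Prop :=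
  [/\ measurable_entries G,
      mutually_independent P (entries G),
      forall i j, has_normal_law P 0 (Num.sqrt m%:R^-1) (fun t => G t i j)
    & independent_families P (entries G) (entries xi)].

Lemma enorm_sqr (R : realType) (n : nat) (x : 'cV[R]_n) :
  enorm x ^+ 2 = \sum_(i < n) x i 0 ^+ 2.
Proof. by rewrite sqr_sqrtr// sumr_ge0// => i _; rewrite sqr_ge0. Qed.

Lemma enorm_sqr_mx (R : realType) (n : nat) (x : 'cV[R]_n) :
  enorm x ^+ 2 = (x^T *m x) 0 0.
Proof. by rewrite enorm_sqr mxE; apply: eq_bigr => i _; rewrite mxE expr2. Qed.

Lemma enorm_eq0 (R : realType) (n : nat) (x : 'cV[R]_n) :
  enorm x ^+ 2 <= 0 -> x = 0.
Proof.
rewrite enorm_sqr => x0; apply/matrixP => i j; rewrite (ord1 j) mxE.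
have s0 : \sum_(k < n) x k 0 ^+ 2 = 0.
  by apply/eqP; rewrite eq_le x0 sumr_ge0// => k _; rewrite sqr_ge0.
have := psumr_eq0P (fun k _ => sqr_ge0 (x k 0)) s0.
by move=> /(_ i isT)/eqP; rewrite sqrf_eq0 => /eqP.
Qed.

Lemma ridge_unitmx (R : realType) (m n : nat) (lambda : R) (A : 'M[R]_(m, n)) :
  0 < lambda -> A^T *m A + lambda%:M \in unitmx.
Proof.
move=> l0; rewrite -row_free_unit; apply/inj_row_free => v v0.
have : enorm v^T ^+ 2 <= 0.
  have : ((v *m (A^T *m A + lambda%:M)) *m v^T) 0 0 = 0.
    by rewrite v0 mul0mx mxE.
  rewrite mulmxDr mulmxDl mul_mx_scalar -scalemxAl mxE [X in _ + X]mxE => vE.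
  have : 0 <= enorm (A *m v^T) ^+ 2 by rewrite sqr_ge0.
  rewrite enorm_sqr_mx trmx_mul trmxK -!mulmxA in vE * => AvE.
  by rewrite enorm_sqr_mx trmxK -(pmulr_rle0 _ l0); lra.
by move=> /enorm_eq0 /(congr1 trmx); rewrite trmxK trmx0.
Qed.

Lemma enorm_sqrD (R : realType) (n : nat) (x y : 'cV[R]_n) :
  enorm (x + y) ^+ 2 = enorm x ^+ 2 + 2 * (y^T *m x) 0 0 + enorm y ^+ 2.
Proof.
rewrite !enorm_sqr mxE mulr_sumr -!big_split/=; apply: eq_bigr => i _.
by rewrite !mxE; ring.
Qed.

Lemma ridge_errorE (R : realType) (m n : nat) (lambda : R) (mu0 : 'cV[R]_n)
    (A : 'M[R]_(m, n)) (xi : 'cV[R]_m) : (0 < m)%N -> 0 < lambda ->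
  ridge_error lambda mu0 A xi
  = invmx (A^T *m A + lambda%:M) *m (A^T *m xi - lambda *: mu0).
Proof.
move=> m0 l0; set M := A^T *m A + lambda%:M; set w0 := (X in _ = X).
have m0' : 0 < m%:R^-1 :> R by rewrite invr_gt0 ltr0n.
have Mw0 : M *m w0 = A^T *m xi - lambda *: mu0.
  by rewrite mulKVmx// ridge_unitmx.
have costD v : ridge_cost lambda mu0 (w0 + v) A xi
    = ridge_cost lambda mu0 w0 A xi
      + m%:R^-1 * (2^-1 * enorm (A *m v) ^+ 2 + lambda / 2 * enorm v ^+ 2).
  rewrite /ridge_cost mulmxDr addrAC [w0 + v + mu0]addrAC.
  rewrite (enorm_sqrD _ (A *m v)) (enorm_sqrD _ v).
  have : (v^T *m (A^T *m (A *m w0 - xi) + lambda *: (w0 + mu0))) 0 0 = 0.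
    rewrite mulmxBr scalerDr addrACA mulmxA -[lambda *: w0]mul_scalar_mx.
    rewrite -mulmxDl -/M Mw0 [- _ + _]addrC [X in _ *m X](_ : _ = 0).
      by rewrite mulmx0 mxE.
    by rewrite addrA subrK subrr.
  rewrite (mulmxDr v^T) -scalemxAr mulmxA -trmx_mul mxE [X in _ + X]mxE => e0.
  by rewrite -mulrDr; congr (_ * _); lra.
have w0min v : ridge_cost lambda mu0 w0 A xi <= ridge_cost lambda mu0 v A xi.
  rewrite -[v](subrKC w0) costD lerDl pmulr_rge0// addr_ge0// mulr_ge0//.
  - by rewrite sqr_ge0.
  - by rewrite divr_ge0// ltW.
  - by rewrite sqr_ge0.
have gmin : [set w | forall v,
    ridge_cost lambda mu0 w A xi <= ridge_cost lambda mu0 v A xi]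
    (ridge_error lambda mu0 A xi) by exact: (@getI _ _ w0 w0min).
have := gmin w0; rewrite -[ridge_error _ _ _ _](subrKC w0) costD.
set v := _ - w0 => le0; suff -> : v = 0 by rewrite addr0.
apply: enorm_eq0; rewrite -(pmulr_rle0 _ l0).
have : 0 <= enorm (A *m v) ^+ 2 by rewrite sqr_ge0.
by move: le0; rewrite gerDl (pmulr_rle0 _ m0'); lra.
Qed.

(* Main.v *)
(* Replace the minimum of the ridge cost over a finite net by the soft minimum
   -(1/beta) ln (sum_c exp(-beta H(w_c))) and compose it with a sigmoid.  The resulting
   functional of the entries of the design is smooth, so Lindeberg's exchange argument
   replaces A by G one entry at a time.  With all |w_j| <= L, its third derivatives in an
   entry cost a factor beta^2 L^3 times a Gibbs average of |residual|^3; by Chebyshev's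
   association inequality this average only decreases when the row of the entry is left
   out of the Gibbs weights, after which row and weights are independent.

   The net lives in a box of radius O(|mu_0|_oo + ln n).  Restricting to it is harmless
   since the ridge error lies in it: removing column j shows that |w_j| is at most
   |mu_0j| + |a_j . r^(j)| / lambda, where the leave-one-out residual r^(j) is independent
   of a_j, and sub-Gaussianity of a_j bounds the inner product by O(ln n).

   If the ridge error for A lies in S, then either the global minimum for A exceeds
   z + 3/2 rho_0, or the minimum over S is below it.  Each alternative is transferred to G
   at the price of a factor 2 (the sigmoid is at least 1/2 on the event), which is where
   4 eps comes from. *)
Require Import Defs.
From HB Require Import structures.
From mathcomp Require Import all_boot all_order all_algebra.
From mathcomp Require Import all_classical all_reals all_analysis.
From mathcomp Require Import measurable_realfun.
From mathcomp Require Import ring lra.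

Set Implicit Arguments.
Unset Strict Implicit.
Unset Printing Implicit Defensive.

Import Order.TTheory GRing.Theory Num.Theory.
Import numFieldNormedType.Exports.

Local Open Scope classical_set_scope.
Local Open Scope ring_scope.

(** * Independent families and their laws *)

(** The scales behind the rate: a harmless mesh needs about [n^(6 n)] net points, so the inverse
    temperature of the cost must be of order [n ln n (1 v 1/rho0)]. Bounding third derivatives by
    the largest residual on the net would need a union over all these points. The Gibbs average
    avoids it: leaving the row out of the weights raises the average, the direction an upper bound
    needs, and then each net point only contributes a third moment. That moment is O(1) only if net
    points have Euclidean norm O(sqrt m), hence a second constraint besides the box. The [m n]
    exchanges cost [n^(-1/2) (1 v 1/rho0)^3 M^3 ln^6 n] with [M = 1 v |mu_0|_oo]. The claim is
    trivial unless [M^2 <= n^(1/6)]; in that range the surplus [M ln^4 n] is O(n^(1/3)), which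
    leaves [n^(-1/6) M^2 ln^2 n]. The joint law of [A] and [G] is unspecified, so the exchange runs
    on a product of two probability spaces. [S_n] is an arbitrary set, so the final event is bounded
    in outer measure. *)

Definition coordinate_cylinders (I : Type) (R : realType) : set (set (I -> R)) :=
  [set E | exists i (B : set R), measurable B /\ E = (fun x => x i) @^-1` B].

(** The product sigma-algebra on plain functions: a functional of all entries becomes one measurable
    map. *)
Notation fvec I R := (g_sigma_algebraType (@coordinate_cylinders I R)).

Section product_sigma_algebra.
Context (I : finType) (R : realType).

Lemma measurable_coord (i : I) :
  measurable_fun [set: fvec I R] (fun x : fvec I R => x i).
Proof.
move=> _ B mB; rewrite setTI; apply: sub_sigma_algebra.
by exists i, B.
Qed.

Lemma measurable_fvec d (U : measurableType d) (Y : U -> fvec I R) :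
  (forall i, measurable_fun [set: U] (fun u => Y u i)) ->
  measurable_fun [set: U] Y.
Proof.
move=> mY; apply: (@measurability _ _ _ (fvec I R) _ _ (@coordinate_cylinders I R)) => //.
by move=> _ [_ [i [B [mB ->]]] <-]; rewrite setTI -[_ @^-1` _]setTI; exact: mY.
Qed.

(** The pi-system on which mutual independence prescribes the law of a family. *)
Definition box_sets : set (set (fvec I R)) :=
  [set E | exists B : I -> set R, (forall i, measurable (B i)) /\
     E = [set x : I -> R | forall i, B i (x i)]].

Lemma box_setsI : setI_closed box_sets.
Proof.
move=> _ _ [B [mB ->]] [C [mC ->]]; exists (fun i => B i `&` C i); split.
  by move=> i; exact: measurableI.
by rewrite predeqE => x; split => [[xB xC] i|xBC]; split => // i; have [] := xBC i.
Qed.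

Lemma measurable_forall_in d (U : measurableType d) (Y : I -> U -> R) (B : I -> set R) :
  (forall i, measurable_fun setT (Y i)) -> (forall i, measurable (B i)) ->
  measurable [set u | forall i, B i (Y i u)].
Proof.
move=> mY mB.
rewrite (_ : [set u | _] = \bigcap_(i in [set: I]) (Y i @^-1` B i)).
  apply: fin_bigcap_measurable; first exact: finite_finset.
  by move=> i _; rewrite -[_ @^-1` _]setTI; exact: mY.
by rewrite predeqE => x; split => [xB i _|xB i]; exact: xB.
Qed.

Lemma measurable_box (B : I -> set R) : (forall i, measurable (B i)) ->
  measurable ([set x | forall i, B i (x i)] : set (fvec I R)).
Proof. by move=> mB; apply: measurable_forall_in mB => i; exact: measurable_coord. Qed.

Lemma measurable_fvecE : @measurable _ (fvec I R) = <<s box_sets >>.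
Proof.
rewrite eqEsubset; split.
  apply: (@smallest_sub _ (sigma_algebra setT) (@coordinate_cylinders I R)).
    exact: smallest_sigma_algebra.
  move=> _ [i [B [mB ->]]]; apply: sub_sigma_algebra.
  exists (fun j => if j == i then B else setT).
  split; first by move=> j; case: ifP.
  rewrite predeqE => x; split => [xB j|/(_ i)]; last by rewrite eqxx.
  by case: eqP => [->|].
apply: (@smallest_sub _ (sigma_algebra setT) box_sets (@measurable _ (fvec I R))).
  exact: sigma_algebra_measurable.
by move=> _ [B [mB ->]]; exact: measurable_box.
Qed.

End product_sigma_algebra.

Section independent_family.
Context (I : finType) (R : realType).

Lemma mutually_independentT d (T : measurableType d) (P : probability T R)
    (X : I -> T -> R) : mutually_independent P X ->
  forall B : I -> set R, (forall i, measurable (B i)) ->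
  P [set t | forall i, B i (X i t)] = (\prod_i P (X i @^-1` B i))%E.
Proof.
move=> iX B mB; rewrite (_ : [set t | _] =
    \bigcap_(i in [set` (finset.setT : {set I})]) (X i @^-1` B i)).
  by rewrite iX//; apply: eq_bigl => i; rewrite finset.inE.
by rewrite predeqE => t; split => [h i _|h i]; [exact: h|apply: h; rewrite /= finset.inE].
Qed.

Lemma mutually_independentE d (T : measurableType d) (P : probability T R)
    (X : I -> T -> R) : 
  (forall B : I -> set R, (forall i, measurable (B i)) ->
     P [set t | forall i, B i (X i t)] = (\prod_i P (X i @^-1` B i))%E) ->
  mutually_independent P X.
Proof.
move=> iX J B mB.
have := iX (fun i => if i \in J then B i else setT).
rewrite (_ : [set t | _] = \bigcap_(i in [set` J]) (X i @^-1` B i)); last first.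
  rewrite predeqE => t; split => [h i/= iJ|h i]; first by have := h i; rewrite iJ.
  by case: ifPn => // iJ; exact: h.
move=> ->; last by move=> i; case: ifP.
rewrite [RHS]big_mkcond/=; apply: eq_bigr => i _; case: ifP => // _.
by rewrite preimage_setT probability_setT.
Qed.

(** Both laws give a box the product of its marginals, and boxes are a generating pi-system, so the
    two pushforward measures coincide. Equality of marginals thus extends to every nonnegative
    functional of the family. *)
Lemma eq_expectation_indep d (T : measurableType d) (P : probability T R)
    d' (T' : measurableType d') (P' : probability T' R)
    (X : I -> T -> R) (Y : I -> T' -> R) (f : fvec I R -> R) :
  (forall i, measurable_fun setT (X i)) -> (forall i, measurable_fun setT (Y i)) ->
  mutually_independent P X -> mutually_independent P' Y ->
  (forall i B, measurable B -> P (X i @^-1` B) = P' (Y i @^-1` B)) ->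
  measurable_fun [set: fvec I R] f -> (forall x, 0 <= f x) ->
  (\int[P]_t (f (X ^~ t))%:E = \int[P']_t (f (Y ^~ t))%:E)%E.
Proof.
move=> mX mY iX iY XY mf f0.
have mX' : measurable_fun [set: T] (fun t => X ^~ t : fvec I R) by exact: measurable_fvec.
have mY' : measurable_fun [set: T'] (fun t => Y ^~ t : fvec I R) by exact: measurable_fvec.
have -> : (\int[P]_t (f (X ^~ t))%:E = \int[pushforward P (fun t => X ^~ t : fvec I R)]_x (f x)%:E)%E.
  rewrite ge0_integral_pushforward ?preimage_setT//; first exact/measurable_EFinP.
  by move=> x _; rewrite lee_fin.
have -> : (\int[P']_t (f (Y ^~ t))%:E = \int[pushforward P' (fun t => Y ^~ t : fvec I R)]_x (f x)%:E)%E.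
  rewrite ge0_integral_pushforward ?preimage_setT//; first exact/measurable_EFinP.
  by move=> x _; rewrite lee_fin.
apply: eq_measure_integral => A mA _.
apply: (@measure_unique _ _ (fvec I R) (@box_sets I R) (fun _ => setT)) => //.
- exact: measurable_fvecE.
- exact: box_setsI.
- by move=> _; exists (fun _ => setT); split => //; rewrite predeqE.
- by rewrite bigcup_const//; exists 0%N.
- move=> _ [B [mB ->]]; rewrite /pushforward /=.
  rewrite [LHS](mutually_independentT iX mB) [RHS](mutually_independentT iY mB).
  by apply: eq_bigr => i _; rewrite XY.
- by move=> _; change (P setT < +oo)%E; rewrite probability_setT ltry.
Qed.

End independent_family.

(** The two families are placed on the two factors of a product space, so no assumption on their
    joint law is needed to mix them. *)
Definition hybrid (I T T' R : Type) (b : I -> bool) (X : I -> T -> R)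
  (Y : I -> T' -> R) (i : I) (w : T * T') : R := if b i then X i w.1 else Y i w.2.

Section hybrid_family.
Context (I : finType) (R : realType).
Context d (T : measurableType d) (P : probability T R).
Context d' (T' : measurableType d') (P' : probability T' R).
Context (X : I -> T -> R) (Y : I -> T' -> R) (b : I -> bool).
Hypothesis mX : forall i, measurable_fun setT (X i).
Hypothesis mY : forall i, measurable_fun setT (Y i).
Local Notation Q := (P \x P')%E.

Lemma measurable_hybrid i : measurable_fun setT (hybrid b X Y i).
Proof.
rewrite /hybrid; case: (b i).
  by apply: measurableT_comp => //; exact: measurable_fst.
by apply: measurableT_comp => //; exact: measurable_snd.
Qed.

Lemma hybrid_marginal i B : measurable B -> Q (hybrid b X Y i @^-1` B) =
  if b i then P (X i @^-1` B) else P' (Y i @^-1` B).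
Proof.
move=> mB; rewrite /hybrid; case: (b i).
  rewrite (_ : _ @^-1` _ = (X i @^-1` B) `*` setT); last first.
    by rewrite predeqE => -[x y]; split => /=; [|case].
  rewrite product_measure1E//.
    by rewrite [X in (_ * X)%E](_ : _ = 1%E) ?mule1//; exact: probability_setT.
  by rewrite -[_ @^-1` _]setTI; exact: mX.
rewrite (_ : _ @^-1` _ = setT `*` (Y i @^-1` B)); last first.
  by rewrite predeqE => -[x y]; split => /=; [|case].
rewrite product_measure1E//.
  by rewrite [X in (X * _)%E](_ : _ = 1%E) ?mul1e//; exact: probability_setT.
by rewrite -[_ @^-1` _]setTI; exact: mY.
Qed.

Lemma hybrid_indep : mutually_independent P X -> mutually_independent P' Y ->
  mutually_independent Q (hybrid b X Y).
Proof.
move=> iX iY; apply: mutually_independentE => B mB.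
rewrite (_ : [set t | _] = [set t | forall i, (if b i then B i else setT) (X i t)] `*`
    [set t | forall i, (if b i then setT else B i) (Y i t)]); last first.
  rewrite predeqE => -[x y]; rewrite /hybrid/=; split => [h|[hx hy] i].
    by split => i; have := h i; case: (b i).
  by have := hx i; have := hy i; case: (b i).
etransitivity; first apply: product_measure1E.
- by apply: (measurable_forall_in (B := fun i => if b i then B i else setT)) => // i; case: ifP.
- by apply: (measurable_forall_in (B := fun i => if b i then setT else B i)) => // i; case: ifP.
- have hX := mutually_independentT iX (B := fun i => if b i then B i else setT).
  have hY := mutually_independentT iY (B := fun i => if b i then setT else B i).
  etransitivity; first apply: congr2; [apply: hX|apply: hY|].
  - by move=> i; case: ifP.
  - by move=> i; case: ifP.
  rewrite -big_split/=; apply: eq_bigr => i _; rewrite [RHS]hybrid_marginal//.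
  by case: (b i); rewrite preimage_setT probability_setT ?mule1 ?mul1e.
Qed.

End hybrid_family.

(** * Decoupling and sub-Gaussian variables *)

Section nonnegative_expectation.
Local Open Scope ereal_scope.
Context (R : realType) d (T : measurableType d) (P : probability T R).
Implicit Types f g : T -> R.

Lemma integral_cstr (c : R) : \int[P]_t c%:E = c%:E.
Proof.
rewrite integral_cst// [X in _ * X](_ : _ = 1) ?mule1//; exact: probability_setT.
Qed.

Lemma integral_mulrl (k : R) f : measurable_fun setT f ->
  (forall t, 0 <= f t)%R -> (0 <= k)%R ->
  \int[P]_t (k * f t)%:E = k%:E * \int[P]_t (f t)%:E.
Proof.
move=> mf f0 k0; under eq_integral do rewrite EFinM.
by rewrite ge0_integralZl_EFin//; [move=> t _; rewrite lee_fin|exact/measurable_EFinP].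
Qed.

Lemma integral_addr f g : measurable_fun setT f -> measurable_fun setT g ->
  (forall t, 0 <= f t)%R -> (forall t, 0 <= g t)%R ->
  \int[P]_t (f t + g t)%:E = \int[P]_t (f t)%:E + \int[P]_t (g t)%:E.
Proof.
move=> mf mg f0 g0; under eq_integral do rewrite EFinD.
rewrite ge0_integralD//.
- by move=> t _; rewrite lee_fin.
- exact/measurable_EFinP.
- by move=> t _; rewrite lee_fin.
- exact/measurable_EFinP.
Qed.

Lemma integral_sumr (C : Type) (s : seq C) (f : C -> T -> R) :
  (forall c, measurable_fun setT (f c)) -> (forall c t, 0 <= f c t)%R ->
  \int[P]_t (\sum_(c <- s) f c t)%:E = \sum_(c <- s) \int[P]_t (f c t)%:E.
Proof.
move=> mf f0; under eq_integral do rewrite -sumEFin.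
rewrite ge0_integral_sum//.
  by move=> c; exact/measurable_EFinP.
by move=> c t _; rewrite lee_fin.
Qed.

Lemma integral_ler f g : measurable_fun setT f -> measurable_fun setT g ->
  (forall t, 0 <= f t)%R -> (forall t, f t <= g t)%R ->
  \int[P]_t (f t)%:E <= \int[P]_t (g t)%:E.
Proof.
move=> mf mg f0 fg; apply: ge0_le_integral => //.
- by move=> t _; rewrite lee_fin.
- exact/measurable_EFinP.
- exact/measurable_EFinP.
- by move=> t _; rewrite lee_fin.
Qed.

Lemma markov_ge0 f (c : R) : measurable_fun setT f -> (forall t, 0 <= f t)%R ->
  (0 < c)%R -> P [set t | (c <= f t)%R] <= c^-1%:E * \int[P]_t (f t)%:E.
Proof.
move=> mf f0 c0.
have mA : measurable [set t | (c <= f t)%R].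
  rewrite -[X in measurable X]setTI.
  rewrite (_ : [set t | _] = f @^-1` `[c, +oo[%classic).
    by apply: mf => //; exact: measurable_itv.
  by rewrite predeqE => t; split; rewrite /= in_itv/= andbT.
rewrite -integral_mulrl//; last by rewrite invr_ge0 ltW.
rewrite (_ : P _ = \int[P]_t (\1_[set t | (c <= f t)%R] t)%:E); last first.
  by rewrite integral_indic// setIT.
apply: integral_ler => //; first exact: measurable_funM.
move=> t; rewrite indicE; case: (boolP (t \in _)) => [|_]; last first.
  by rewrite mulr_ge0// invr_ge0 ltW.
by rewrite inE/= => cf; rewrite mulrC ler_pdivlMr// mul1r.
Qed.

End nonnegative_expectation.

Section decoupling.
Local Open Scope ereal_scope.
Context (I : finType) (R : realType).
Context d (T : measurableType d) (P : probability T R).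
Variable X : I -> T -> R.
Hypothesis mX : forall i, measurable_fun setT (X i).
Hypothesis iX : mutually_independent P X.

(** The hybrid of [X] with an independent copy of itself has the law of [X]. By Fubini the
    coordinates in [J] are integrated inside, with the others frozen at [s]; this is how
    conditioning is expressed throughout. *)
Lemma integral_decouple (J : I -> bool) (f : fvec I R -> R) :
  measurable_fun [set: fvec I R] f -> (forall x, 0 <= f x)%R ->
  \int[P]_t (f (X ^~ t))%:E
  = \int[P]_s \int[P]_t (f (fun i => if J i then X i t else X i s))%:E.
Proof.
move=> mf f0.
have mh := measurable_hybrid J mX mX.
rewrite (eq_expectation_indep mX mh iX (hybrid_indep J mX mX iX iX) _ mf f0); last first.
  by move=> i B mB; rewrite [RHS]hybrid_marginal//; case: ifP.
have m2 : measurable_fun setT (fun w => (f (hybrid J X X ^~ w))%:E).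
  apply/measurable_EFinP; apply: (measurableT_comp mf); exact: measurable_fvec.
by rewrite [LHS]fubini_tonelli2//= => w; rewrite lee_fin.
Qed.

Lemma integral_prod_seq (f : I -> R -> R) (s : seq I) : uniq s ->
  (forall i, measurable_fun setT (f i)) -> (forall i x, 0 <= f i x)%R ->
  \int[P]_t (\prod_(i <- s) f i (X i t))%:E = \prod_(i <- s) \int[P]_t (f i (X i t))%:E.
Proof.
move=> us mf f0; elim: s us => [_|i s IH /= /andP[ins us]].
  by under eq_integral do rewrite big_nil; rewrite big_nil integral_cstr.
under eq_integral do rewrite big_cons.
have mg j : measurable_fun [set: fvec I R] (fun x : fvec I R => f j (x j)).
  by apply: (measurableT_comp (mf j)); exact: measurable_coord.
have mfX j : measurable_fun setT (fun t => f j (X j t)) by exact: measurableT_comp.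
rewrite (@integral_decouple (pred1 i) (fun x => (f i (x i) * \prod_(j <- s) f j (x j))%R)).
- rewrite big_cons -IH// /= eqxx.
  transitivity (\int[P]_y ((\prod_(j <- s) f j (X j y))%:E * \int[P]_t (f i (X i t))%:E)).
    apply: eq_integral => y _.
    rewrite -integral_mulrl//; last by apply: prodr_ge0.
    apply: eq_integral => t _; rewrite mulrC; congr (_ * _)%:E.
    by apply: eq_big_seq => j js; case: eqP => // ji; move: ins; rewrite -ji js.
  rewrite muleC ge0_integralZr//.
  + by apply/measurable_EFinP; apply: measurable_prod.
  + by move=> t _; rewrite lee_fin prodr_ge0.
  + by apply: integral_ge0 => t _; rewrite lee_fin.
- by apply: measurable_funM => //; apply: measurable_prod.
- by move=> x; rewrite mulr_ge0// prodr_ge0.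
Qed.

End decoupling.

Section subgaussian.
Local Open Scope ereal_scope.
Context (R : realType) d (T : measurableType d) (P : probability T R).

(** The Laplace transform form; [v] is half of the usual variance proxy. *)
Definition subgaussian (v : R) (X : T -> R) :=
  forall th : R, \int[P]_t (expR (th * X t))%:E <= (expR (v * th ^+ 2))%:E.

Lemma subgaussian_sum (I : finType) (X : I -> T -> R) (v c : I -> R) :
  (forall i, measurable_fun setT (X i)) -> mutually_independent P X ->
  (forall i, subgaussian (v i) (X i)) ->
  \int[P]_t (expR (\sum_i c i * X i t))%:E <= (expR (\sum_i v i * c i ^+ 2))%:E.
Proof.
move=> mX iX sX.
under eq_integral do rewrite expR_sum.
rewrite (@integral_prod_seq _ _ _ _ _ _ mX iX (fun i x => expR (c i * x))) ?index_enum_uniq//.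
  rewrite expR_sum -prodEFin.
  suff : forall r, 0 <= \prod_(i <- r) \int[P]_t (expR (c i * X i t))%:E /\
      \prod_(i <- r) \int[P]_t (expR (c i * X i t))%:E <=
      \prod_(i <- r) (expR (v i * c i ^+ 2))%:E by move=> /(_ (index_enum I))[].
  elim => [|i r [r0 IH]]; first by rewrite !big_nil; split.
  have i0 : 0 <= \int[P]_t (expR (c i * X i t))%:E.
    by apply: integral_ge0 => t _; rewrite lee_fin expR_ge0.
  by rewrite !big_cons; split; [exact: mule_ge0|apply: lee_pmul => //; exact: sX].
by move=> i; apply: measurableT_comp => //; exact: measurable_funM.
Qed.

End subgaussian.

Section exponential_inequalities.
Context (R : realType).
Implicit Types x s a : R.

(** Up to 1/2, [e^x <= 1/(1-x) <= 1 + x + 2x^2]; beyond 1/2, already [x <= 2x^2]. *)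
Lemma expR_le_linear_square x : expR x <= x + expR (2 * x ^+ 2).
Proof.
have [x2|x2] := lerP x 2^-1.
  have h1 : expR x <= 1 + x + 2 * x ^+ 2.
    have e := expR_ge1Dx (- x).
    have e0 : 0 < expR x by exact: expR_gt0.
    have ee : expR x * expR (- x) = 1 by exact: expRxMexpNx_1.
    have lb : expR x * (1 - x) <= expR x * expR (- x) by rewrite ler_pM2l.
    rewrite ee in lb.
    have ub : 1 <= (1 + x + 2 * x ^+ 2) * (1 - x) by nra.
    have x1 : 0 < 1 - x by lra.
    by rewrite -(ler_pM2r x1); exact: le_trans lb ub.
  by have := expR_ge1Dx (2 * x ^+ 2); lra.
have : expR x <= expR (2 * x ^+ 2) by rewrite ler_expR; nra.
lra.
Qed.

(** Convexity between 0 and [a], obtained by averaging with weights [1-s] and [s] the tangent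
    inequality at [s a] evaluated at the two endpoints. *)
Lemma expR_convex01 s a : 0 <= s <= 1 -> expR (s * a) <= 1 + s * (expR a - 1).
Proof.
move=> /andP[s0 s1].
have t0 : 0 <= 1 - s by lra.
have e1 := expR_ge1Dx (- (s * a)).
have e2 := expR_ge1Dx (a - s * a).
have e0 : 0 < expR (s * a) by exact: expR_gt0.
have h1 : expR (s * a) * (1 - s * a) <= expR (s * a) * expR (- (s * a)) by rewrite ler_pM2l.
rewrite expRxMexpNx_1 in h1.
have h2 : expR (s * a) * (1 + (a - s * a)) <= expR a.
  rewrite (_ : expR a = expR (s * a) * expR (a - s * a)) ?ler_pM2l//.
  by rewrite -expRD; congr expR; ring.
nra.
Qed.

(** [e^x] is the k-th power of [e^(x/k)], which is at least [x/k]. *)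
Lemma exprn_le_expR (k : nat) x : 0 <= x -> x ^+ k <= k%:R ^+ k * expR x.
Proof.
move=> x0; case: k => [|k]; first by rewrite !expr0 mul1r -expR0 ler_expR.
have k0 : (0 : R) < k.+1%:R by rewrite ltr0n.
rewrite (_ : expR x = expR (x / k.+1%:R) ^+ k.+1); last first.
  by rewrite -expRM_natr divfK// gt_eqF.
rewrite -exprMn lerXn2r ?nnegrE ?mulr_ge0 ?expR_ge0 ?ler0n//.
rewrite -ler_pdivrMl// mulrC; apply: le_trans (expR_ge1Dx _).
by rewrite lerDr.
Qed.

End exponential_inequalities.

Section subgaussian_theory.
Context (R : realType) d (T : measurableType d) (P : probability T R).
Implicit Types X : T -> R.

Lemma measurable_expRM X (c : R) : measurable_fun setT X ->
  measurable_fun setT (fun t => expR (c * X t)).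
Proof. by move=> mX; apply: measurableT_comp => //; exact: measurable_funM. Qed.

Lemma subgaussian_scale X (v c : R) : subgaussian P v X ->
  subgaussian P (v * c ^+ 2) (fun t => c * X t).
Proof.
move=> sX th; have := sX (th * c).
under eq_integral do rewrite -mulrA.
by rewrite (_ : v * (th * c) ^+ 2 = v * c ^+ 2 * th ^+ 2) //; ring.
Qed.

Lemma subgaussian_le X (v w : R) : v <= w -> subgaussian P v X -> subgaussian P w X.
Proof.
move=> vw sX th; apply: le_trans (sX th) _.
by rewrite lee_fin ler_expR ler_wpM2r// sqr_ge0.
Qed.

Lemma subgaussian_expR_norm X (v c : R) : measurable_fun setT X -> subgaussian P v X ->
  (\int[P]_t (expR (c * `|X t|))%:E <= (2 * expR (v * c ^+ 2))%:E)%E.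
Proof.
move=> mX sX.
apply: (@le_trans _ _ (\int[P]_t (expR (c * X t) + expR (- c * X t))%:E)%E).
  apply: integral_ler => //.
  - by apply: measurable_expRM; exact: measurableT_comp.
  - by apply: measurable_funD; exact: measurable_expRM.
  - move=> t; case: (ger0P (X t)) => _; first by rewrite lerDl expR_ge0.
    by rewrite mulrN -mulNr lerDr expR_ge0.
rewrite integral_addr//; [|exact: measurable_expRM|exact: measurable_expRM].
rewrite (_ : 2 * _ = expR (v * c ^+ 2) + expR (v * (- c) ^+ 2)); last by rewrite sqrrN; ring.
by rewrite EFinD leeD.
Qed.

Lemma subgaussian_moment X (v : R) (k : nat) : measurable_fun setT X -> subgaussian P v X ->
  (\int[P]_t (`|X t| ^+ k)%:E <= (k%:R ^+ k * (2 * expR v))%:E)%E.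
Proof.
move=> mX sX.
have mnX : measurable_fun setT (fun t => `|X t|) by exact: measurableT_comp.
have me : measurable_fun setT (fun t => expR (1 * `|X t|)) by exact: measurable_expRM.
apply: (@le_trans _ _ (\int[P]_t (k%:R ^+ k * expR (1 * `|X t|))%:E)%E).
  apply: integral_ler => //.
  - exact: measurable_funX.
  - exact: measurable_funM.
  - by move=> t; rewrite mul1r exprn_le_expR.
rewrite integral_mulrl//.
have := subgaussian_expR_norm 1 mX sX; rewrite expr1n mulr1.
by rewrite [X in _ -> (_ <= X)%E]EFinM; apply: lee_wpmul2l; rewrite lee_fin exprn_ge0.
Qed.

(* For small [th], [expR y <= y + expR (2 y^2)] removes the linear term; for large [th],
   AM-GM suffices. *)
Lemma subgaussian_psi2 X (t : R) : measurable_fun setT X -> 0 < t ->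
  (\int[P]_w (expR (X w ^+ 2 / t ^+ 2))%:E <= 2%:E)%E ->
  (\int[P]_w (X w)%:E = 0)%E -> subgaussian P (2 * t ^+ 2) X.
Proof.
move=> mX t0 E2 E0 th.
pose Y w := X w ^+ 2 / t ^+ 2.
have mY : measurable_fun setT Y by apply: measurable_funM => //; exact: measurable_funX.
have meY : measurable_fun setT (fun w => expR (Y w)) by exact: measurableT_comp.
have Y0 w : 0 <= Y w by rewrite mulr_ge0 ?invr_ge0 ?sqr_ge0.
have t20 : 0 < t ^+ 2 by rewrite exprn_gt0.
have XY w : X w ^+ 2 = t ^+ 2 * Y w by rewrite /Y mulrC divfK ?gt_eqF.
(* Convexity interpolates between [E e^0 = 1] and [E e^Y <= 2]; the bound [1 + s] is then below
   [e^s], with no constant in front. *)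
have mean s : 0 <= s <= 1 -> (\int[P]_w (expR (s * Y w))%:E <= (1 + s)%:E)%E.
  move=> /andP[s0 s1].
  apply: (@le_trans _ _ (\int[P]_w ((1 - s) + s * expR (Y w))%:E)%E).
    apply: integral_ler => //.
    - exact: measurable_expRM.
    - by apply: measurable_funD => //; exact: measurable_funM.
    - by move=> w; apply: le_trans (expR_convex01 _ _) _; [rewrite s0 s1|lra].
  rewrite integral_addr//; last 3 first.
  - exact: measurable_funM.
  - by move=> w; lra.
  - by move=> w; rewrite mulr_ge0// expR_ge0.
  rewrite integral_cstr integral_mulrl//.
  rewrite (_ : 1 + s = (1 - s) + s * 2); last by ring.
  by rewrite [leRHS]EFinD leeD2l// EFinM lee_wpmul2l.
have [small|large] := lerP (2 * t ^+ 2 * th ^+ 2) 1.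
- have s01 : 0 <= 2 * t ^+ 2 * th ^+ 2 <= 1.
    by rewrite small andbT; apply: mulr_ge0; [apply: mulr_ge0|]; rewrite ?sqr_ge0.
  apply: (@le_trans _ _ (1 + 2 * t ^+ 2 * th ^+ 2)%:E); last first.
    by rewrite lee_fin expR_ge1Dx.
  have iX : P.-integrable setT (EFin \o X).
    apply/integrableP; split; first exact/measurable_EFinP.
    apply: (@le_lt_trans _ _ (\int[P]_w (t * expR (Y w))%:E)%E).
      apply: integral_ler => //; [exact: measurableT_comp|exact: measurable_funM|].
      move=> w /=; have := expR_ge1Dx (Y w); have := XY w.
      rewrite -[X w ^+ 2]real_normK ?num_real//.
      have : 0 <= `|X w| by [].
      set n := `|X w|; set e := expR _ => n0 nY; rewrite -(ler_pM2l t20) => eY.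
      have : 0 <= (t - n) ^+ 2 by exact: sqr_ge0.
      have : 0 <= t * n by apply: mulr_ge0 => //; exact: ltW.
      by move=> h1 h2; rewrite -(ler_pM2l t0); lra.
    rewrite integral_mulrl//; last exact: ltW.
    by apply: lte_mul_pinfty => //; [rewrite lee_fin ltW|exact: le_lt_trans E2 (ltry _)].
  pose E w := expR (2 * t ^+ 2 * th ^+ 2 * Y w).
  have mE : measurable_fun setT E by exact: measurable_expRM.
  have iE : P.-integrable setT (EFin \o E).
    apply/integrableP; split; first exact/measurable_EFinP.
    under eq_integral do rewrite /= ger0_norm ?expR_ge0//.
    exact: le_lt_trans (mean _ s01) (ltry _).
  have ithX : P.-integrable setT (EFin \o (fun w => th * X w)).
    by have := integrableZl measurableT th iX.
  apply: (@le_trans _ _ (\int[P]_w (th * X w + E w)%:E)%E).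
    apply: integral_ler => //; first exact: measurable_expRM.
      by apply: measurable_funD => //; exact: measurable_funM.
    move=> w; apply: le_trans (expR_le_linear_square _) _.
    rewrite lerD2l /E ler_expR exprMn XY; lra.
  rewrite integralD_EFin//.
  rewrite [X in (X + _)%E](_ : _ = 0%E) ?add0e; first exact: mean.
  under eq_integral do rewrite /= EFinM.
  by rewrite integralZl// E0 mule0.
- apply: (@le_trans _ _ (\int[P]_w (expR (t ^+ 2 * th ^+ 2 / 2) * expR (2^-1 * Y w))%:E)%E).
    apply: integral_ler => //; first exact: measurable_expRM.
      by apply: measurable_funM => //; exact: measurable_expRM.
    move=> w; rewrite -expRD ler_expR.
    have sq : 0 <= (t ^+ 2 * th - X w) ^+ 2 by exact: sqr_ge0.
    by have XYw := XY w; rewrite -(ler_pM2l t20); nra.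
  rewrite integral_mulrl//; last exact: measurable_expRM.
  have h12 : 0 <= (2^-1 : R) <= 1 by apply/andP; split; lra.
  apply: (@le_trans _ _ ((expR (t ^+ 2 * th ^+ 2 / 2))%:E * (1 + 2^-1)%:E)%E).
    by apply: lee_wpmul2l; [rewrite lee_fin expR_ge0|exact: mean].
  rewrite -EFinM lee_fin.
  apply: (@le_trans _ _ (expR (t ^+ 2 * th ^+ 2 / 2) * expR 2^-1)).
    by rewrite ler_pM2l ?expR_gt0// expR_ge1Dx.
  rewrite -expRD ler_expR; lra.
Qed.

End subgaussian_theory.

Section subgaussian_integrable.
Context (R : realType) d (T : measurableType d) (P : probability T R).

Lemma subgaussian_integrable (X : T -> R) (v : R) (k : nat) :
  measurable_fun setT X -> subgaussian P v X ->
  P.-integrable setT (EFin \o (fun t => X t ^+ k)).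
Proof.
move=> mX sX; apply/integrableP; split.
  by apply/measurable_EFinP; exact: measurable_funX.
under eq_integral do rewrite /= normrX.
exact: le_lt_trans (subgaussian_moment k mX sX) (ltry _).
Qed.

Lemma integrable_EFin (X : T -> R) : P.-integrable setT (EFin \o X) ->
  exists m : R, (\int[P]_t (X t)%:E = m%:E)%E.
Proof.
move=> iX; exists (fine (\int[P]_t (X t)%:E)%E).
by rewrite fineK//; exact: integrable_fin_num.
Qed.

End subgaussian_integrable.

(** * Moments of the normal law *)

Section gaussian.
Context (R : realType).

Lemma integralZ_normal_pdf (k m s : R) : 0 <= k ->
  (\int[lebesgue_measure]_x (k * normal_pdf m s x)%:E = k%:E)%E.
Proof.
move=> k0; under eq_integral do rewrite EFinM.
have p0 (x : measurableTypeR R) : setT x -> (0 <= (normal_pdf m s x)%:E)%E.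
  by move=> _; rewrite lee_fin normal_pdf_ge0.
have mp : measurable_fun setT (fun x : measurableTypeR R => (normal_pdf m s x)%:E).
  by apply/measurable_EFinP; exact: measurable_normal_pdf.
have := @ge0_integralZl_EFin _ _ _ (@lebesgue_measure R) setT measurableT _ p0 mp k k0.
by move=> ->; rewrite integral_normal_pdf mule1.
Qed.

(** The Radon-Nikodym derivative and [normal_pdf] have the same integral over every measurable set,
    so they agree almost everywhere and one can replace the other. *)
Lemma integral_normal_prob (m s : R) (f : R -> R) : measurable_fun setT f ->
  (forall x, 0 <= f x) -> (\int[normal_prob m s]_x (f x)%:E
    = \int[lebesgue_measure]_x (f x * normal_pdf m s x)%:E)%E.
Proof.
move=> mf f0.
have dom := @normal_prob_dominates R m s.
have mfE : measurable_fun setT (EFin \o f) by exact/measurable_EFinP.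
rewrite -(@Radon_Nikodym_SigmaFinite.change_of_variables _ _ _ _
  (@lebesgue_measure R) dom (EFin \o f) setT)//.
under [RHS]eq_integral do rewrite EFinM.
apply: ae_eq_integral => //.
- apply: emeasurable_funM => //; apply: (measurable_int lebesgue_measure).
  exact: Radon_Nikodym_SigmaFinite.f_integrable.
- by apply: emeasurable_funM => //; apply/measurable_EFinP; exact: measurable_normal_pdf.
- apply: ae_eqe_mul2l => /=.
  apply: integral_ae_eq => //=.
  + exact: Radon_Nikodym_SigmaFinite.f_integrable.
  + by apply/measurable_EFinP; exact: measurable_normal_pdf.
  + move=> E _ mE; rewrite -Radon_Nikodym_SigmaFinite.f_integral//.
Qed.

Context d (T : measurableType d) (P : probability T R).

Lemma integral_normal_law (m s : R) (X : T -> R) (f : R -> R) :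
  measurable_fun setT X -> has_normal_law P m s X ->
  measurable_fun setT f -> (forall x, 0 <= f x) ->
  (\int[P]_t (f (X t))%:E = \int[lebesgue_measure]_x (f x * normal_pdf m s x)%:E)%E.
Proof.
move=> mX lX mf f0; rewrite -integral_normal_prob//.
have mX' : @measurable_fun _ _ T (measurableTypeR R) setT X by exact: mX.
pose X' : {mfun T >-> measurableTypeR R} :=
  HB.pack X (@isMeasurableFun.Build _ _ T (measurableTypeR R) X mX').
transitivity (\int[distribution P X']_x (f x)%:E)%E.
  rewrite ge0_integral_pushforward ?preimage_setT//; first exact/measurable_EFinP.
  by move=> x _; rewrite lee_fin.
by apply: eq_measure_integral => A mA _; exact: lX.
Qed.

Lemma gaussian_mgf (s : R) (X : T -> R) : measurable_fun setT X -> 0 < s ->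
  has_normal_law P 0 s X ->
  forall th, (\int[P]_t (expR (th * X t))%:E = (expR (s ^+ 2 / 2 * th ^+ 2))%:E)%E.
Proof.
move=> mX s0 lX th.
rewrite (integral_normal_law (f := fun x => expR (th * x)) mX lX)//; last first.
  by apply: measurableT_comp => //; exact: measurable_funM.
etransitivity; last exact: (integralZ_normal_pdf (th * s ^+ 2) s (expR_ge0 _)).
apply: eq_integral => x _; congr EFin.
rewrite !normal_pdfE ?gt_eqF// mulrCA [RHS]mulrCA; congr (_ * _).
rewrite /normal_fun -!expRD; congr expR; field; lra.
Qed.

(** The exponent is parametrized by [u] so that the integrand is [u] times the normal density of
    standard deviation [u s]. *)
Lemma gaussian_square_mgf (s u : R) (X : T -> R) : measurable_fun setT X -> 0 < s -> 0 < u ->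
  has_normal_law P 0 s X ->
  (\int[P]_t (expR ((1 - u ^- 2) / (2 * s ^+ 2) * X t ^+ 2))%:E = u%:E)%E.
Proof.
move=> mX s0 u0 lX.
rewrite (integral_normal_law (f := fun x => expR ((1 - u ^- 2) / (2 * s ^+ 2) * x ^+ 2)) mX lX)//; last first.
  by apply: measurableT_comp => //; apply: measurable_funM => //; exact: measurable_funX.
have us0 : 0 < u * s by rewrite mulr_gt0.
etransitivity; last exact: (integralZ_normal_pdf 0 (u * s) (ltW u0)).
apply: eq_integral => x _; congr EFin.
rewrite !normal_pdfE ?gt_eqF// mulrCA [RHS]mulrA; congr (_ * _).
  rewrite /normal_peak (_ : (u * s) ^+ 2 * pi *+ 2 = u ^+ 2 * (s ^+ 2 * pi *+ 2)); last first.
    by rewrite exprMn -mulrA mulrnAr.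
  rewrite sqrtrM ?sqr_ge0// sqrtr_sqr gtr0_norm//.
  by rewrite invfM mulrA divff ?mul1r// gt_eqF.
rewrite /normal_fun -!expRD; congr expR; field.
by apply/andP; split; lra.
Qed.

Lemma gaussian_subgaussian (s : R) (X : T -> R) : measurable_fun setT X -> 0 < s ->
  has_normal_law P 0 s X -> subgaussian P (s ^+ 2 / 2) X.
Proof. by move=> mX s0 lX th; rewrite (gaussian_mgf mX s0 lX). Qed.

(** Near [th = 0] a nonzero linear term beats a quadratic one. The explicit choice
    [th = q / (q^2 + 2a)] replaces a limit, and the claim for [- m] follows by changing the sign of
    [th]. *)
Lemma mean_eq0_of_mgf (a m : R) : 0 <= a ->
  (forall th, 1 + th * m <= expR (a * th ^+ 2)) -> m = 0.
Proof.
move=> a0.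
have key q : (forall th, 1 + th * q <= expR (a * th ^+ 2)) -> q <= 0.
  move=> h; rewrite leNgt; apply/negP => q0.
  pose D := q ^+ 2 + 2 * a.
  have q20 : 0 < q ^+ 2 by rewrite exprn_gt0.
  have D0 : 0 < D by rewrite /D; lra.
  pose th := q / D.
  have thD : th * D = q by rewrite /th divfK// gt_eqF.
  have th0 : 0 < th by rewrite divr_gt0.
  have thq : th * q <= 1 by rewrite /th mulrAC ler_pdivrMr// /D -expr2; lra.
  have ath : 2 * (a * th) <= q by rewrite -[leRHS]thD /D; nra.
  have ath2 : a * th ^+ 2 <= 2^-1 by nra.
  have e1 : expR (a * th ^+ 2) * (1 - a * th ^+ 2) <= 1.
    by rewrite -[leRHS](expRxMexpNx_1 (a * th ^+ 2)) ler_pM2l ?expR_gt0// expR_ge1Dx.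
  have e2 : (1 + th * q) * (1 - a * th ^+ 2) <= 1.
    by apply: le_trans e1; rewrite ler_wpM2r//; lra.
  have e3 : th * (q - a * th - a * th * (th * q)) <= 0 by nra.
  have e4 : 0 < q - a * th - a * th * (th * q).
    have : 0 <= a * th by rewrite mulr_ge0// ltW.
    have : 0 < th * q by rewrite mulr_gt0.
    have : 0 < D * th ^+ 2 by rewrite mulr_gt0// exprn_gt0.
    rewrite /D in thD *; nra.
  by move: e3; rewrite leNgt mulr_gt0.
move=> h; apply/eqP; rewrite eq_le key//=.
by rewrite -oppr_le0 key// => th; have := h (- th); rewrite sqrrN mulrN mulNr.
Qed.

(** Integrating [1 + th X <= e^(th X)] compares the mean with the known Laplace transform, which
    avoids integrating against the density. *)
Lemma gaussian_mean (s : R) (X : T -> R) : measurable_fun setT X -> 0 < s ->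
  has_normal_law P 0 s X -> (\int[P]_t (X t)%:E = 0)%E.
Proof.
move=> mX s0 lX.
have iX := subgaussian_integrable 1 mX (gaussian_subgaussian mX s0 lX).
have [m Em] := integrable_EFin iX.
rewrite Em; congr EFin; apply: (@mean_eq0_of_mgf (s ^+ 2 / 2)).
  by rewrite divr_ge0// sqr_ge0.
move=> th; rewrite -lee_fin -(gaussian_mgf mX s0 lX).
have ithX : P.-integrable setT (EFin \o (fun t => th * X t)).
  exact: (integrableZl measurableT th iX).
rewrite EFinD EFinM -Em -integralZl// -[X in (X + _)%E](integral_cstr P 1).
rewrite -integralD//; last exact: finite_measure_integrable_cst.
apply: le_integral => //.
- by apply: integrableD => //; exact: finite_measure_integrable_cst.
- apply/integrableP; split; first by apply/measurable_EFinP; exact: measurable_expRM.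
  under eq_integral do rewrite /= ger0_norm ?expR_ge0//.
  by rewrite (gaussian_mgf mX s0 lX) ltry.
- by move=> t _; rewrite lee_fin expR_ge1Dx.
Qed.

(** The same device with [1 + c X^2 <= e^(c X^2)], where [c] is positive for [u > 1] and negative
    for [u < 1]; the two sides of [u = 1] bound the variance from above and from below. *)
Lemma gaussian_variance (s : R) (X : T -> R) : measurable_fun setT X -> 0 < s ->
  has_normal_law P 0 s X -> (\int[P]_t (X t ^+ 2)%:E = (s ^+ 2)%:E)%E.
Proof.
move=> mX s0 lX.
have mX2 : measurable_fun setT (fun t => X t ^+ 2) by exact: measurable_funX.
have iX := subgaussian_integrable 2 mX (gaussian_subgaussian mX s0 lX).
have [m Em] := integrable_EFin iX.
have m0 : 0 <= m by rewrite -lee_fin -Em integral_ge0// => t _; rewrite lee_fin sqr_ge0.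
have s20 : 0 < s ^+ 2 by rewrite exprn_gt0.
rewrite Em; congr EFin.
have h u : 0 < u -> 1 + (1 - u ^- 2) / (2 * s ^+ 2) * m <= u.
  move=> u0; rewrite -lee_fin -(gaussian_square_mgf mX s0 u0 lX).
  set c := _ / _.
  rewrite EFinD EFinM -Em -integralZl// -[X in (X + _)%E](integral_cstr P 1).
  rewrite -integralD//; last first.
    exact: (integrableZl measurableT c iX).
    exact: finite_measure_integrable_cst.
  apply: le_integral => //.
  - apply: integrableD => //; first exact: finite_measure_integrable_cst.
    exact: (integrableZl measurableT c iX).
  - apply/integrableP; split; first by apply/measurable_EFinP; exact: measurable_expRM.
    under eq_integral do rewrite /= ger0_norm ?expR_ge0//.
    by rewrite (gaussian_square_mgf mX s0 u0 lX) ltry.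
  - by move=> t _; rewrite lee_fin expR_ge1Dx.
have [q qE] : exists q, q = m / s ^+ 2 by exists (m / s ^+ 2).
have q0 : 0 <= q by rewrite qE divr_ge0// ltW.
have hq u : 0 < u -> (u - 1) * (u + 1) * q <= 2 * (u - 1) * u ^+ 2.
  move=> u0; have := h u u0.
  have -> : (1 - u ^- 2) / (2 * s ^+ 2) * m = (u - 1) * (u + 1) * q / (2 * u ^+ 2).
    by rewrite qE; field; rewrite !gt_eqF.
  have u20 : 0 < u ^+ 2 by rewrite exprn_gt0.
  by rewrite addrC -lerBrDr ler_pdivrMr; nra.
(* After division by [u - 1], the limit [u -> 1] is replaced by an explicit [u = 1 + e] or
   [u = 1 - e] depending on the sign of [q - 1]. *)
have q1 : q = 1.
  apply/eqP; rewrite eq_le; apply/andP; split; rewrite leNgt; apply/negP => ql.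
    have [e [e0 e1 e2]] : exists e, [/\ 0 < e, e <= 1 & 4 * e <= q - 1].
      have D0 : 0 < q + 3 by lra.
      exists ((q - 1) / (q + 3)); split; first by apply: divr_gt0; lra.
        by rewrite ler_pdivrMr//; lra.
      by rewrite mulrA ler_pdivrMr//; nra.
    have := hq (1 + e) _; rewrite (_ : 0 < 1 + e); last lra.
    move=> /(_ isT); rewrite (_ : 1 + e - 1 = e) ?mulrA; last ring.
    rewrite -!mulrA [leRHS]mulrCA ler_pM2l// => hh.
    have : 0 <= e * (q - 1 - 4 * e) by apply: mulr_ge0; lra.
    nra.
  have [e [e0 e1 e2]] : exists e, [/\ 0 < e, e <= 2^-1 & 8 * e <= 1 - q].
    by exists ((1 - q) / 8); split; lra.
  have := hq (1 - e) _; rewrite (_ : 0 < 1 - e); last lra.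
  move=> /(_ isT); rewrite (_ : 1 - e - 1 = - e); last ring.
  rewrite -!mulrA [leRHS]mulrCA ler_nM2l ?oppr_lt0// => hh.
  have : 0 <= e * (1 - q - 8 * e) by apply: mulr_ge0; lra.
  have : 0 <= e * (2^-1 - e) by apply: mulr_ge0; lra.
  nra.
by move: q1; rewrite qE => /(congr1 (fun x => x * s ^+ 2)); rewrite divfK ?gt_eqF// mul1r.
Qed.

End gaussian.

(** * Derivatives of the smoothed soft minimum *)

Section one_variable_calculus.
Context (R : realType).
Implicit Types (f g : R -> R) (x a b : R).

Lemma is_derive_addr f g x a b : is_derive x 1 f a -> is_derive x 1 g b ->
  is_derive x 1 (fun y => f y + g y) (a + b).
Proof. by move=> df dg; exact: is_deriveD. Qed.

Lemma is_derive_mulr f g x a b : is_derive x 1 f a -> is_derive x 1 g b ->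
  is_derive x 1 (fun y => f y * g y) (a * g x + f x * b).
Proof.
move=> df dg; have h := is_deriveM df dg.
by apply: is_derive_eq h _; rewrite addrC; congr (_ + _); rewrite /GRing.scale/= mulrC.
Qed.

Lemma is_derive_mulrl f (k : R) x a : is_derive x 1 f a ->
  is_derive x 1 (fun y => k * f y) (k * a).
Proof. by move=> df; exact: is_deriveZ. Qed.

Lemma is_derive_sumr (C : Type) (s : seq C) (h : C -> R -> R) (dh : C -> R) x :
  (forall c, is_derive x 1 (h c) (dh c)) ->
  is_derive x 1 (fun y => \sum_(c <- s) h c y) (\sum_(c <- s) dh c).
Proof.
move=> dH; elim: s => [|c s IH].
  rewrite big_nil; under eq_fun do rewrite big_nil; exact: is_derive_cst.
by rewrite big_cons; under eq_fun do rewrite big_cons; exact: is_derive_addr.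
Qed.

Lemma is_derive_expR_comp f x a : is_derive x 1 f a ->
  is_derive x 1 (fun y => expR (f y)) (a * expR (f x)).
Proof.
move=> df; have h := is_derive1_comp (is_derive_expR (f x)) df.
by apply: is_derive_eq h _; rewrite mulrC.
Qed.

Lemma is_derive_ln_comp f x a : 0 < f x -> is_derive x 1 f a ->
  is_derive x 1 (fun y => ln (f y)) (a / f x).
Proof.
move=> f0 df; have h := is_derive1_comp (is_derive1_ln f0) df.
by apply: is_derive_eq h _; rewrite mulrC.
Qed.

Lemma is_derive_invr f x a : f x != 0 -> is_derive x 1 f a ->
  is_derive x 1 (fun y => (f y)^-1) (- (a / f x ^+ 2)).
Proof.
move=> f0 df; have h := is_deriveV f0 df.
by apply: is_derive_eq h _; rewrite /GRing.scale/= mulNr mulrC.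
Qed.

Lemma norm_increment_le f (df : R -> R) (B x : R) :
  (forall y : R, is_derive y 1 f (df y)) -> (forall y, `|y| <= `|x| -> `|df y| <= B) ->
  `|f x - f 0| <= B * `|x|.
Proof.
move=> dF dB.
have cf : continuous f.
  by move=> y; apply/differentiable_continuous/derivable1_diffP; have [] := dF y.
have [x0|x0] := lerP 0 x.
  have [c + ->] := MVT_segment x0 (fun y _ => dF y) (continuous_subspaceT cf).
  rewrite in_itv/= subr0 => /andP[c0 cx]; rewrite normrM ler_wpM2r// dB//.
  by rewrite !ger0_norm.
have [c + E] := MVT_segment (ltW x0) (fun y _ => dF y) (continuous_subspaceT cf).
rewrite in_itv/= => /andP[xc c0]; rewrite -normrN opprB E sub0r normrM normrN.
rewrite ler_wpM2r// dB// (ler0_norm c0) ltr0_norm//; lra.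
Qed.

(** Three uses of the mean value inequality, each gaining a factor [|x|]. The constant 1 instead of
    1/6 is the price of not integrating the remainder. *)
Lemma taylor2_remainder f f1 f2 f3 (D x : R) :
  (forall y : R, is_derive y 1 f (f1 y)) -> (forall y : R, is_derive y 1 f1 (f2 y)) ->
  (forall y : R, is_derive y 1 f2 (f3 y)) -> 
  (forall y, `|y| <= `|x| -> `|f3 y| <= D) ->
  `|f x - f 0 - f1 0 * x - f2 0 / 2 * x ^+ 2| <= D * `|x| ^+ 3.
Proof.
move=> d1 d2 d3 D3.
have D0 : 0 <= D by apply: le_trans (D3 0 _); rewrite ?normr0.
have h2 y : `|y| <= `|x| -> `|f2 y - f2 0| <= D * `|x|.
  move=> yx; apply: (@le_trans _ _ (D * `|y|)); last by rewrite ler_wpM2l.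
  by apply: norm_increment_le d3 _ => z zy; apply: D3; exact: le_trans yx.
have dlin (k y : R) : is_derive y 1 (fun z => k * z) k.
  by apply: is_derive_eq (is_derive_mulrl k (is_derive_id y 1)) _; rewrite mulr1.
have h1 y : `|y| <= `|x| -> `|f1 y - f1 0 - f2 0 * y| <= D * `|x| ^+ 2.
  move=> yx; have dG (z : R) : is_derive z 1 (fun z => f1 z - f2 0 * z) (f2 z - f2 0).
    by apply: is_derive_addr => //; have := dlin (- f2 0) z; under eq_fun do rewrite mulNr.
  have := @norm_increment_le _ _ (D * `|x|) y dG.
  rewrite mulr0 subr0 (_ : f1 y - f2 0 * y - f1 0 = f1 y - f1 0 - f2 0 * y); last by ring.
  move=> /(_ _)/le_trans; apply; first by move=> z zy; apply: h2; exact: le_trans yx.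
  by rewrite expr2 mulrA ler_wpM2l// mulr_ge0.
have dF (z : R) : is_derive z 1 (fun z => f z + ((- f1 0) * z + (- (f2 0 / 2)) * (z * z)))
    (f1 z - f1 0 - f2 0 * z).
  have h := is_derive_addr (d1 z) (is_derive_addr (dlin (- f1 0) z)
    (is_derive_mulrl (- (f2 0 / 2)) (is_derive_mulr (is_derive_id z 1) (is_derive_id z 1)))).
  by apply: is_derive_eq h _; field.
have := @norm_increment_le _ _ (D * `|x| ^+ 2) x dF.
rewrite !mulr0 !addr0 (_ : f x + _ - f 0 = f x - f 0 - f1 0 * x - f2 0 / 2 * x ^+ 2); last by ring.
by move=> /(_ h1); rewrite (_ : D * `|x| ^+ 3 = D * `|x| ^+ 2 * `|x|) //; ring.
Qed.

End one_variable_calculus.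

(** * Gibbs averages and the logistic function *)

Section gibbs_averages.
Context (R : realType) (C : finType) (c0 : C).
Implicit Types (u g h : C -> R).

Lemma gibbs_sum_gt0 u : (forall c, 0 < u c) -> 0 < \sum_c u c.
Proof.
move=> u0; rewrite (bigD1 c0)//=; apply: ltr_pwDl => //.
by apply: sumr_ge0 => c _; exact: ltW.
Qed.

(* Chebyshev's association inequality: tilting by [g] lowers the average of any [h]
   oppositely ordered to [g]. *)
Lemma gibbs_association u g h : (forall c, 0 < u c) -> (forall c, 0 < g c) ->
  (forall c d, (g c - g d) * (h c - h d) <= 0) ->
  (\sum_c u c * g c * h c) / (\sum_c u c * g c) <= (\sum_c u c * h c) / (\sum_c u c).
Proof.
move=> u0 g0 gh.
have U0 := gibbs_sum_gt0 u0.
have V0 : 0 < \sum_c u c * g c by apply: gibbs_sum_gt0 => c; exact: mulr_gt0.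
rewrite ler_pdivrMr// mulrAC ler_pdivlMr//.
(* Expanded, this symmetrized double sum is twice the difference of the two cross-multiplied
   sides. *)
have : \sum_c \sum_d u c * u d * ((g c - g d) * (h c - h d)) <= 0.
  apply: sumr_le0 => c _; apply: sumr_le0 => d _.
  by rewrite mulr_ge0_le0// mulr_ge0// ltW.
pose S a b : R := (\sum_c u c * a c) * (\sum_d u d * b d).
have SE a b : S a b = \sum_c \sum_d u c * u d * (a c * b d).
  rewrite /S big_distrlr/=; apply: eq_bigr => c _; apply: eq_bigr => d _; ring.
rewrite (_ : \sum_c _ = S (fun c => g c * h c) (fun=> 1) - S g h - S h g
    + S (fun=> 1) (fun c => g c * h c)); last first.
  rewrite !SE -!sumrB -big_split/=; apply: eq_bigr => c _.
  rewrite -!sumrB -big_split/=; apply: eq_bigr => d _; ring.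
have E1 : \sum_c u c * 1 = \sum_c u c by apply: eq_bigr => c _; rewrite mulr1.
have E2 : \sum_c u c * (g c * h c) = \sum_c u c * g c * h c.
  by apply: eq_bigr => c _; rewrite mulrA.
rewrite /S E1 E2; nra.
Qed.

End gibbs_averages.

(** The logistic function serves as smooth indicator: at least 1/2 on the positive half-line, at
    most [e^y] on the negative one, with derivatives that are polynomials in itself. *)
Definition sigmoid (R : realType) (y : R) : R := (1 + expR (- y))^-1.

Section sigmoid_theory.
Context (R : realType).
Implicit Types y : R.

Lemma sigmoid_gt0 y : 0 < sigmoid y.
Proof. by rewrite invr_gt0 addr_gt0// expR_gt0. Qed.

Lemma sigmoid_le1 y : sigmoid y <= 1.
Proof. by rewrite invf_le1 ?addr_gt0 ?expR_gt0// lerDl expR_ge0. Qed.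

Lemma sigmoid_le_expR y : sigmoid y <= expR y.
Proof.
rewrite -[leRHS]invrK -expRN lef_pV2 ?posrE ?addr_gt0 ?expR_gt0//.
by rewrite lerDr.
Qed.

Lemma sigmoid_ge_half y : 0 <= y -> 2^-1 <= sigmoid y.
Proof.
move=> y0; rewrite lef_pV2 ?posrE ?addr_gt0 ?expR_gt0//.
by have : expR (- y) <= 1; [rewrite expR_le1 oppr_le0|lra].
Qed.

Lemma measurable_sigmoid : measurable_fun setT (@sigmoid R).
Proof.
apply: nondecreasing_measurable => // x y xy.
rewrite lef_pV2 ?posrE ?addr_gt0 ?expR_gt0// lerD2l ler_expR; lra.
Qed.

Lemma is_derive_sigmoid f (x a : R) : is_derive x 1 f a ->
  is_derive x 1 (fun y => sigmoid (f y))
    (a * (sigmoid (f x) * (1 - sigmoid (f x)))).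
Proof.
move=> df.
have dm : is_derive x 1 (fun y => -1 * f y) (-1 * a) by exact: is_derive_mulrl.
have de := is_derive_addr (is_derive_cst (1 : R) x 1) (is_derive_expR_comp dm).
have e0 : 1 + expR (- f x) != 0 by rewrite gt_eqF// addr_gt0// expR_gt0.
have e0' : cst 1 x + expR (-1 * f x) != 0 by rewrite /= mulN1r.
have h := @is_derive_invr _ (fun y => cst 1 y + expR (-1 * f y)) x _ e0' de.
have -> : (fun y => sigmoid (f y)) = (fun y => (cst 1 y + expR (-1 * f y))^-1).
  by apply/funext => y; rewrite /sigmoid /= mulN1r.
by apply: is_derive_eq h _; rewrite /sigmoid /= !mulN1r; field.
Qed.

End sigmoid_theory.

Section gibbs_moments.
Context (R : realType) (C : finType) (c0 : C) (u : C -> R).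
Hypothesis u0 : forall c, 0 < u c.
Let Z := \sum_c u c.
Definition gibbs_avg (h : C -> R) : R := (\sum_c u c * h c) / \sum_c u c.

Let Z0 : 0 < Z. Proof. exact: gibbs_sum_gt0. Qed.

Lemma gibbs_avg_le h1 h2 : (forall c, h1 c <= h2 c) -> gibbs_avg h1 <= gibbs_avg h2.
Proof.
move=> h12; rewrite /gibbs_avg ler_wpM2r ?invr_ge0 ?(ltW Z0)//.
by apply: ler_sum => c _; rewrite ler_wpM2l// ltW.
Qed.

Lemma gibbs_avg_ge0 h : (forall c, 0 <= h c) -> 0 <= gibbs_avg h.
Proof.
move=> h0; rewrite /gibbs_avg mulr_ge0 ?invr_ge0 ?(ltW Z0)// sumr_ge0// => c _.
by rewrite mulr_ge0// ltW.
Qed.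

Lemma norm_gibbs_avg h : `|gibbs_avg h| <= gibbs_avg (fun c => `|h c|).
Proof.
rewrite /gibbs_avg normrM [`|_^-1|]ger0_norm ?invr_ge0 ?(ltW Z0)//.
rewrite ler_wpM2r ?invr_ge0 ?(ltW Z0)//; apply: le_trans (ler_norm_sum _ _ _) _.
by apply: ler_sum => c _; rewrite normrM gtr0_norm.
Qed.

Lemma gibbs_avgD h1 h2 : gibbs_avg (fun c => h1 c + h2 c) = gibbs_avg h1 + gibbs_avg h2.
Proof.
rewrite /gibbs_avg -mulrDl -big_split/=; congr (_ / _).
by apply: eq_bigr => c _; rewrite mulrDr.
Qed.

Lemma gibbs_avgZ k h : gibbs_avg (fun c => k * h c) = k * gibbs_avg h.
Proof.
by rewrite /gibbs_avg mulrA mulr_sumr; congr (_ / _); apply: eq_bigr => c _; rewrite mulrCA.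
Qed.

Lemma gibbs_avg_cst k : gibbs_avg (fun=> k) = k.
Proof. by rewrite /gibbs_avg -mulr_suml mulrAC divff ?mul1r// gt_eqF. Qed.

Lemma gibbs_avg_sqr_le h : gibbs_avg h ^+ 2 <= gibbs_avg (fun c => h c ^+ 2).
Proof.
set m := gibbs_avg h.
have : gibbs_avg (fun c => m ^+ 2 * 1 + (2 * m) * (h c + - m)) <= gibbs_avg (fun c => h c ^+ 2).
  by apply: gibbs_avg_le => c; have := sqr_ge0 (h c - m); nra.
rewrite gibbs_avgD !gibbs_avgZ gibbs_avg_cst gibbs_avgD gibbs_avg_cst -/m; lra.
Qed.

(** Pointwise [x * y^2 <= x^3 + y^3], since the cube of the larger number dominates; this is
    averaged over two independent draws. *)
Lemma gibbs_avg_mul_sqr_le h : (forall c, 0 <= h c) ->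
  gibbs_avg h * gibbs_avg (fun c => h c ^+ 2) <= 2 * gibbs_avg (fun c => h c ^+ 3).
Proof.
move=> h0; set m2 := gibbs_avg (fun c => h c ^+ 2); set m3 := gibbs_avg (fun c => h c ^+ 3).
rewrite mulrC -gibbs_avgZ.
apply: (@le_trans _ _ (gibbs_avg (fun c => m3 + h c ^+ 3))); last first.
  by rewrite gibbs_avgD gibbs_avg_cst -/m3; lra.
apply: gibbs_avg_le => c; rewrite mulrC -gibbs_avgZ.
apply: (@le_trans _ _ (gibbs_avg (fun d => h d ^+ 3 + h c ^+ 3))); last first.
  by rewrite gibbs_avgD gibbs_avg_cst.
apply: gibbs_avg_le => d; have := h0 c; have := h0 d.
move: (h c) (h d) => x y y0 x0.
have [xy|/ltW yx] := lerP x y.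
  apply: (@le_trans _ _ (y ^+ 3)); last by rewrite lerDl exprn_ge0.
  by rewrite [leRHS]exprS ler_wpM2r// exprn_ge0.
apply: (@le_trans _ _ (x ^+ 3)); last by rewrite lerDr exprn_ge0.
by rewrite [leRHS]exprS ler_wpM2l// lerXn2r.
Qed.

End gibbs_moments.

Section norm_bounds.
Context (R : realType).
Implicit Types x y X Y : R.

Lemma norm_mul_le x y X Y : `|x| <= X -> `|y| <= Y -> `|x * y| <= X * Y.
Proof. by move=> hx hy; rewrite normrM ler_pM. Qed.

Lemma norm_add_le x y X Y : `|x| <= X -> `|y| <= Y -> `|x + y| <= X + Y.
Proof. by move=> hx hy; apply: le_trans (ler_normD _ _) _; exact: lerD. Qed.

Lemma norm_sub_le x y X Y : `|x| <= X -> `|y| <= Y -> `|x - y| <= X + Y.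
Proof. by move=> hx hy; apply: norm_add_le => //; rewrite normrN. Qed.

Lemma cube_add_le x y : `|x + y| ^+ 3 <= 4 * (`|x| ^+ 3 + `|y| ^+ 3).
Proof.
apply: (@le_trans _ _ ((`|x| + `|y|) ^+ 3)); first by rewrite lerXn2r ?nnegrE ?addr_ge0// ler_normD.
have : 0 <= `|x| by []. have : 0 <= `|y| by [].
move: `|x| `|y| => p q q0 p0.
have h1 := sqr_ge0 (p - q).
have h2 : 0 <= (p + q) * (p - q) ^+ 2 by apply: mulr_ge0; [lra|].
lra.
Qed.

Lemma le_1D_cube x : 0 <= x -> x <= 1 + x ^+ 3.
Proof.
move=> x0; have h : 0 <= x * (x - 1) ^+ 2 by rewrite mulr_ge0// sqr_ge0.
have := sqr_ge0 (x - 2^-1); nra.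
Qed.

End norm_bounds.

(** * The test function as a function of one entry *)

Section softmin_calculus.
Context (R : realType) (C : finType) (c0 : C).
Variables (r w k : C -> R) (b L th a : R).
Hypotheses (b1 : 1 <= b) (L1 : 1 <= L) (wL : forall c, `|w c| <= L) (th1 : `|th| <= 1).

(** Only one entry [x] varies: [n c x] is the residual of its row at net point [c], and [k c]
    collects the other rows and the penalty. [q] and [s] are the first two derivatives of the
    log-weight; [Zi], [yi], [Si], [fi] are the i-th derivatives of the partition function, of its
    logarithm, of the sigmoid at its argument, and of [f]. *)
Let n c (x : R) := r c + x * w c.
Let u c (x : R) := expR (- (b / 2 * n c x ^+ 2 + k c)).
Let q c (x : R) := - b * (n c x * w c).
Let s c := - b * w c ^+ 2.
Let Z0 (x : R) := \sum_c u c x.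
Let Z1 (x : R) := \sum_c u c x * q c x.
Let Z2 (x : R) := \sum_c u c x * (q c x ^+ 2 + s c).
Let Z3 (x : R) := \sum_c u c x * (q c x ^+ 3 + 3 * q c x * s c).
Let y1 (x : R) := Z1 x / Z0 x.
Let y2 (x : R) := Z2 x / Z0 x - y1 x ^+ 2.
Let y3 (x : R) := Z3 x / Z0 x - Z2 x / Z0 x * y1 x - 2 * y1 x * y2 x.
Let f (x : R) := sigmoid (th * ln (Z0 x) + a).
Let S1 (x : R) := f x * (1 - f x).
Let S2 (x : R) := S1 x * (1 - 2 * f x).
Let S3 (x : R) := S2 x * (1 - 2 * f x) - 2 * S1 x ^+ 2.
Let f1 (x : R) := S1 x * (th * y1 x).
Let f2 (x : R) := S2 x * (th * y1 x) ^+ 2 + S1 x * (th * y2 x).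
Let f3 (x : R) := S3 x * (th * y1 x) ^+ 3 + 3 * S2 x * (th * y1 x) * (th * y2 x)
  + S1 x * (th * y3 x).

Let u_gt0 x c : 0 < u c x. Proof. exact: expR_gt0. Qed.
Let Z0_gt0 x : 0 < Z0 x. Proof. by apply: gibbs_sum_gt0 => //; exact: u_gt0. Qed.

Let dn c (x : R) : is_derive x 1 (n c) (w c).
Proof.
have h := is_derive_addr (is_derive_cst (r c) x 1) (is_derive_mulrl (w c) (is_derive_id x 1)).
have E : n c = (fun y => cst (r c) y + w c * id y) by apply/funext => y; rewrite /n mulrC.
by rewrite E; apply: is_derive_eq h _; rewrite add0r mulr1.
Qed.

Let dq c (x : R) : is_derive x 1 (q c) (s c).
Proof.
have h := is_derive_mulrl (- b * w c) (dn c x).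
have E : q c = (fun y => - b * w c * n c y) by apply/funext => y; rewrite /q; ring.
by rewrite E; apply: is_derive_eq h _; rewrite /s; ring.
Qed.

Let du c (x : R) : is_derive x 1 (u c) (u c x * q c x).
Proof.
have h := is_derive_expR_comp (is_derive_addr
  (is_derive_mulrl (- (b / 2)) (is_derive_mulr (dn c x) (dn c x))) (is_derive_cst (- k c) x 1)).
have E : u c = (fun y => expR (- (b / 2) * (n c y * n c y) + cst (- k c) y)).
  by apply/funext => y; rewrite /u; congr expR; rewrite /=; ring.
by rewrite E; apply: is_derive_eq h _; rewrite /q /=; field.
Qed.

Let dZ0 (x : R) : is_derive x 1 Z0 (Z1 x).
Proof. by apply: is_derive_sumr => c; exact: du. Qed.

Let dZ1 (x : R) : is_derive x 1 Z1 (Z2 x).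
Proof.
apply: is_derive_sumr => c.
by apply: is_derive_eq (is_derive_mulr (du c x) (dq c x)) _; ring.
Qed.

Let dZ2 (x : R) : is_derive x 1 Z2 (Z3 x).
Proof.
apply: is_derive_sumr => c.
have h := is_derive_mulr (du c x)
  (is_derive_addr (is_derive_mulr (dq c x) (dq c x)) (is_derive_cst (s c) x 1)).
have E : (fun y => u c y * (q c y ^+ 2 + s c)) =
    (fun y => u c y * (q c y * q c y + cst (s c) y)).
  by apply/funext => y; rewrite expr2.
by rewrite E; apply: is_derive_eq h _; rewrite /=; ring.
Qed.

Let dV (x : R) : is_derive x 1 (fun y => (Z0 y)^-1) (- (Z1 x / Z0 x ^+ 2)).
Proof. by apply: is_derive_invr => //; rewrite gt_eqF. Qed.

Let dy1 (x : R) : is_derive x 1 y1 (y2 x).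
Proof.
apply: is_derive_eq (is_derive_mulr (dZ1 x) (dV x)) _.
by rewrite /y2 /y1; field; rewrite gt_eqF.
Qed.

Let dy2 (x : R) : is_derive x 1 y2 (y3 x).
Proof.
have h := is_derive_addr (is_derive_mulr (dZ2 x) (dV x))
  (is_derive_mulrl (-1) (is_derive_mulr (dy1 x) (dy1 x))).
have E : y2 = (fun y => Z2 y * (Z0 y)^-1 + -1 * (y1 y * y1 y)).
  by apply/funext => y; rewrite /y2; ring.
rewrite E; apply: is_derive_eq h _; rewrite /y3 /y1; field; by rewrite gt_eqF.
Qed.

Let df0 (x : R) : is_derive x 1 f (f1 x).
Proof.
have h := is_derive_sigmoid (is_derive_addr
  (is_derive_mulrl th (is_derive_ln_comp (Z0_gt0 x) (dZ0 x))) (is_derive_cst a x 1)).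
by apply: is_derive_eq h _; rewrite /f1 /S1 /f /y1 /=; ring.
Qed.

Let dS1 (x : R) : is_derive x 1 S1 (S2 x * (th * y1 x)).
Proof.
have h := is_derive_mulr (df0 x)
  (is_derive_addr (is_derive_cst (1 : R) x 1) (is_derive_mulrl (-1) (df0 x))).
have E : S1 = (fun y => f y * (cst 1 y + -1 * f y)).
  by apply/funext => y; rewrite /S1 /= mulN1r.
by rewrite E; apply: is_derive_eq h _; rewrite /f1 /S2 /S1 /=; ring.
Qed.

Let dS2 (x : R) : is_derive x 1 S2 (S3 x * (th * y1 x)).
Proof.
have h := is_derive_mulr (dS1 x)
  (is_derive_addr (is_derive_cst (1 : R) x 1) (is_derive_mulrl (-2) (df0 x))).
have E : S2 = (fun y => S1 y * (cst 1 y + -2 * f y)).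
  by apply/funext => y; rewrite /S2 /=; ring.
by rewrite E; apply: is_derive_eq h _; rewrite /f1 /S3 /S2 /=; ring.
Qed.

Let df1 (x : R) : is_derive x 1 f1 (f2 x).
Proof.
apply: is_derive_eq (is_derive_mulr (dS1 x) (is_derive_mulrl th (dy1 x))) _.
by rewrite /f2; ring.
Qed.

Let df2 (x : R) : is_derive x 1 f2 (f3 x).
Proof.
have t1 := is_derive_mulrl th (dy1 x).
have h := is_derive_addr (is_derive_mulr (dS2 x) (is_derive_mulr t1 t1))
  (is_derive_mulr (dS1 x) (is_derive_mulrl th (dy2 x))).
have E : f2 = (fun y => S2 y * (th * y1 y * (th * y1 y)) + S1 y * (th * y2 y)).
  by apply/funext => y; rewrite /f2 expr2.
by rewrite E; apply: is_derive_eq h _; rewrite /f3; ring.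
Qed.

Let M j (x : R) := gibbs_avg (u ^~ x) (fun c => `|q c x| ^+ j).
Let S := b * L ^+ 2.
Let N3 (x : R) := gibbs_avg (u ^~ x) (fun c => `|n c x| ^+ 3).

Let b0 : 0 <= b. Proof. exact: le_trans b1. Qed.
Let L0 : 0 <= L. Proof. exact: le_trans L1. Qed.
Let S_ge0 : 0 <= S. Proof. by rewrite mulr_ge0// exprn_ge0. Qed.

Let M_ge0 j x : 0 <= M j x.
Proof. by apply: gibbs_avg_ge0 => // c; rewrite exprn_ge0. Qed.

Let N3_ge0 x : 0 <= N3 x.
Proof. by apply: gibbs_avg_ge0 => // c; rewrite exprn_ge0. Qed.

Let s_le c : `|s c| <= S.
Proof.
rewrite /s normrM normrN normrX (ger0_norm b0) ler_wpM2l// lerXn2r// nnegrE//.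
Qed.

Let y1_le x : `|y1 x| <= M 1 x.
Proof. exact: norm_gibbs_avg. Qed.

Let Z2_le x : `|Z2 x / Z0 x| <= M 2 x + S.
Proof.
apply: le_trans (norm_gibbs_avg c0 (u_gt0 x) _) _.
rewrite -(gibbs_avg_cst c0 (u_gt0 x) S) -gibbs_avgD; apply: gibbs_avg_le => // c.
by apply: norm_add_le => //; rewrite normrX.
Qed.

Let Z3_le x : `|Z3 x / Z0 x| <= M 3 x + 3 * S * M 1 x.
Proof.
apply: le_trans (norm_gibbs_avg c0 (u_gt0 x) _) _.
rewrite -gibbs_avgZ -gibbs_avgD; apply: gibbs_avg_le => // c.
apply: norm_add_le; first by rewrite normrX.
rewrite expr1 (mulrAC 3 S); apply: norm_mul_le => //.
by rewrite normrM ger0_norm.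
Qed.

Let f01 x : 0 <= f x <= 1.
Proof. by rewrite ltW ?sigmoid_gt0// sigmoid_le1. Qed.

Let S1_le x : `|S1 x| <= 1.
Proof. by rewrite ler_norml /S1; have /andP[f0' f1'] := f01 x; apply/andP; split; nra. Qed.

Let S2_le x : `|S2 x| <= 1.
Proof.
rewrite -[1]mulr1; apply: norm_mul_le; first exact: S1_le.
by rewrite ler_norml; have /andP[? ?] := f01 x; apply/andP; split; lra.
Qed.

Let S3_le x : `|S3 x| <= 1.
Proof.
rewrite ler_norml /S3 /S2; have /andP[f0' f1'] := f01 x.
have h1 : 0 <= S1 x by rewrite mulr_ge0//; lra.
have h2 : S1 x <= 4^-1 by have := sqr_ge0 (f x - 2^-1); rewrite /S1; nra.
have h3 : 0 <= (1 - 2 * f x) ^+ 2 <= 1 by rewrite sqr_ge0/=; nra.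
move: h1 h2 h3; rewrite -mulrA -expr2; set v := (1 - 2 * f x) ^+ 2.
by move=> h1 h2 /andP[h3 h4]; apply/andP; split; nra.
Qed.

Let y2_le x : `|y2 x| <= 2 * M 2 x + S.
Proof.
have := norm_sub_le (Z2_le x) (lexx `|y1 x ^+ 2|); rewrite normrX.
have : `|y1 x| ^+ 2 <= M 2 x.
  apply: (@le_trans _ _ (M 1 x ^+ 2)).
    by rewrite lerXn2r ?nnegrE// y1_le.
  exact: gibbs_avg_sqr_le.
rewrite -/(y2 x); lra.
Qed.

Let y3_le x : `|y3 x| <= M 3 x + 3 * S * M 1 x + (M 2 x + S) * M 1 x
  + 2 * M 1 x * (2 * M 2 x + S).
Proof.
apply: norm_sub_le; first apply: norm_sub_le => //.
  by apply: norm_mul_le.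
by apply: norm_mul_le => //; apply: norm_mul_le => //; rewrite ger0_norm.
Qed.

Let M12 x : M 1 x * M 2 x <= 2 * M 3 x.
Proof. exact: gibbs_avg_mul_sqr_le. Qed.

Let M111 x : M 1 x ^+ 3 <= 2 * M 3 x.
Proof.
apply: le_trans (M12 x); rewrite exprS ler_wpM2l ?M_ge0//; exact: gibbs_avg_sqr_le.
Qed.

(** Every term of [f3] contains [th]; as [|th| <= 1], one power is kept, and it matters because [th]
    will be of order [1/m]. Products of moments reduce to [M 3] and [S * M 1]; the three summands
    contribute [25 = 2 + 12 + 11] and [9 = 0 + 3 + 6]. *)
Let f3_le x : `|f3 x| <= `|th| * (25 * M 3 x + 9 * (S * M 1 x)).
Proof.
have t0 : 0 <= `|th| by [].
have hy1 : `|th * y1 x| <= `|th| * M 1 x by exact: norm_mul_le.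
have hy2 : `|th * y2 x| <= `|th| * (2 * M 2 x + S) by exact: norm_mul_le.
have hy3 := norm_mul_le (lexx `|th|) (y3_le x).
have t2 : `|th| ^+ 2 <= `|th| by rewrite expr2 ler_piMl.
have t3 : `|th| ^+ 3 <= `|th| by rewrite exprS ler_piMr// exprn_ile1.
have h3 : `|S3 x * (th * y1 x) ^+ 3| <= 1 * (`|th| * M 1 x) ^+ 3.
  by apply: norm_mul_le => //; rewrite normrX lerXn2r// nnegrE mulr_ge0 ?M_ge0.
have h2 : `|3 * S2 x * (th * y1 x) * (th * y2 x)| <=
    3 * 1 * (`|th| * M 1 x) * (`|th| * (2 * M 2 x + S)).
  apply: norm_mul_le => //; apply: norm_mul_le => //; apply: norm_mul_le => //.
  by rewrite ger0_norm.
have h1 := norm_mul_le (S1_le x) hy3.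
apply: le_trans (norm_add_le (norm_add_le h3 h2) h1) _.
have e3 : (`|th| * M 1 x) ^+ 3 <= `|th| * M 1 x ^+ 3.
  by rewrite exprMn ler_wpM2r// exprn_ge0// M_ge0.
have e2 : `|th| * M 1 x * (`|th| * (2 * M 2 x + S)) <= `|th| * (M 1 x * (2 * M 2 x + S)).
  rewrite (_ : _ * _ = `|th| ^+ 2 * (M 1 x * (2 * M 2 x + S))); last by ring.
  by rewrite ler_wpM2r// mulr_ge0 ?M_ge0// addr_ge0// mulr_ge0 ?M_ge0.
have m3 : `|th| * M 1 x ^+ 3 <= `|th| * (2 * M 3 x) by rewrite ler_wpM2l.
have m12 : `|th| * (M 1 x * M 2 x) <= `|th| * (2 * M 3 x) by rewrite ler_wpM2l.
lra.
Qed.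

Let q_le x c : `|q c x| <= b * L * `|n c x|.
Proof.
rewrite /q normrM normrN (ger0_norm b0) -mulrA ler_wpM2l// normrM mulrC ler_wpM2r//.
Qed.

Let M3_le x : M 3 x <= b ^+ 3 * L ^+ 3 * N3 x.
Proof.
rewrite /M /N3 -gibbs_avgZ; apply: gibbs_avg_le => // c.
by rewrite -exprMn -exprMn lerXn2r ?nnegrE// !mulr_ge0.
Qed.

Let SM1_le x : S * M 1 x <= b ^+ 3 * L ^+ 3 * (1 + N3 x).
Proof.
have h : M 1 x <= b * L * (1 + N3 x).
  rewrite -{1}(gibbs_avg_cst c0 (u_gt0 x) 1) -gibbs_avgD -gibbs_avgZ; apply: gibbs_avg_le => // c.
  rewrite expr1; apply: le_trans (q_le x c) _.
  by rewrite ler_wpM2l ?mulr_ge0// le_1D_cube.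
have N0 : 0 <= 1 + N3 x by rewrite addr_ge0.
apply: (@le_trans _ _ (S * (b * L * (1 + N3 x)))); first by rewrite ler_wpM2l.
rewrite (_ : S * _ = b ^+ 2 * L ^+ 3 * (1 + N3 x)); last by rewrite /S; ring.
rewrite ler_wpM2r// ler_wpM2r ?exprn_ge0// [leRHS]exprS ler_peMl// exprn_ge0//.
Qed.

Let v c := expR (- k c).
Let v_gt0 c : 0 < v c. Proof. exact: expR_gt0. Qed.

(** The weight [u] is [v] times a factor [g] that decreases in [|n c x|], whereas [|n c x|^3]
    increases. Tilting [v] by [g] therefore lowers the average, so the average under [v], where the
    row is absent, is an upper bound. *)
Let N3_le x : N3 x <= 4 * (gibbs_avg v (fun c => `|r c| ^+ 3) + L ^+ 3 * `|x| ^+ 3).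
Proof.
apply: (@le_trans _ _ (gibbs_avg v (fun c => `|n c x| ^+ 3))).
  pose g c := expR (- (b / 2 * n c x ^+ 2)).
  have ug c : u c x = v c * g c.
    by rewrite /u /v /g -expRD; congr expR; ring.
  have := @gibbs_association _ _ c0 v g (fun c => `|n c x| ^+ 3) v_gt0 (fun c => expR_gt0 _).
  rewrite /N3 /gibbs_avg; under eq_bigr do rewrite -ug.
  under [X in _ / X <= _]eq_bigr do rewrite -ug.
  apply=> c d; wlog cd : c d / `|n c x| <= `|n d x|.
    have [cd|/ltW dc] := lerP `|n c x| `|n d x|; first exact.
    by move=> /(_ d c dc); rewrite -opprB mulNr -mulrN opprB.
  rewrite mulr_ge0_le0//; last by rewrite subr_le0 lerXn2r.
  rewrite subr_ge0 ler_expR lerN2 ler_wpM2l ?divr_ge0//.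
  by rewrite -(real_normK (num_real (n c x))) -(real_normK (num_real (n d x))) lerXn2r.
rewrite -(gibbs_avg_cst c0 v_gt0 (L ^+ 3 * _)) -gibbs_avgD -gibbs_avgZ.
apply: gibbs_avg_le => // c; apply: le_trans (cube_add_le _ _) _.
rewrite ler_wpM2l// lerD2l normrM exprMn mulrC ler_wpM2r ?exprn_ge0//.
by rewrite lerXn2r// nnegrE.
Qed.

(** The coefficients do not depend on [x], so they disappear when two variables with equal first and
    second moments are compared. The constant is [136 = 4 * 34], with [34 = 25 + 9] from [f3_le] and
    4 from [N3_le]. *)
Lemma softmin_taylor : exists a1 a2, forall x,
  `|f x - f 0 - a1 * x - a2 * x ^+ 2| <= 136 * (`|th| * (b ^+ 3 * L ^+ 3) *
     (1 + gibbs_avg v (fun c => `|r c| ^+ 3) + L ^+ 3 * `|x| ^+ 3)) * `|x| ^+ 3.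
Proof.
exists (f1 0), (f2 0 / 2) => x.
apply: (taylor2_remainder df0 df1 df2) => y yx.
apply: le_trans (f3_le y) _; set B := b ^+ 3 * L ^+ 3; set W := (1 + _ + _).
rewrite (_ : 136 * _ = `|th| * (B * (136 * W))); last by ring.
rewrite ler_wpM2l// /W.
have B0 : 0 <= B by rewrite mulr_ge0 ?exprn_ge0.
set G := gibbs_avg v _.
have L3 : L ^+ 3 * `|y| ^+ 3 <= L ^+ 3 * `|x| ^+ 3.
  by rewrite ler_wpM2l ?exprn_ge0// lerXn2r ?nnegrE.
have h1 : 25 * M 3 y + 9 * (S * M 1 y) <= B * (34 * (1 + N3 y)).
  have := M3_le y; have := SM1_le y; rewrite -/B; have := N3_ge0 y; nra.
apply: le_trans h1 _; rewrite ler_wpM2l//.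
have := N3_le y; rewrite -/G; lra.
Qed.

End softmin_calculus.

(** * Lindeberg exchange *)

Section integrable_sum.
Context (R : realType) d (T : measurableType d) (P : probability T R).

Lemma integral_addr_integrable (f g : T -> R) : P.-integrable setT (EFin \o f) ->
  P.-integrable setT (EFin \o g) ->
  (\int[P]_t (f t + g t)%:E = \int[P]_t (f t)%:E + \int[P]_t (g t)%:E)%E.
Proof. by move=> fi gi; rewrite -integralD_EFin. Qed.

End integrable_sum.

Section scalar_comparison.
Context (R : realType) d (T : measurableType d) (P : probability T R).
Variables (X : T -> R) (s2 : R) (phi psi : R -> R) (a1 a2 K B : R).
Hypotheses (mX : measurable_fun setT X)
  (iX : P.-integrable setT (EFin \o X)) (iX2 : P.-integrable setT (EFin \o (fun t => X t ^+ 2)))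
  (EX : (\int[P]_t (X t)%:E = 0)%E) (EX2 : (\int[P]_t (X t ^+ 2)%:E = s2%:E)%E)
  (mphi : measurable_fun setT phi) (phi01 : forall x, 0 <= phi x <= 1)
  (mpsi : measurable_fun setT psi) (psi0 : forall x, 0 <= psi x)
  (Epsi : (\int[P]_t (psi (X t))%:E <= B%:E)%E)
  (K0 : 0 <= K)
  (taylor : forall x, `|phi x - phi 0 - a1 * x - a2 * x ^+ 2| <= K * psi x).

Let p (x : R) := phi 0 + (a1 * x + a2 * x ^+ 2).

Let ip : P.-integrable setT (EFin \o (fun t => p (X t))).
Proof.
have i1 := integrableZl measurableT a1 iX.
have i2 := integrableZl measurableT a2 iX2.
exact: (integrableD measurableT (finite_measure_integrable_cst P (phi 0) measurableT)
  (integrableD measurableT i1 i2)).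
Qed.

Let Ep : (\int[P]_t (p (X t))%:E = (phi 0 + a2 * s2)%:E)%E.
Proof.
have i1 : P.-integrable setT (EFin \o (fun t => a1 * X t)).
  exact: (integrableZl measurableT a1 iX).
have i2 : P.-integrable setT (EFin \o (fun t => a2 * X t ^+ 2)).
  exact: (integrableZl measurableT a2 iX2).
rewrite integral_addr_integrable; last 2 first.
- exact: finite_measure_integrable_cst.
- exact: (integrableD measurableT i1 i2).
rewrite integral_addr_integrable//.
have -> : (\int[P]_t (a1 * X t)%:E = a1%:E * \int[P]_t (X t)%:E)%E.
  by under eq_integral do rewrite EFinM; rewrite integralZl.
have -> : (\int[P]_t (a2 * X t ^+ 2)%:E = a2%:E * \int[P]_t (X t ^+ 2)%:E)%E.
  by under eq_integral do rewrite EFinM; rewrite integralZl.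
by rewrite EX EX2 mule0 add0e integral_cstr -EFinM EFinD.
Qed.

Let ipsi : P.-integrable setT (EFin \o (fun t => K * psi (X t))).
Proof.
suff i0 : P.-integrable setT (EFin \o (fun t => psi (X t))).
  exact: (integrableZl measurableT K i0).
apply/integrableP; split; first by apply/measurable_EFinP; exact: measurableT_comp.
under eq_integral do rewrite /= ger0_norm//.
exact: le_lt_trans Epsi (ltry _).
Qed.

Let iphi : P.-integrable setT (EFin \o (fun t => phi (X t))).
Proof.
apply: (@le_integrable _ _ _ P _ measurableT _ (fun=> 1%:E)) => //.
- by apply/measurable_EFinP; exact: measurableT_comp.
- move=> t _; have /andP[h0 h1] := phi01 (X t).
  by rewrite /= lee_fin ger0_norm// normr1.
- exact: finite_measure_integrable_cst.
Qed.

Let Epsi_le : (\int[P]_t (K * psi (X t))%:E <= (K * B)%:E)%E.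
Proof.
rewrite integral_mulrl//; last exact: measurableT_comp.
by rewrite EFinM lee_wpmul2l.
Qed.

(** The mean is zero and the variance is [s2], so the expansion integrates to [phi 0 + a2 * s2],
    which is the same number for both laws to be compared. A general [psi] replaces the cube because
    the remainder also contains a sixth power. *)
Lemma integral_le_of_taylor :
  (\int[P]_t (phi (X t))%:E <= (phi 0 + a2 * s2 + K * B)%:E)%E.
Proof.
apply: (@le_trans _ _ (\int[P]_t (p (X t) + K * psi (X t))%:E)%E).
  apply: le_integral => //; first exact: (integrableD measurableT ip ipsi).
  move=> t _; rewrite /= lee_fin /p.
  by have := taylor (X t); rewrite ler_norml => /andP[_]; lra.
rewrite integral_addr_integrable// Ep [leRHS]EFinD.
by rewrite leeD2l.
Qed.

Lemma integral_ge_of_taylor :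
  ((phi 0 + a2 * s2)%:E <= \int[P]_t (phi (X t))%:E + (K * B)%:E)%E.
Proof.
rewrite -Ep.
apply: (@le_trans _ _ (\int[P]_t (phi (X t) + K * psi (X t))%:E)%E).
  apply: le_integral => //; first exact: (integrableD measurableT iphi ipsi).
  move=> t _; rewrite /= lee_fin /p.
  by have := taylor (X t); rewrite ler_norml => /andP[+ _]; lra.
rewrite integral_addr_integrable//.
by rewrite leeD2l.
Qed.

End scalar_comparison.

Definition update (I : eqType) (R : Type) (y : I -> R) (i : I) (x : R) : I -> R :=
  fun j => if j == i then x else y j.

Lemma measurable_update (I : finType) (R : realType) d (U : measurableType d)
    (f : fvec I R -> R) (Y : I -> U -> R) (i : I) (x : U -> R) :
  measurable_fun [set: fvec I R] f -> (forall j, measurable_fun setT (Y j)) ->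
  measurable_fun setT x -> measurable_fun setT (fun u => f (update (Y ^~ u) i (x u))).
Proof.
move=> mf mY mx; apply: (measurableT_comp mf); apply: measurable_fvec => j.
by rewrite /update; case: (j == i).
Qed.

Section lindeberg.
Local Open Scope ereal_scope.
Context (I : finType) (R : realType).
Context d (T : measurableType d) (P : probability T R).
Context d' (T' : measurableType d') (P' : probability T' R).
Variables (X : I -> T -> R) (Y : I -> T' -> R).
Hypotheses (mX : forall i, measurable_fun setT (X i)) (mY : forall i, measurable_fun setT (Y i))
  (iX : mutually_independent P X) (iY : mutually_independent P' Y).
Variable A : pred I.
Variables (s2 : R) (f : fvec I R -> R) (K : I -> fvec I R -> R) (psi : R -> R) (B kappa : R).
Hypotheses (mf : measurable_fun [set: fvec I R] f) (f01 : forall y, (0 <= f y <= 1)%R)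
  (mK : forall i, measurable_fun [set: fvec I R] (K i)) (K0 : forall i y, (0 <= K i y)%R)
  (mpsi : measurable_fun setT psi) (psi0 : forall x, (0 <= psi x)%R) (B0 : (0 <= B)%R).
Hypotheses
  (EX : forall i, A i -> [/\ P.-integrable setT (EFin \o X i),
     P.-integrable setT (EFin \o (fun t => X i t ^+ 2)%R),
     \int[P]_t (X i t)%:E = 0, \int[P]_t (X i t ^+ 2)%:E = s2%:E
     & \int[P]_t (psi (X i t))%:E <= B%:E])
  (EY : forall i, A i -> [/\ P'.-integrable setT (EFin \o Y i),
     P'.-integrable setT (EFin \o (fun t => Y i t ^+ 2)%R),
     \int[P']_t (Y i t)%:E = 0, \int[P']_t (Y i t ^+ 2)%:E = s2%:E
     & \int[P']_t (psi (Y i t))%:E <= B%:E])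
  (same_law : forall i D, ~~ A i -> measurable D -> P (X i @^-1` D) = P' (Y i @^-1` D)).
Hypothesis taylor : forall i y, A i -> exists a1 a2, forall x : R,
  (`|f (update y i x) - f (update y i 0) - a1 * x - a2 * x ^+ 2| <= K i y * psi x)%R.
Hypothesis EK : forall i (b : pred I), A i ->
  \int[P \x P']_w (K i (hybrid b X Y ^~ w))%:E <= kappa%:E.

(** With all other coordinates frozen, both sides integrate the same scalar section of [f] against
    [X i] and against [Y i]. An upper bound for one and a lower bound for the other share the
    quadratic part and lose [B * K] each, hence the factor 2. *)
Lemma lindeberg_swap i (b b' : pred I) : A i -> b i -> ~~ b' i ->
  (forall j, j != i -> b j = b' j) ->
  \int[P \x P']_w (f (hybrid b X Y ^~ w))%:E <=
  \int[P \x P']_w (f (hybrid b' X Y ^~ w))%:E + (2 * B * kappa)%:E.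
Proof.
move=> Ai bi b'i bb'.
have mh b0 := measurable_hybrid b0 mX mY.
have f0 y : (0 <= f y)%R by have /andP[] := f01 y.
have c0 : (0 <= 2 * B)%R by rewrite mulr_ge0.
pose Z := hybrid b X Y; pose Z' := hybrid b' X Y.
have E0 (b0 : pred I) : \int[P \x P']_w (f (hybrid b0 X Y ^~ w))%:E =
    \int[P \x P']_s \int[P \x P']_w (f (update (hybrid b0 X Y ^~ s) i (hybrid b0 X Y i w)))%:E.
  rewrite (integral_decouple (mh b0) (hybrid_indep b0 mX mY iX iY) (pred1 i) mf f0).
  apply: eq_integral => s _; apply: eq_integral => w _.
  by congr (f _)%:E; apply/funext => j; rewrite /update /=; case: eqP => // ->.
rewrite !E0.
have same s x : update (Z' ^~ s) i x = update (Z ^~ s) i x.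
  by apply/funext => j; rewrite /update /Z' /Z /hybrid; case: eqP => // /eqP /bb' ->.
have EZ s : \int[P \x P']_w (f (update (Z ^~ s) i (Z i w)))%:E
    = \int[P]_t (f (update (Z ^~ s) i (X i t)))%:E.
  have mg : measurable_fun setT (fun w : T * T' => (f (update (Z ^~ s) i (Z i w)))%:E).
    apply/measurable_EFinP.
    by apply: (@measurable_update _ _ _ _ f (fun j _ => Z j s) i (Z i)) => //; exact: mh.
  rewrite fubini_tonelli1//; last by move=> w; rewrite lee_fin.
  apply: eq_integral => t _; rewrite /fubini_F /Z /hybrid /= bi.
  exact: integral_cstr.
have EZ' s : \int[P \x P']_w (f (update (Z' ^~ s) i (Z' i w)))%:E
    = \int[P']_t (f (update (Z ^~ s) i (Y i t)))%:E.
  have mg : measurable_fun setT (fun w : T * T' => (f (update (Z' ^~ s) i (Z' i w)))%:E).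
    apply/measurable_EFinP.
    by apply: (@measurable_update _ _ _ _ f (fun j _ => Z' j s) i (Z' i)) => //; exact: mh.
  rewrite fubini_tonelli2//; last by move=> w; rewrite lee_fin.
  apply: eq_integral => t _; rewrite /fubini_G /Z' /hybrid /= (negbTE b'i).
  by rewrite -/(hybrid b' X Y) integral_cstr same.
have mG (b0 : pred I) : measurable_fun setT (fun s =>
    \int[P \x P']_w (f (update (hybrid b0 X Y ^~ s) i (hybrid b0 X Y i w)))%:E).
  pose F (z : (T * T') * (T * T')) := f (update (hybrid b0 X Y ^~ z.1) i (hybrid b0 X Y i z.2)).
  have mF : measurable_fun setT F.
    have m1 j : measurable_fun setT (fun z : (T * T') * (T * T') => hybrid b0 X Y j z.1).
      by apply: (measurableT_comp (mh b0 j)); exact: measurable_fst.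
    have m2 : measurable_fun setT (fun z : (T * T') * (T * T') => hybrid b0 X Y i z.2).
      by apply: (measurableT_comp (mh b0 i)); exact: measurable_snd.
    exact: (measurable_update i mf m1 m2).
  have mFE : measurable_fun setT (EFin \o F) by exact/measurable_EFinP.
  have F0 z : 0 <= (EFin \o F) z by rewrite lee_fin /F f0.
  pose Q : probability (T * T')%type R := (P \x P').
  exact: (@measurable_fun_fubini_tonelli_F _ _ (T * T')%type (T * T')%type R Q (EFin \o F) mFE F0).
have mKZ : measurable_fun setT (fun s => K i (Z ^~ s)).
  by apply: (measurableT_comp (mK i)); apply: measurable_fvec => j; exact: mh.
apply: (@le_trans _ _ (\int[P \x P']_s
    (\int[P \x P']_w (f (update (Z' ^~ s) i (Z' i w)))%:E + (2 * B * K i (Z ^~ s))%:E))).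
  apply: ge0_le_integral => //.
  - by move=> s _; apply: integral_ge0 => w _; rewrite lee_fin.
  - apply: emeasurable_funD; first exact: (mG b').
    by apply/measurable_EFinP; exact: measurable_funM.
  move=> s _; rewrite EZ EZ'.
  have mphi : measurable_fun setT (fun x => f (update (Z ^~ s) i x)).
    exact: (@measurable_update _ _ _ _ f (fun j _ => Z j s) i id).
  have [a1 [a2 ta]] := taylor (Z ^~ s) Ai.
  have [x1 x2 x3 x4 x5] := EX Ai; have [z1 z2 z3 z4 z5] := EY Ai.
  have ub := integral_le_of_taylor (mX i) x1 x2 x3 x4 mphi (fun x => f01 _) mpsi psi0 x5
    (K0 i _) ta.
  have lb := integral_ge_of_taylor (mY i) z1 z2 z3 z4 mphi (fun x => f01 _) mpsi psi0 z5
    (K0 i _) ta.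
  apply: le_trans ub _; rewrite EFinD.
  rewrite (_ : (2 * B * K i (Z ^~ s))%R = (K i (Z ^~ s) * B + K i (Z ^~ s) * B)%R); last by ring.
  by rewrite [in leRHS]EFinD addeA leeD2r.
rewrite ge0_integralD//.
- rewrite leeD2l// integral_mulrl//.
  by rewrite [leRHS]EFinM lee_wpmul2l//; exact: EK.
- by move=> s _; apply: integral_ge0 => w _; rewrite lee_fin.
- exact: (mG b').
- by move=> s _; rewrite lee_fin mulr_ge0.
- by apply/measurable_EFinP; exact: measurable_funM.
Qed.

Lemma lindeberg_hybrids (s : seq I) : uniq s -> all A s ->
  \int[P \x P']_w (f (hybrid (mem s) X Y ^~ w))%:E <=
  \int[P \x P']_w (f (hybrid pred0 X Y ^~ w))%:E + ((size s)%:R * (2 * B * kappa))%:E.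
Proof.
elim: s => [_ _|i s IH /= /andP[ins us] /andP[Ai As]].
  by rewrite mul0r adde0.
apply: le_trans (@lindeberg_swap i _ (mem s) Ai _ ins _) _; rewrite ?inE ?eqxx//.
  by move=> j /negbTE ji; rewrite /= inE ji.
set c := (2 * B * kappa)%R.
have -> : ((size s).+1%:R * c)%:E = ((size s)%:R * c)%:E + c%:E.
  by rewrite -EFinD -natr1 mulrDl mul1r.
by rewrite addeA leeD2r//; exact: IH.
Qed.

(** Outside [A] the marginals agree, so [X] has the law of the hybrid that takes those coordinates
    from [Y]. Both ends of the chain are then hybrids on the product space, and only [#|A|] swaps
    are paid. *)
Lemma lindeberg :
  \int[P]_t (f (X ^~ t))%:E <=
  \int[P']_t (f (Y ^~ t))%:E + (#|A|%:R * (2 * B * kappa))%:E.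
Proof.
have f0 y : (0 <= f y)%R by have /andP[] := f01 y.
have mh b0 := measurable_hybrid b0 mX mY.
have ih b0 := hybrid_indep b0 mX mY iX iY.
rewrite (@eq_expectation_indep _ _ _ _ P _ _ (P \x P') X (hybrid (mem (enum A)) X Y))//; last first.
  move=> i D mD; rewrite [RHS]hybrid_marginal//= mem_enum; case: ifPn => // iA.
  by apply: same_law.
rewrite [X in _ <= X + _](@eq_expectation_indep _ _ _ _ P' _ _ (P \x P') Y (hybrid pred0 X Y))//; last first.
  by move=> i D mD; rewrite [RHS]hybrid_marginal.
rewrite cardE; apply: lindeberg_hybrids; first exact: enum_uniq.
by apply/allP => i; rewrite mem_enum.
Qed.

End lindeberg.

(** * Exchange for the ridge soft minimum *)

Notation entry_index m n := ('I_m * 'I_n + 'I_m)%type.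

Section rows.
Context (R : realType) (m n : nat).
Local Notation I := (entry_index m n).
Implicit Types (y : I -> R) (w : 'I_n -> R) (i : 'I_m) (j : 'I_n).

Definition row_residual w i y : R := \sum_j y (inl (i, j)) * w j - y (inr i).

Definition in_row i (k : I) : bool := match k with inl ij => ij.1 == i | inr i' => i' == i end.

(** Presents the residual of row [i], with entry [(i, j)] set to zero, as a linear form in all
    entries; sub-Gaussian bounds for linear forms then apply to it. *)
Definition row_coef w i j (k : I) : R :=
  match k with
  | inl ij => if (ij.1 == i) && (ij.2 != j) then w ij.2 else 0
  | inr i' => if i' == i then -1 else 0
  end.

Lemma row_residual_update w i j y x :
  row_residual w i (update y (inl (i, j)) x) =
  row_residual w i (update y (inl (i, j)) 0) + x * w j.
Proof.
rewrite /row_residual (bigD1 j)//= [in RHS](bigD1 j)//= /update !eqxx mul0r add0r.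
rewrite [RHS]addrC addrA; congr (_ + _ - _).
apply: eq_bigr => j' j'j; congr (_ * _).
have -> // : (inl (i, j') == inl (i, j) :> I) = false.
by apply/negbTE; apply: contra j'j => /eqP[->].
Qed.

Lemma row_residual_update_ne w i i' j y x : i' != i ->
  row_residual w i' (update y (inl (i, j)) x) = row_residual w i' y.
Proof.
move=> i'i; rewrite /row_residual /update /=; congr (_ - _); apply: eq_bigr => j' _.
congr (_ * _); have -> // : (inl (i', j') == inl (i, j) :> I) = false.
by apply/negbTE; apply: contra i'i => /eqP[->].
Qed.

Lemma sum_entry_index (F : I -> R) :
  \sum_k F k = \sum_i \sum_j F (inl (i, j)) + \sum_i F (inr i).
Proof. by rewrite big_sumType/= pair_big; congr (_ + _); apply: eq_bigr => -[]. Qed.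

Lemma row_residual_coef w i j y :
  row_residual w i (update y (inl (i, j)) 0) = \sum_k row_coef w i j k * y k.
Proof.
rewrite sum_entry_index /= (bigD1 i)//= [X in _ = _ + X + _]big1 ?addr0; last first.
  by move=> i' /negbTE i'i; apply: big1 => j' _; rewrite /= i'i mul0r.
rewrite [X in _ = _ + X](bigD1 i)//= [X in _ = _ + (_ + X)]big1 ?addr0; last first.
  by move=> i' /negbTE ->; rewrite mul0r.
rewrite eqxx mulN1r /row_residual /update /=; congr (_ - _).
apply: eq_bigr => j' _; rewrite ?eqxx /=; have [->|j'j] := eqVneq j' j.
  by rewrite !eqxx !mul0r.
have -> : (inl (i, j') == inl (i, j) :> I) = false.
  by apply/negbTE; apply: contra j'j => /eqP[->].
exact: mulrC.
Qed.

Lemma sum_row_coef (v : I -> R) (v1 v2 : R) w i j : (forall ij, v (inl ij) = v1) ->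
  (forall i', v (inr i') = v2) -> 0 <= v1 ->
  \sum_k v k * row_coef w i j k ^+ 2 <= v1 * \sum_j w j ^+ 2 + v2.
Proof.
move=> e1 e2 v10; rewrite sum_entry_index /= (bigD1 i)//= [X in _ + X + _]big1 ?addr0; last first.
  by move=> i' /negbTE i'i; apply: big1 => j' _; rewrite /= i'i expr0n mulr0.
rewrite [X in _ + X](bigD1 i)//= [X in _ + (_ + X)]big1 ?addr0; last first.
  by move=> i' /negbTE ->; rewrite expr0n mulr0.
rewrite eqxx sqrrN expr1n mulr1 e2 lerD2r mulr_sumr; apply: ler_sum => j' _.
rewrite e1 ?eqxx /=; case: ifP => _ //.
by rewrite expr0n mulr0 mulr_ge0// sqr_ge0.
Qed.

End rows.

Section ridge_test_function.
Context (R : realType) (m n : nat) (C : finType) (c0 : C).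
Local Notation I := (entry_index m n).
Variables (w : C -> 'I_n -> R) (k : C -> R) (b th a : R).

(** With [k] the ridge penalty this is [b * m] times the ridge cost at net point [c], so the inverse
    temperature of the cost itself is [b * m]. *)
Definition gibbs_energy (c : C) (y : I -> R) : R :=
  b * (2^-1 * \sum_i row_residual (w c) i y ^+ 2 + k c).

Definition partition_sum (y : I -> R) : R := \sum_c expR (- gibbs_energy c y).

Definition softmin_test (y : I -> R) : R := sigmoid (th * ln (partition_sum y) + a).

Definition cavity_energy i (c : C) (y : I -> R) : R :=
  b * (2^-1 * \sum_(i' | i' != i) row_residual (w c) i' y ^+ 2 + k c).

(** The weights omit row [i] and the residual uses only row [i]: the two are independent, which is
    what the average over the full weights lacks. *)
Definition cavity_cube i j (y : I -> R) : R :=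
  gibbs_avg (fun c => expR (- cavity_energy i c y))
    (fun c => `|row_residual (w c) i (update y (inl (i, j)) 0)| ^+ 3).

Lemma measurable_row_residual (u : 'I_n -> R) i :
  measurable_fun [set: fvec I R] (fun y : fvec I R => row_residual u i y).
Proof.
apply: measurable_funB; last exact: measurable_coord.
apply: measurable_sum => j; apply: measurable_funM => //; exact: measurable_coord.
Qed.

Lemma measurable_gibbs_energy c : measurable_fun [set: fvec I R] (gibbs_energy c : fvec I R -> R).
Proof.
apply: measurable_funM => //; apply: measurable_funD => //; apply: measurable_funM => //.
by apply: measurable_sum => i; apply: measurable_funX; exact: measurable_row_residual.
Qed.

Lemma partition_sum_gt0 y : 0 < partition_sum y.
Proof. by apply: gibbs_sum_gt0 => // c; exact: expR_gt0. Qed.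

Lemma measurable_softmin_test : measurable_fun [set: fvec I R] (softmin_test : fvec I R -> R).
Proof.
apply: (measurableT_comp (@measurable_sigmoid R)).
apply: measurable_funD => //; apply: measurable_funM => //.
apply: (measurableT_comp (@measurable_ln R)); apply: measurable_sum => c.
apply: measurableT_comp => //; apply: measurableT_comp => //; exact: measurable_gibbs_energy.
Qed.

Lemma measurable_cavity_energy i c :
  measurable_fun [set: fvec I R] (cavity_energy i c : fvec I R -> R).
Proof.
apply: measurable_funM => //; apply: measurable_funD => //; apply: measurable_funM => //.
rewrite (_ : (fun y : fvec I R => _) = (fun y : fvec I R => \sum_i'
    if i' != i then row_residual (w c) i' y ^+ 2 else 0)); last first.
  by apply/funext => y; rewrite -big_mkcond.
apply: measurable_sum => i'; case: (i' != i) => //.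
by apply: measurable_funX; exact: measurable_row_residual.
Qed.

Lemma measurable_cavity_cube i j :
  measurable_fun [set: fvec I R] (cavity_cube i j : fvec I R -> R).
Proof.
have mE c : measurable_fun [set: fvec I R] (fun y : fvec I R => expR (- cavity_energy i c y)).
  by apply: measurableT_comp => //; apply: measurableT_comp => //; exact: measurable_cavity_energy.
rewrite /cavity_cube /gibbs_avg.
apply: measurable_funM.
  apply: measurable_sum => c; apply: measurable_funM => //; apply: measurable_funX.
  apply: measurableT_comp => //.
  apply: (@measurable_update _ _ _ _ (fun y => row_residual (w c) i y)
    (fun j (y : fvec I R) => y j)) => // [|k']; first exact: measurable_row_residual.
  exact: measurable_coord.
have -> : (fun y : fvec I R => (\sum_c expR (- cavity_energy i c y))^-1) =
    (fun y => expR (- ln (\sum_c expR (- cavity_energy i c y)))).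
  apply/funext => y; rewrite expRN lnK// posrE; apply: gibbs_sum_gt0 => // c.
  exact: expR_gt0.
apply: measurableT_comp => //; apply: measurableT_comp => //.
by apply: (measurableT_comp (@measurable_ln R)); apply: measurable_sum.
Qed.

Lemma cavity_cube_ge0 i j y : 0 <= cavity_cube i j y.
Proof. by apply: gibbs_avg_ge0 => // c; rewrite ?expR_gt0 ?exprn_ge0. Qed.

Lemma softmin_test_taylor (L : R) i j y : 1 <= b -> 1 <= L -> `|th| <= 1 ->
  (forall c, `|w c j| <= L) ->
  exists a1 a2, forall x,
  `|softmin_test (update y (inl (i, j)) x) - softmin_test (update y (inl (i, j)) 0)
     - a1 * x - a2 * x ^+ 2| <=
  136 * (`|th| * (b ^+ 3 * L ^+ 3)) * (1 + cavity_cube i j y) *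
    ((1 + L ^+ 3 * `|x| ^+ 3) * `|x| ^+ 3).
Proof.
move=> b1 L1 th1 wL.
have [a1 [a2 ta]] := softmin_taylor c0
  (fun c => row_residual (w c) i (update y (inl (i, j)) 0))
  (fun c => cavity_energy i c y) a b1 L1 wL th1.
exists a1, a2 => x.
have E z : softmin_test (update y (inl (i, j)) z) = sigmoid (th * ln (\sum_c
   expR (- (b / 2 * (row_residual (w c) i (update y (inl (i, j)) 0) + z * w c j) ^+ 2
     + cavity_energy i c y))) + a).
  rewrite /softmin_test (_ : partition_sum _ = \sum_c
     expR (- (b / 2 * (row_residual (w c) i (update y (inl (i, j)) 0) + z * w c j) ^+ 2
       + cavity_energy i c y)))//.
  apply: eq_bigr => c _; congr expR; congr (- _).
  rewrite /gibbs_energy /cavity_energy (bigD1 i)//= -row_residual_update.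
  under eq_bigr do rewrite row_residual_update_ne//.
  by field.
rewrite !E; apply: le_trans (ta x) _.
rewrite -/(cavity_cube i j y).
have := cavity_cube_ge0 i j y; set G := cavity_cube _ _ _ => G0.
have x0 : 0 <= `|x| ^+ 3 by rewrite exprn_ge0.
have L0 : 0 <= L ^+ 3 by rewrite exprn_ge0//; lra.
set c := `|th| * (b ^+ 3 * L ^+ 3).
have c_ge0 : 0 <= c.
  by apply: mulr_ge0 => //; apply: mulr_ge0; apply: exprn_ge0; lra.
move: (L ^+ 3) (`|x| ^+ 3) L0 x0 => l q l0 q0.
rewrite (_ : 136 * c * (1 + G) * ((1 + l * q) * q)
  = 136 * (c * ((1 + G) * (1 + l * q))) * q); last by ring.
rewrite ler_wpM2r// ler_wpM2l// ler_wpM2l//.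
have : 0 <= G * (l * q) by rewrite mulr_ge0// mulr_ge0.
lra.
Qed.

End ridge_test_function.

Section subgaussian_family.
Context (R : realType) (m n : nat).
Local Notation I := (entry_index m n).

Definition entry_proxy (v : R) (k : I) : R :=
  match k with inl _ => v / m%:R | inr _ => v end.

Context d (T : measurableType d) (P : probability T R).

Definition subgaussian_family (v : R) (X : I -> T -> R) : Prop :=
  [/\ forall k, measurable_fun setT (X k), mutually_independent P X &
      forall k, subgaussian P (entry_proxy v k) (X k)].

Definition standardized_entries (X : I -> T -> R) : Prop :=
  forall ij, (\int[P]_t (X (inl ij) t)%:E = 0)%E /\
             (\int[P]_t (X (inl ij) t ^+ 2)%:E = (m%:R^-1)%:E)%E.

Lemma subgaussian_linear (J : finType) (v : J -> R) (X : J -> T -> R) (c : J -> R) :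
  (forall k, measurable_fun setT (X k)) -> mutually_independent P X ->
  (forall k, subgaussian P (v k) (X k)) ->
  subgaussian P (\sum_k v k * c k ^+ 2) (fun t => \sum_k c k * X k t).
Proof.
move=> mX iX sX th.
under eq_integral do rewrite mulr_sumr.
have -> : (\sum_k v k * c k ^+ 2) * th ^+ 2 = \sum_k v k * (th * c k) ^+ 2.
  by rewrite mulr_suml; apply: eq_bigr => k _; rewrite exprMn; ring.
apply: le_trans (subgaussian_sum (fun k => th * c k) mX iX sX).
rewrite le_eqVlt; apply/orP; left; apply/eqP; apply: eq_integral => t _.
by congr (expR _)%:E; apply: eq_bigr => k _; rewrite mulrA.
Qed.

Context (C : finType) (c0 : C) (w : C -> 'I_n -> R) (q : C -> R) (b v C1 : R) (X : I -> T -> R).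
Hypotheses (m0 : (0 < m)%N) (v0 : 0 <= v)
  (wC1 : forall c, \sum_j w c j ^+ 2 <= C1 * m%:R)
  (fX : subgaussian_family v X).

(** Row [i] is integrated with the weights frozen. The result is a convex combination of third
    moments, each bounded by the same constant thanks to the Euclidean bound [wC1]; the size of the
    net does not enter. The factor is [54 = 3^3 * 2] from [subgaussian_moment]. *)
Lemma integral_cavity_cube i j :
  (\int[P]_t (cavity_cube w q b i j (X ^~ t))%:E <= (54 * expR (v * (C1 + 1)))%:E)%E.
Proof.
have [mX iX sX] := fX.
have m0' : (0 : R) < m%:R by rewrite ltr0n.
pose rr c t := \sum_k row_coef (w c) i j k * X k t.
have mrr c : measurable_fun setT (rr c).
  by apply: measurable_sum => k; apply: measurable_funM.
have mrr3 c : measurable_fun setT (fun t => `|rr c t| ^+ 3).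
  by apply: measurable_funX; exact: measurableT_comp.
have rr_bound c : (\int[P]_t (`|rr c t| ^+ 3)%:E <= (54 * expR (v * (C1 + 1)))%:E)%E.
  have sr : subgaussian P (v * (C1 + 1)) (rr c).
    apply: (subgaussian_le _ (subgaussian_linear (row_coef (w c) i j) mX iX sX)).
    apply: le_trans (@sum_row_coef _ _ _ (entry_proxy v) (v / m%:R) v (w c) i j _ _ _) _ => //.
      by rewrite divr_ge0.
    by rewrite mulrDr mulr1 lerD2r -mulrA ler_wpM2l// mulrC ler_pdivrMr//.
  have := subgaussian_moment 3 (mrr c) sr.
  by rewrite (_ : 3 ^+ 3 * _ = 54 * expR (v * (C1 + 1)))//; ring.
pose p c s := expR (- cavity_energy w q b i c (X ^~ s)).
have p0 c s : 0 < p c s by exact: expR_gt0.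
rewrite (integral_decouple mX iX (in_row i) (measurable_cavity_cube c0 w q b i j)
  (cavity_cube_ge0 c0 w q b i j)).
have mixE s t : cavity_cube w q b i j (fun k => if in_row i k then X k t else X k s) =
    \sum_c p c s / (\sum_c' p c' s) * `|rr c t| ^+ 3.
  have e1 c : cavity_energy w q b i c (fun k => if in_row i k then X k t else X k s)
      = cavity_energy w q b i c (X ^~ s).
    rewrite /cavity_energy; congr (_ * (_ * _ + _)); apply: eq_bigr => i' /negbTE i'i.
    by rewrite /row_residual /= i'i.
  have den : \sum_c expR (- cavity_energy w q b i c (fun k => if in_row i k then X k t else X k s))
      = \sum_c p c s by apply: eq_bigr => c _; rewrite e1.
  rewrite /cavity_cube /gibbs_avg den mulr_suml.
  apply: eq_bigr => c _; rewrite e1 mulrAC; congr (_ * `|_| ^+ 3).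
  rewrite row_residual_coef; apply: eq_bigr => -[[i' j']|i'] _ /=.
    by case: (i' == i); rewrite ?mul0r.
  by case: (i' == i); rewrite ?mul0r.
apply: (@le_trans _ _ (\int[P]_s (54 * expR (v * (C1 + 1)))%:E)%E); last by rewrite integral_cstr.
have Z0 s : 0 < \sum_c p c s by exact: gibbs_sum_gt0.
have pz0 c s : 0 <= p c s / \sum_c' p c' s by rewrite divr_ge0// ltW.
have inner s : (\int[P]_t (cavity_cube w q b i j (fun k => if in_row i k then X k t else X k s))%:E
    <= (54 * expR (v * (C1 + 1)))%:E)%E.
  under eq_integral do rewrite mixE.
  rewrite integral_sumr; last 2 first.
  - by move=> c; apply: measurable_funM.
  - by move=> c t; rewrite mulr_ge0// exprn_ge0.
  apply: (@le_trans _ _ (\sum_c (p c s / (\sum_c' p c' s) * (54 * expR (v * (C1 + 1))))%:E)%E).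
    apply: lee_sum => c _; rewrite integral_mulrl//.
    by rewrite [leRHS]EFinM; apply: lee_wpmul2l; [rewrite lee_fin|exact: rr_bound].
  by rewrite sumEFin lee_fin -mulr_suml -mulr_suml divff ?mul1r// gt_eqF.
apply: ge0_le_integral => //.
- by move=> s _; apply: integral_ge0 => t _; rewrite lee_fin cavity_cube_ge0.
- pose F (z : T * T) := cavity_cube w q b i j (fun k => if in_row i k then X k z.2 else X k z.1).
  have mF : measurable_fun setT F.
    apply: (measurableT_comp (measurable_cavity_cube c0 w q b i j)).
    apply: measurable_fvec => k; case: (in_row i k).
      by apply: (measurableT_comp (mX k)); exact: measurable_snd.
    by apply: (measurableT_comp (mX k)); exact: measurable_fst.
  have mFE : measurable_fun setT (EFin \o F) by exact/measurable_EFinP.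
  have F0 z : (0 <= (EFin \o F) z)%E by rewrite lee_fin /F cavity_cube_ge0.
  exact: (@measurable_fun_fubini_tonelli_F _ _ T T R P (EFin \o F) mFE F0).
Qed.

End subgaussian_family.

Section hybrid_of_families.
Context (R : realType) (m n : nat).
Local Notation I := (entry_index m n).
Context d (T : measurableType d) (P : probability T R).
Context d' (T' : measurableType d') (P' : probability T' R).

Lemma integral_hybrid (X : I -> T -> R) (Y : I -> T' -> R) (b : I -> bool) k (g : R -> R) :
  (forall k, measurable_fun setT (X k)) -> (forall k, measurable_fun setT (Y k)) ->
  measurable_fun setT g -> (forall x, 0 <= g x) ->
  (\int[P \x P']_z (g (hybrid b X Y k z))%:E =
   if b k then \int[P]_t (g (X k t))%:E else \int[P']_t (g (Y k t))%:E)%E.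
Proof.
move=> mX mY mg g0.
have mG : measurable_fun setT (fun z => (g (hybrid b X Y k z))%:E).
  by apply/measurable_EFinP; apply: measurableT_comp => //; exact: measurable_hybrid.
have G0 z : (0 <= (g (hybrid b X Y k z))%:E)%E by rewrite lee_fin.
case: (boolP (b k)) => bk.
  rewrite fubini_tonelli1//; apply: eq_integral => t _.
  by rewrite /fubini_F /hybrid /= bk integral_cstr.
rewrite fubini_tonelli2//; apply: eq_integral => t _.
by rewrite /fubini_G /hybrid /= (negbTE bk) integral_cstr.
Qed.

Lemma subgaussian_family_hybrid (X : I -> T -> R) (Y : I -> T' -> R) (v : R) (b : I -> bool) :
  subgaussian_family P v X -> subgaussian_family P' v Y ->
  subgaussian_family (P \x P')%E v (hybrid b X Y).
Proof.
move=> [mX iX sX] [mY iY sY]; split.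
- by move=> k; exact: measurable_hybrid.
- exact: hybrid_indep.
- move=> k th; rewrite [leLHS](integral_hybrid b k mX mY (g := fun x => expR (th * x)))//.
    by case: (b k); [exact: sX|exact: sY].
  by apply: measurableT_comp => //; exact: measurable_funM.
Qed.

End hybrid_of_families.

Section ridge_lindeberg.
Context (R : realType) (m n : nat).
Local Notation I := (entry_index m n).
Variables (v C1 L b th a : R).
Hypotheses (m0 : (0 < m)%N) (v0 : 0 <= v) (b1 : 1 <= b) (L1 : 1 <= L)
  (Lm : L ^+ 2 <= m%:R) (th1 : `|th| <= 1).

Definition swap_weight (x : R) : R := (1 + L ^+ 3 * `|x| ^+ 3) * `|x| ^+ 3.

Definition swap_moment : R := (3 ^+ 3 + 6 ^+ 6) * (2 * expR v) / Num.sqrt m%:R ^+ 3.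

Lemma measurable_swap_weight : measurable_fun setT swap_weight.
Proof.
have mn k : measurable_fun setT (fun x : R => `|x| ^+ k).
  by apply: measurable_funX; exact: normr_measurable.
by apply: measurable_funM => //; apply: measurable_funD => //; exact: measurable_funM.
Qed.

Lemma swap_weight_ge0 x : 0 <= swap_weight x.
Proof.
have L0 : 0 <= L by exact: le_trans L1.
by rewrite mulr_ge0 ?exprn_ge0// addr_ge0// mulr_ge0 ?exprn_ge0.
Qed.

(** After scaling by [sqrt m] only third and sixth moments occur. The assumption [L <= sqrt m] gives
    [L^3 |x|^6] the same order [m^(-3/2)] as [|x|^3]. *)
Lemma integral_swap_weight d (T : measurableType d) (P : probability T R) (X : T -> R) :
  measurable_fun setT X -> subgaussian P (v / m%:R) X ->
  (\int[P]_t (swap_weight (X t))%:E <= swap_moment%:E)%E.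
Proof.
move=> mX sX; pose s : R := Num.sqrt m%:R.
have m0' : (0 : R) < m%:R by rewrite ltr0n.
have s0 : 0 < s by rewrite sqrtr_gt0.
have s2 : s ^+ 2 = m%:R by rewrite sqr_sqrtr// ltW.
have L0 : 0 <= L by exact: le_trans L1.
have Ls : L <= s by rewrite -ler_sqr ?nnegrE ?(ltW s0)// s2.
have msX : measurable_fun setT (fun t => s * X t) by exact: measurable_funM.
have ssX : subgaussian P v (fun t => s * X t).
  have := subgaussian_scale s sX; rewrite s2 divfK// gt_eqF//.
have mnX k : measurable_fun setT (fun t => `|s * X t| ^+ k).
  by apply: measurable_funX; exact: measurableT_comp.
apply: (@le_trans _ _ (\int[P]_t (s ^- 3 * (`|s * X t| ^+ 3 + `|s * X t| ^+ 6))%:E)%E).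
  apply: integral_ler => //.
  - by apply: (measurableT_comp measurable_swap_weight).
  - by apply: measurable_funM => //; exact: measurable_funD.
  - by move=> t; exact: swap_weight_ge0.
  - move=> t; rewrite /swap_weight normrM (gtr0_norm s0) !exprMn.
    set x := `|X t|.
    have x0 : 0 <= x ^+ 6 by apply: exprn_ge0; exact: normr_ge0.
    have Ls3 : L ^+ 3 <= s ^+ 3 by rewrite lerXn2r// nnegrE ltW.
    rewrite (_ : s ^- 3 * _ = x ^+ 3 + s ^+ 3 * x ^+ 6); last by field; rewrite gt_eqF.
    rewrite (_ : (1 + _) * _ = x ^+ 3 + L ^+ 3 * x ^+ 6); last by ring.
    by rewrite lerD2l ler_wpM2r.
rewrite integral_mulrl; last 3 first.
- exact: measurable_funD.
- by move=> t; rewrite addr_ge0// exprn_ge0.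
- by rewrite invr_ge0 exprn_ge0// ltW.
rewrite integral_addr//.
have h3 := subgaussian_moment 3 msX ssX; have h6 := subgaussian_moment 6 msX ssX.
rewrite /swap_moment -/s mulrC EFinM; apply: lee_wpmul2l.
  by rewrite lee_fin invr_ge0 exprn_ge0// ltW.
by apply: le_trans (leeD h3 h6) _; rewrite -EFinD lee_fin -mulrDl.
Qed.

Context (C : finType) (c0 : C) (w : C -> 'I_n -> R) (q : C -> R).
Hypotheses (wL : forall c j, `|w c j| <= L) (wC1 : forall c, \sum_j w c j ^+ 2 <= C1 * m%:R).

Definition swap_constant : R :=
  136 * (`|th| * (b ^+ 3 * L ^+ 3)) * (1 + 54 * expR (v * (C1 + 1))).

Context d (T : measurableType d) (P : probability T R).
Context d' (T' : measurableType d') (P' : probability T' R).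
Variables (X : I -> T -> R) (Y : I -> T' -> R).
Hypotheses (fX : subgaussian_family P v X) (fY : subgaussian_family P' v Y)
  (sX : standardized_entries P X) (sY : standardized_entries P' Y)
  (lawXY : forall i D, measurable D -> P (X (inr i) @^-1` D) = P' (Y (inr i) @^-1` D)).

Theorem ridge_lindeberg :
  (\int[P]_t (softmin_test w q b th a (X ^~ t))%:E <=
   \int[P']_t (softmin_test w q b th a (Y ^~ t))%:E
   + ((m * n)%:R * (2 * swap_moment * swap_constant))%:E)%E.
Proof.
have [mX iX gX] := fX; have [mY iY gY] := fY.
have c_ge0 : 0 <= 136 * (`|th| * (b ^+ 3 * L ^+ 3)).
  have b0 : 0 <= b by exact: le_trans b1.
  have L0 : 0 <= L by exact: le_trans L1.
  by rewrite !mulr_ge0 ?exprn_ge0.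
(* Only the [m n] design entries are exchanged; noise coordinates have the same law in both
   families. *)
pose A (k : I) := if k is inl _ then true else false.
pose K (k : I) (y : fvec I R) : R := match k with
  | inl ij => 136 * (`|th| * (b ^+ 3 * L ^+ 3)) * (1 + cavity_cube w q b ij.1 ij.2 y)
  | inr _ => 0 end.
have cardA : #|A| = (m * n)%N.
  transitivity #|{: 'I_m * 'I_n}|; last by rewrite card_prod !card_ord.
  rewrite -(card_imset predT (@inl_inj ('I_m * 'I_n)%type 'I_m)).
  apply: eq_card => -[ij|i]; first by rewrite imset_f.
  by apply/esym/negbTE; apply/imsetP => -[].
rewrite -cardA.
apply: (@lindeberg I R d T P d' T' P' X Y mX mY iX iY A (m%:R^-1) (softmin_test w q b th a) K
  swap_weight swap_moment swap_constant).
- exact: measurable_softmin_test.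
- by move=> y; rewrite sigmoid_le1 ltW ?sigmoid_gt0.
- case=> [[i j]|i]; last exact: measurable_cst.
  exact: (measurable_funM (measurable_cst _)
    (measurable_funD (measurable_cst _) (measurable_cavity_cube c0 w q b i j))).
- case=> [ij|i] y //=; rewrite mulr_ge0// addr_ge0//; exact: cavity_cube_ge0.
- exact: measurable_swap_weight.
- exact: swap_weight_ge0.
- apply: divr_ge0; last by rewrite exprn_ge0// sqrtr_ge0.
  by rewrite mulr_ge0// ?mulr_ge0// addr_ge0// exprn_ge0.
- case=> // ij _; have [e1 e2] := sX ij; split => //.
  + exact: (subgaussian_integrable 1 (mX _) (gX _)).
  + exact: (subgaussian_integrable 2 (mX _) (gX _)).
  + by apply: integral_swap_weight => //; exact: gX.
- case=> // ij _; have [e1 e2] := sY ij; split => //.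
  + exact: (subgaussian_integrable 1 (mY _) (gY _)).
  + exact: (subgaussian_integrable 2 (mY _) (gY _)).
  + by apply: integral_swap_weight => //; exact: gY.
- by case=> // i D _ mD; exact: lawXY.
- case=> // -[i j] y _ /=; exact: softmin_test_taylor.
- case=> // -[i j] bb _ /=.
  have fZ := subgaussian_family_hybrid bb fX fY.
  have [mZ iZ gZ] := fZ.
  have mc : measurable_fun setT (fun z => cavity_cube w q b i j (hybrid bb X Y ^~ z)).
    by apply: (measurableT_comp (measurable_cavity_cube c0 w q b i j)); exact: measurable_fvec.
  have cc0 z : 0 <= cavity_cube w q b i j (hybrid bb X Y ^~ z) by exact: cavity_cube_ge0.
  have h := integral_cavity_cube c0 q b m0 v0 wC1 fZ i j.
  apply: (@le_trans _ _ ((136 * (`|th| * (b ^+ 3 * L ^+ 3)))%:E *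
     \int[P \x P']_z (1 + cavity_cube w q b i j (hybrid bb X Y ^~ z))%:E)%E).
    rewrite -integral_mulrl//; last by move=> z; rewrite addr_ge0.
    exact: measurable_funD.
  rewrite integral_addr// integral_cstr /swap_constant [leRHS]EFinM.
  apply: lee_wpmul2l; first by rewrite lee_fin.
  by rewrite [leRHS]EFinD leeD2l.
Qed.

End ridge_lindeberg.

(** * Leave-one-out bounds for the ridge error *)

Section ridge_minimizer.
Context (R : realType) (m n : nat) (lambda : R).
Hypotheses (m0 : (0 < m)%N) (l0 : 0 < lambda).
Implicit Types (A : 'M[R]_(m, n)) (xi : 'cV[R]_m) (mu w v : 'cV[R]_n).

Lemma ridge_normal_equation A xi mu :
  (A^T *m A + lambda%:M) *m ridge_error lambda mu A xi = A^T *m xi - lambda *: mu.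
Proof. by rewrite ridge_errorE// mulKVmx// ridge_unitmx. Qed.

Lemma ridge_error_min A xi mu v :
  ridge_cost lambda mu (ridge_error lambda mu A xi) A xi <= ridge_cost lambda mu v A xi.
Proof.
have mV : 0 < m%:R^-1 :> R by rewrite invr_gt0 ltr0n.
have := ridge_normal_equation A xi mu; set w := ridge_error _ _ _ _ => Ew.
have : ((v - w)^T *m (A^T *m (A *m w - xi) + lambda *: (w + mu))) 0 0 = 0.
  rewrite (_ : A^T *m (A *m w - xi) + lambda *: (w + mu) =
    (A^T *m A + lambda%:M) *m w - (A^T *m xi - lambda *: mu)); last first.
    rewrite mulmxBr mulmxDl mul_scalar_mx scalerDr mulmxA opprB addrACA.
    by rewrite [lambda *: mu - _]addrC addrACA addrC.
  by rewrite Ew subrr mulmx0 mxE.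
rewrite mulmxDr -scalemxAr mulmxA -trmx_mul mxE [X in _ + X]mxE => e0.
rewrite -[v](subrKC w) /ridge_cost mulmxDr (addrAC (A *m w)) (addrAC w).
rewrite (enorm_sqrD _ (A *m (v - w))) (enorm_sqrD _ (v - w)).
rewrite ler_pM2l//.
have h1 : 0 <= enorm (A *m (v - w)) ^+ 2 by exact: sqr_ge0.
have h2 : 0 <= lambda * enorm (v - w) ^+ 2 by rewrite mulr_ge0 ?sqr_ge0// ltW.
nra.
Qed.

Lemma enormN_sqr (k : nat) (x : 'cV[R]_k) : enorm (- x) ^+ 2 = enorm x ^+ 2.
Proof. by rewrite !enorm_sqr; apply: eq_bigr => i _; rewrite mxE sqrrN. Qed.

Lemma enorm_sqrD_le (k : nat) (x y : 'cV[R]_k) :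
  enorm (x + y) ^+ 2 <= 2 * enorm x ^+ 2 + 2 * enorm y ^+ 2.
Proof.
rewrite !enorm_sqr !mulr_sumr -big_split/=; apply: ler_sum => i _; rewrite mxE.
have := sqr_ge0 (x i 0 - y i 0); lra.
Qed.

(** Comparison of the minimizer with the competitor 0. *)
Lemma ridge_error_energy A xi mu :
  enorm (A *m ridge_error lambda mu A xi - xi) ^+ 2
    + lambda * enorm (ridge_error lambda mu A xi + mu) ^+ 2
  <= enorm xi ^+ 2 + lambda * enorm mu ^+ 2.
Proof.
have mV : 0 < m%:R^-1 :> R by rewrite invr_gt0 ltr0n.
have := ridge_error_min A xi mu 0; rewrite /ridge_cost ler_pM2l//.
rewrite mulmx0 add0r add0r enormN_sqr; lra.
Qed.

Lemma ridge_error_norm A xi mu :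
  enorm (ridge_error lambda mu A xi) ^+ 2
    <= 2 / lambda * enorm xi ^+ 2 + 4 * enorm mu ^+ 2.
Proof.
have := ridge_error_energy A xi mu; set w := ridge_error _ _ _ _ => E.
have h0 : 0 <= enorm (A *m w - xi) ^+ 2 by exact: sqr_ge0.
have h1 : lambda * enorm (w + mu) ^+ 2 <= enorm xi ^+ 2 + lambda * enorm mu ^+ 2 by lra.
have h2 : enorm (w + mu) ^+ 2 <= enorm xi ^+ 2 / lambda + enorm mu ^+ 2.
  rewrite -(ler_pM2l l0) (_ : lambda * (_ / _ + _) = enorm xi ^+ 2 + lambda * enorm mu ^+ 2)//.
  by field; rewrite gt_eqF.
have := enorm_sqrD_le (w + mu) (- mu); rewrite addrK enormN_sqr; lra.
Qed.

(** Zeroing rather than deleting the column keeps the dimension. With coordinate [j] of [mu] zeroed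
    as well, the normal equation of the reduced problem forces its minimizer to vanish at [j]. *)
Definition zero_col (j : 'I_n) A : 'M[R]_(m, n) :=
  \matrix_(i, k) if k == j then 0 else A i k.

Definition zero_coord (j : 'I_n) mu : 'cV[R]_n :=
  \col_k if k == j then 0 else mu k 0.

Definition loo_residual (j : 'I_n) A xi mu : 'cV[R]_m :=
  xi - zero_col j A *m ridge_error lambda (zero_coord j mu) (zero_col j A) xi.

Lemma loo_residual_norm j A xi mu :
  enorm (loo_residual j A xi mu) ^+ 2 <= enorm xi ^+ 2 + lambda * enorm mu ^+ 2.
Proof.
have := ridge_error_energy (zero_col j A) xi (zero_coord j mu).
set w := ridge_error _ _ _ _ => E.
have h0 : 0 <= lambda * enorm (w + zero_coord j mu) ^+ 2.
  by rewrite mulr_ge0 ?sqr_ge0// ltW.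
have h1 : lambda * enorm (zero_coord j mu) ^+ 2 <= lambda * enorm mu ^+ 2.
  rewrite ler_pM2l// !enorm_sqr; apply: ler_sum => k _; rewrite mxE.
  by case: ifP => // _; rewrite expr0n sqr_ge0.
by rewrite /loo_residual -enormN_sqr opprB -/w; lra.
Qed.

(* The gradient of the ridge cost at the leave-one-out minimizer is carried by
   coordinate [j], so strong convexity bounds the displacement of that coordinate. *)
Lemma ridge_error_coord j A xi mu :
  `|ridge_error lambda mu A xi j 0| <=
  `|mu j 0| + `|\sum_i A i j * loo_residual j A xi mu i 0| / lambda.
Proof.
have Ew := ridge_normal_equation A xi mu.
set w := ridge_error _ _ _ _ in Ew *.
have Ev := ridge_normal_equation (zero_col j A) xi (zero_coord j mu).
rewrite /loo_residual; set v := ridge_error _ _ _ _ in Ev *.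
set r := xi - _; set s := \sum_i _.
have Evk k : \sum_i zero_col j A i k * r i 0 = lambda * (v k 0 + zero_coord j mu k 0).
  have := congr1 (fun x : 'cV[R]_n => x k 0) Ev.
  rewrite mulmxDl mul_scalar_mx -mulmxA => Evk.
  have : ((zero_col j A)^T *m r) k 0 = lambda * (v k 0 + zero_coord j mu k 0).
    rewrite mulmxBr mxE [X in _ + X]mxE.
    by move: Evk; rewrite !mxE; lra.
  rewrite mxE => <-; apply: eq_bigr => i _; congr (_ * _).
  by rewrite [in RHS]mxE.
have vj : v j 0 = 0.
  have := Evk j; rewrite big1 => [|i _]; last by rewrite mxE eqxx mul0r.
  by rewrite mxE eqxx addr0 => /esym/eqP; rewrite mulf_eq0 gt_eqF//= => /eqP.
have Av : A *m v = zero_col j A *m v.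
  apply/matrixP => i c; rewrite !mxE; apply: eq_bigr => k _; rewrite mxE ord1.
  by case: eqP => // ->; rewrite vj !mulr0.
have grad k : (A^T *m xi - lambda *: mu - (A^T *m A + lambda%:M) *m v) k 0 =
    if k == j then s - lambda * mu j 0 else 0.
  have -> : A^T *m xi - lambda *: mu - (A^T *m A + lambda%:M) *m v =
      A^T *m r - lambda *: (mu + v).
    rewrite mulmxDl mul_scalar_mx -mulmxA Av mulmxBr scalerDr !opprD.
    by rewrite addrACA.
  rewrite mxE [X in _ + X]mxE [X in _ - X]mxE [X in _ - _ * X]mxE.
  have e1 : (A^T *m r) k 0 = \sum_i A i k * r i 0.
    by rewrite mxE; apply: eq_bigr => i _; rewrite mxE.
  rewrite e1; case: eqP => [->|/eqP kj]; first by rewrite vj addr0.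
  have h := Evk k; have z : zero_coord j mu k 0 = mu k 0 by rewrite [LHS]mxE (negbTE kj).
  rewrite z in h.
  rewrite (_ : \sum_i A i k * r i 0 = \sum_i zero_col j A i k * r i 0).
    by rewrite h; ring.
  by apply: eq_bigr => i _; rewrite [zero_col _ _ _ _]mxE (negbTE kj).
pose u := w - v.
have uj : u j 0 = w j 0 by rewrite !mxE vj subr0.
have Mu : (A^T *m A + lambda%:M) *m u = A^T *m xi - lambda *: mu - (A^T *m A + lambda%:M) *m v.
  by rewrite mulmxBr Ew.
have quad : (u^T *m ((A^T *m A + lambda%:M) *m u)) 0 0 = u j 0 * (s - lambda * mu j 0).
  rewrite Mu mxE (bigD1 j)//= big1 ?addr0 => [|k /negbTE kj]; last by rewrite grad kj mulr0.
  by rewrite grad eqxx mxE.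
have quad2 : (u^T *m ((A^T *m A + lambda%:M) *m u)) 0 0 =
    enorm (A *m u) ^+ 2 + lambda * enorm u ^+ 2.
  have -> : enorm (A *m u) ^+ 2 = (u^T *m (A^T *m A *m u)) 0 0.
    by rewrite enorm_sqr_mx trmx_mul !mulmxA.
  by rewrite enorm_sqr_mx mulmxDl mulmxDr mxE mul_scalar_mx -scalemxAr [X in _ + X]mxE.
have uj2 : u j 0 ^+ 2 <= enorm u ^+ 2.
  by rewrite enorm_sqr (bigD1 j)//= lerDl sumr_ge0// => k _; rewrite sqr_ge0.
have main : lambda * u j 0 ^+ 2 <= u j 0 * (s - lambda * mu j 0).
  rewrite -quad quad2; have := sqr_ge0 (enorm (A *m u)).
  by have := uj2; rewrite -(ler_pM2l l0); lra.
rewrite -uj; move: main; move: (u j 0) (mu j 0) => x y main.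
have h : lambda * `|x| * `|x| <= `|x| * (`|s| + lambda * `|y|).
  rewrite -mulrA -expr2 real_normK ?num_real//; apply: le_trans main _.
  apply: le_trans (ler_norm _) _; rewrite normrM ler_wpM2l//.
  apply: le_trans (ler_normB _ _) _; by rewrite normrM (gtr0_norm l0).
have [x0|x0] := eqVneq `|x| 0.
  by rewrite x0 addr_ge0// divr_ge0// ltW.
have xp : 0 < `|x| by rewrite lt_def x0 normr_ge0.
move: h; rewrite mulrC ler_pM2l// => h.
rewrite -(ler_pM2l l0) (_ : lambda * (`|y| + _ / _) = `|s| + lambda * `|y|)//.
by field; rewrite gt_eqF.
Qed.

End ridge_minimizer.

(** * Measurability of matrix functionals *)

Section measurable_matrices.
Context (R : realType) d (U : measurableType d).

(** Written as [g / g^2], where the inverse of the positive [g^2] is an exponential of a logarithm;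
    this covers both signs of [g]. *)
Lemma measurable_invr (g : U -> R) : measurable_fun setT g -> (forall u, g u != 0) ->
  measurable_fun setT (fun u => (g u)^-1).
Proof.
move=> mg g0; have -> : (fun u => (g u)^-1) = (fun u => g u * expR (- ln (g u ^+ 2))).
  apply/funext => u; rewrite expRN lnK ?posrE ?exprn_even_gt0 ?g0//.
  by rewrite expr2 invfM mulrA divff ?mul1r.
apply: measurable_funM => //; apply: measurableT_comp => //; apply: measurableT_comp => //.
by apply: (measurableT_comp (@measurable_ln R)); exact: measurable_funX.
Qed.

Lemma measurable_mulmx p q r (A : U -> 'M[R]_(p, q)) (B : U -> 'M[R]_(q, r)) :
  measurable_entries A -> measurable_entries B -> measurable_entries (fun u => A u *m B u).
Proof.
move=> mA mB i j; under eq_fun do rewrite mxE.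
by apply: measurable_sum => k; exact: measurable_funM.
Qed.

Lemma measurable_trmx p q (A : U -> 'M[R]_(p, q)) :
  measurable_entries A -> measurable_entries (fun u => (A u)^T).
Proof. by move=> mA i j; under eq_fun do rewrite mxE; exact: mA. Qed.

Lemma measurable_addmx p q (A B : U -> 'M[R]_(p, q)) :
  measurable_entries A -> measurable_entries B -> measurable_entries (fun u => A u + B u).
Proof. by move=> mA mB i j; under eq_fun do rewrite mxE; exact: measurable_funD. Qed.

Lemma measurable_oppmx p q (A : U -> 'M[R]_(p, q)) :
  measurable_entries A -> measurable_entries (fun u => - A u).
Proof. by move=> mA i j; under eq_fun do rewrite mxE; exact: measurable_funN. Qed.

Lemma measurable_cstmx p q (A : 'M[R]_(p, q)) : measurable_entries (fun _ : U => A).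
Proof. by move=> i j; exact: measurable_cst. Qed.

Lemma measurable_det p (A : U -> 'M[R]_p) :
  measurable_entries A -> measurable_fun setT (fun u => \det (A u)).
Proof.
move=> mA; apply: measurable_sum => s; apply: measurable_funM => //.
by apply: measurable_prod => i _; exact: mA.
Qed.

Lemma measurable_invmx p (A : U -> 'M[R]_p) :
  measurable_entries A -> (forall u, A u \in unitmx) -> measurable_entries (fun u => invmx (A u)).
Proof.
move=> mA uA i j.
have -> : (fun u => invmx (A u) i j) = (fun u => (\det (A u))^-1 * cofactor (A u) j i).
  by apply/funext => u; rewrite /invmx uA mxE [X in _ * X]mxE.
apply: measurable_funM.
  apply: measurable_invr; first exact: measurable_det.
  by move=> u; have := uA u; rewrite unitmxE unitfE.
rewrite /cofactor; apply: measurable_funM => //; apply: measurable_det => k l.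
by under eq_fun do rewrite !mxE; exact: mA.
Qed.

Lemma measurable_ridge_error m n (lambda : R) (mu : 'cV[R]_n) (A : U -> 'M[R]_(m, n))
    (xi : U -> 'cV[R]_m) : (0 < m)%N -> 0 < lambda ->
  measurable_entries A -> measurable_entries xi ->
  measurable_entries (fun u => ridge_error lambda mu (A u) (xi u)).
Proof.
move=> m0 l0 mA mxi.
rewrite (_ : (fun u => _) = (fun u => invmx ((A u)^T *m A u + lambda%:M)
   *m ((A u)^T *m xi u + - (lambda *: mu)))); last first.
  by apply/funext => u; rewrite ridge_errorE.
apply: measurable_mulmx.
  apply: measurable_invmx; last by move=> u; exact: ridge_unitmx.
  apply: measurable_addmx; last exact: measurable_cstmx.
  by apply: measurable_mulmx => //; exact: measurable_trmx.
apply: measurable_addmx; last exact: measurable_cstmx.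
by apply: measurable_mulmx => //; exact: measurable_trmx.
Qed.

End measurable_matrices.

(** * Exponential moments of the leave-one-out scores *)

Section design_of_vector.
Context (R : realType) (m n : nat).
Local Notation I := (entry_index m n).

Definition design_of (x : I -> R) : 'M[R]_(m, n) := \matrix_(i, j) x (inl (i, j)).
Definition noise_of (x : I -> R) : 'cV[R]_m := \col_i x (inr i).

Lemma measurable_design_of : measurable_entries (design_of : fvec I R -> 'M[R]_(m, n)).
Proof.
move=> i j; rewrite (_ : (fun x : fvec I R => _) = (fun x : fvec I R => x (inl (i, j)))).
  exact: measurable_coord.
by apply/funext => x; rewrite mxE.
Qed.

Lemma measurable_noise_of : measurable_entries (noise_of : fvec I R -> 'cV[R]_m).
Proof.
move=> i j; rewrite (_ : (fun x : fvec I R => _) = (fun x : fvec I R => x (inr i))).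
  exact: measurable_coord.
by apply/funext => x; rewrite mxE.
Qed.

Lemma measurable_enorm_sqr d (U : measurableType d) k (x : U -> 'cV[R]_k) :
  measurable_entries x -> measurable_fun setT (fun u => enorm (x u) ^+ 2).
Proof.
move=> mx; under eq_fun do rewrite enorm_sqr.
by apply: measurable_sum => i; apply: measurable_funX; exact: mx.
Qed.

Lemma row_residualE (w : 'cV[R]_n) i x :
  row_residual (fun j => w j 0) i x = (design_of x *m w - noise_of x) i 0.
Proof. by rewrite !mxE; congr (_ - _); apply: eq_bigr => j _; rewrite mxE. Qed.

Variables (lambda v : R) (mu : 'cV[R]_n).
Hypotheses (m0 : (0 < m)%N) (l0 : 0 < lambda) (v0 : 0 <= v).

Definition loo_of j (x : I -> R) : 'cV[R]_m := loo_residual lambda j (design_of x) (noise_of x) mu.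

Definition loo_score j (x : I -> R) : R := \sum_i x (inl (i, j)) * loo_of j x i 0.

(** Given the other columns, the score is sub-Gaussian with proxy [v / m] times the squared norm of
    the leave-one-out residual. Subtracting this from the exponent normalizes each exponential to
    mean at most 1; both signs are kept to control the absolute value. *)
Definition loo_exp j (x : I -> R) : R :=
  expR (loo_score j x - v / m%:R * enorm (loo_of j x) ^+ 2)
  + expR (- loo_score j x - v / m%:R * enorm (loo_of j x) ^+ 2).

Lemma measurable_loo_of j : measurable_entries (loo_of j : fvec I R -> 'cV[R]_m).
Proof.
have mZ : measurable_entries (fun x : fvec I R => zero_col j (design_of x)).
  move=> i k; rewrite (_ : (fun x : fvec I R => _) =
      (fun x : fvec I R => if k == j then 0 else design_of x i k)).
    by case: (k == j) => //; exact: measurable_design_of.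
  by apply/funext => x; rewrite mxE.
apply: measurable_addmx; first exact: measurable_noise_of.
apply: measurable_oppmx; apply: measurable_mulmx => //.
by apply: measurable_ridge_error => //; exact: measurable_noise_of.
Qed.

Lemma measurable_loo_score j : measurable_fun [set: fvec I R] (loo_score j : fvec I R -> R).
Proof.
apply: measurable_sum => i; apply: measurable_funM; first exact: measurable_coord.
exact: measurable_loo_of.
Qed.

Lemma measurable_loo_term j (s : R) : measurable_fun [set: fvec I R]
  (fun x : fvec I R => expR (s * loo_score j x - v / m%:R * enorm (loo_of j x) ^+ 2)).
Proof.
apply: measurableT_comp => //; apply: measurable_funB.
  by apply: measurable_funM => //; exact: measurable_loo_score.
by apply: measurable_funM => //; apply: measurable_enorm_sqr; exact: measurable_loo_of.
Qed.

Lemma loo_expE j : loo_exp j = (fun x =>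
  expR (1 * loo_score j x - v / m%:R * enorm (loo_of j x) ^+ 2)
  + expR (-1 * loo_score j x - v / m%:R * enorm (loo_of j x) ^+ 2)).
Proof. by apply/funext => x; rewrite /loo_exp mul1r mulN1r. Qed.

Lemma measurable_loo_exp j : measurable_fun [set: fvec I R] (loo_exp j : fvec I R -> R).
Proof. by rewrite loo_expE; apply: measurable_funD; exact: measurable_loo_term. Qed.

Lemma loo_exp_ge0 j x : 0 <= loo_exp j x.
Proof. by rewrite addr_ge0// expR_ge0. Qed.

Context d (T : measurableType d) (P : probability T R) (X : I -> T -> R).
Hypothesis fX : subgaussian_family P v X.

(* The leave-one-out residual does not involve column [j], so it is a constant when
   one integrates over that column alone. *)
Lemma integral_loo_term j (s : R) : s ^+ 2 = 1 ->
  (\int[P]_t (expR (s * loo_score j (X ^~ t)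
     - v / m%:R * enorm (loo_of j (X ^~ t)) ^+ 2))%:E <= 1%:E)%E.
Proof.
move=> s1; have [mX iX sX] := fX.
pose J (k : I) := if k is inl ij then ij.2 == j else false.
rewrite (integral_decouple mX iX J (measurable_loo_term j s) (fun _ => expR_ge0 _)).
pose mix s0 t : I -> R := fun k => if J k then X k t else X k s0.
have looE s0 t : loo_of j (mix s0 t) = loo_of j (X ^~ s0).
  rewrite /loo_of (_ : noise_of (mix s0 t) = noise_of (X ^~ s0)); last first.
    by apply/matrixP => i k; rewrite !mxE.
  rewrite /loo_residual (_ : zero_col j (design_of (mix s0 t)) = zero_col j (design_of (X ^~ s0)))//.
  apply/matrixP => i k; rewrite !mxE /mix /J /=; by case: (k == j).
have inner s0 : (\int[P]_t (expR (s * loo_score j (mix s0 t)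
     - v / m%:R * enorm (loo_of j (mix s0 t)) ^+ 2))%:E <= 1%:E)%E.
  set rho := loo_of j (X ^~ s0).
  pose c (k : I) : R := if k is inl ij then (if ij.2 == j then rho ij.1 0 else 0) else 0.
  have scE t : loo_score j (mix s0 t) = \sum_k c k * X k t.
    rewrite sum_entry_index /= [X in _ = _ + X]big1 ?addr0 => [|i _]; last by rewrite mul0r.
    apply: eq_bigr => i _; rewrite (bigD1 j)//= big1 ?addr0 => [|k /negbTE kj]; last by rewrite kj mul0r.
    by rewrite looE -/rho /mix /J /= eqxx mulrC.
  have cE : \sum_k entry_proxy v k * c k ^+ 2 = v / m%:R * enorm rho ^+ 2.
    rewrite sum_entry_index /= [X in _ + X]big1 ?addr0 => [|i _]; last by rewrite expr0n mulr0.
    rewrite enorm_sqr mulr_sumr; apply: eq_bigr => i _.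
    rewrite (bigD1 j)//= big1 ?addr0 => [|k /negbTE kj]; last by rewrite kj expr0n mulr0.
    by rewrite eqxx.
  have := subgaussian_linear c mX iX sX s; rewrite cE s1 mulr1 => h.
  have E t : expR (s * loo_score j (mix s0 t) - v / m%:R * enorm (loo_of j (mix s0 t)) ^+ 2)
      = expR (- (v / m%:R * enorm rho ^+ 2)) * expR (s * \sum_k c k * X k t).
    by rewrite looE -/rho scE -expRD addrC.
  under eq_integral do rewrite E.
  rewrite integral_mulrl ?expR_ge0//; last first.
    by apply: measurable_expRM; apply: measurable_sum => k; exact: measurable_funM.
  apply: (@le_trans _ _ ((expR (- (v / m%:R * enorm rho ^+ 2)))%:E *
    (expR (v / m%:R * enorm rho ^+ 2))%:E)%E).
    by apply: lee_wpmul2l; rewrite ?lee_fin ?expR_ge0.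
  by rewrite -EFinM mulrC expRxMexpNx_1.
rewrite -[leRHS](integral_cstr P); apply: ge0_le_integral => //.
- by move=> s0 _; apply: integral_ge0 => t _; rewrite lee_fin expR_ge0.
- pose F (z : T * T) := expR (s * loo_score j (mix z.1 z.2)
     - v / m%:R * enorm (loo_of j (mix z.1 z.2)) ^+ 2).
  have mF : measurable_fun setT F.
    apply: (measurableT_comp (measurable_loo_term j s)).
    apply: measurable_fvec => k; rewrite /mix; case: (J k).
      by apply: (measurableT_comp (mX k)); exact: measurable_snd.
    by apply: (measurableT_comp (mX k)); exact: measurable_fst.
  have mFE : measurable_fun setT (EFin \o F) by exact/measurable_EFinP.
  have F0 z : (0 <= (EFin \o F) z)%E by rewrite lee_fin expR_ge0.
  exact: (@measurable_fun_fubini_tonelli_F _ _ T T R P (EFin \o F) mFE F0).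
- by move=> s0 _; exact: inner.
Qed.

Lemma integral_loo_exp j : (\int[P]_t (loo_exp j (X ^~ t))%:E <= 2%:E)%E.
Proof.
have [mX iX sX] := fX.
have mt s : measurable_fun setT (fun t => expR (s * loo_score j (X ^~ t)
     - v / m%:R * enorm (loo_of j (X ^~ t)) ^+ 2)).
  by apply: (measurableT_comp (measurable_loo_term j s)); exact: measurable_fvec.
rewrite loo_expE integral_addr//.
rewrite (_ : 2 = 1 + 1 :> R)// [leRHS]EFinD; apply: leeD; apply: integral_loo_term.
  by rewrite expr1n.
by rewrite sqrrN expr1n.
Qed.

End design_of_vector.

(** * The event on which the ridge error is well localized *)

Section good_event.
Context (R : realType) (m n : nat).
Local Notation I := (entry_index m n).
Variables (lambda v D : R) (mu : 'cV[R]_n).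
Hypotheses (m0 : (0 < m)%N) (n0 : (0 < n)%N) (l0 : 0 < lambda) (v0 : 0 <= v) (D0 : 0 < D).

Definition frobenius_sqr (x : I -> R) : R := \sum_ij x (inl ij) ^+ 2.

(** The first bound controls all scores at once, the second the energy of the noise, the third
    serves the crude Lipschitz bound. The first and third sums have expectation at most [2n] and
    [n], so the level [n^2] costs only O(1/n) by Markov. *)
Definition good_vector (x : I -> R) : Prop :=
  [/\ \sum_j loo_exp lambda v mu j x <= n%:R ^+ 2,
      enorm (noise_of x) ^+ 2 <= 2 * D * m%:R
    & frobenius_sqr x <= n%:R ^+ 2].

Section probability_of_good.
Context d (T : measurableType d) (P : probability T R) (X : I -> T -> R).
Hypotheses (fX : subgaussian_family P v X) (sX : standardized_entries P X)
  (eX : forall i, (\int[P]_t (expR (X (inr i) t ^+ 2 / D))%:E <= 2%:E)%E).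

Let mX k : measurable_fun setT (X k). Proof. by case: fX. Qed.

Let mloo : measurable_fun setT (fun t => \sum_j loo_exp lambda v mu j (X ^~ t)).
Proof.
apply: measurable_sum => j.
by apply: (measurableT_comp (measurable_loo_exp v mu m0 l0 j)); exact: measurable_fvec.
Qed.

Let mnoise : measurable_fun setT (fun t => enorm (noise_of (X ^~ t)) ^+ 2).
Proof.
apply: measurable_enorm_sqr => i j; under eq_fun do rewrite mxE.
exact: mX.
Qed.

Let mfrob : measurable_fun setT (fun t => frobenius_sqr (X ^~ t)).
Proof. by apply: measurable_sum => ij; exact: measurable_funX. Qed.

Let measurable_ge (f : T -> R) c : measurable_fun setT f -> measurable [set t | c <= f t].
Proof.
move=> mf; rewrite -[X in measurable X]setTI (_ : [set t | _] = f @^-1` `[c, +oo[%classic).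
  by apply: mf => //; exact: measurable_itv.
by rewrite predeqE => t; split; rewrite /= in_itv/= andbT.
Qed.

Let measurable_le (f : T -> R) c : measurable_fun setT f -> measurable [set t | f t <= c].
Proof.
move=> mf; rewrite -[X in measurable X]setTI (_ : [set t | _] = f @^-1` `]-oo, c]%classic).
  by apply: mf => //; exact: measurable_itv.
by rewrite predeqE => t; split; rewrite /= in_itv.
Qed.

Lemma measurable_good : measurable [set t | good_vector (X ^~ t)].
Proof.
rewrite (_ : [set t | _] = [set t | \sum_j loo_exp lambda v mu j (X ^~ t) <= n%:R ^+ 2] `&`
  ([set t | enorm (noise_of (X ^~ t)) ^+ 2 <= 2 * D * m%:R] `&`
   [set t | frobenius_sqr (X ^~ t) <= n%:R ^+ 2])).
  by apply: measurableI; [exact: measurable_le|apply: measurableI; exact: measurable_le].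
by rewrite predeqE => t; split => [[h1 h2 h3]|[h1 [h2 h3]]].
Qed.

Lemma prob_loo_ge :
  (P [set t | (n%:R ^+ 2 <= \sum_j loo_exp lambda v mu j (X ^~ t))%R] <= (2 / n%:R)%:E)%E.
Proof.
have n0' : (0 : R) < n%:R by rewrite ltr0n.
apply: le_trans (markov_ge0 P mloo _ _) _.
- by move=> t; apply: sumr_ge0 => j _; exact: loo_exp_ge0.
- by rewrite exprn_gt0.
rewrite integral_sumr; last 2 first.
- move=> j; apply: (measurableT_comp (measurable_loo_exp v mu m0 l0 j)); exact: measurable_fvec.
- by move=> j t; exact: loo_exp_ge0.
apply: (@le_trans _ _ ((n%:R ^- 2)%:E * \sum_(j < n) 2%:E)%E).
  apply: lee_wpmul2l; first by rewrite lee_fin invr_ge0 exprn_ge0.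
  by apply: lee_sum => j _; exact: integral_loo_exp.
rewrite sumEFin -EFinM lee_fin sumr_const card_ord -[2 *+ n]mulr_natr.
by rewrite (_ : _ * _ = 2 / n%:R)//; field; rewrite gt_eqF.
Qed.

Lemma prob_frobenius_ge :
  (P [set t | (n%:R ^+ 2 <= frobenius_sqr (X ^~ t))%R] <= (n%:R^-1)%:E)%E.
Proof.
have n0' : (0 : R) < n%:R by rewrite ltr0n.
have m0' : (0 : R) < m%:R by rewrite ltr0n.
apply: le_trans (markov_ge0 P mfrob _ _) _.
- by move=> t; apply: sumr_ge0 => j _; exact: sqr_ge0.
- by rewrite exprn_gt0.
rewrite integral_sumr; last 2 first.
- by move=> j; exact: measurable_funX.
- by move=> j t; exact: sqr_ge0.
under eq_bigr do rewrite (proj2 (sX _)).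
rewrite sumEFin -EFinM lee_fin sumr_const card_prod !card_ord -[_ *+ (m * n)]mulr_natr natrM.
by rewrite (_ : _ * _ = n%:R^-1)//; field; rewrite !gt_eqF.
Qed.

(** Independence gives [E e^(|xi|^2 / D) <= 2^m <= e^m]; Markov at level [e^(2m)] leaves
    [e^(-m) <= 1/m]. *)
Lemma prob_noise_ge :
  (P [set t | (2 * D * m%:R <= enorm (noise_of (X ^~ t)) ^+ 2)%R] <= (m%:R^-1)%:E)%E.
Proof.
have [_ iX _] := fX.
have m0' : (0 : R) < m%:R by rewrite ltr0n.
pose g (k : I) (x : R) := if k is inr _ then expR (x ^+ 2 / D) else 1.
have mg k : measurable_fun setT (g k).
  case: k => [ij|i]; first exact: measurable_cst.
  by apply: measurableT_comp => //; apply: measurable_funM => //; exact: exprn_measurable.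
have g0 k x : 0 <= g k x by case: k => // i; exact: expR_ge0.
have gE t : \prod_k g k (X k t) = expR (enorm (noise_of (X ^~ t)) ^+ 2 / D).
  rewrite big_sumType/= big1 ?mul1r// -expR_sum enorm_sqr mulr_suml; congr expR.
  by apply: eq_bigr => i _; rewrite mxE.
have E : (\int[P]_t (expR (enorm (noise_of (X ^~ t)) ^+ 2 / D))%:E <= (2 ^+ m)%:E)%E.
  under eq_integral do rewrite -gE.
  rewrite (integral_prod_seq mX iX (index_enum_uniq _) mg g0) big_sumType/=.
  rewrite big1 ?mul1e; last by move=> ij _; exact: integral_cstr.
  rewrite -[X in (2 ^+ X)%:E]card_ord -prodr_const -prodEFin.
  suff : forall r, (0 <= \prod_(i <- r) \int[P]_t (expR (X (inr i) t ^+ 2 / D))%:E /\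
      \prod_(i <- r) \int[P]_t (expR (X (inr i) t ^+ 2 / D))%:E <= \prod_(i <- r) 2%:E)%E.
    by move=> /(_ (index_enum 'I_m))[].
  elim=> [|i r [r0 IH]]; first by rewrite !big_nil; split.
  have i0 : (0 <= \int[P]_t (expR (X (inr i) t ^+ 2 / D))%:E)%E.
    by apply: integral_ge0 => t _; rewrite lee_fin expR_ge0.
  by rewrite !big_cons; split; [exact: mule_ge0|apply: lee_pmul => //; exact: eX].
have mE : measurable_fun setT (fun t => expR (enorm (noise_of (X ^~ t)) ^+ 2 / D)).
  by apply: measurableT_comp => //; exact: measurable_funM.
rewrite (_ : [set t | _] = [set t | expR (2 * m%:R) <=
    expR (enorm (noise_of (X ^~ t)) ^+ 2 / D)]); last first.
  by rewrite predeqE => t /=; rewrite ler_expR ler_pdivlMr// mulrAC.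
apply: le_trans (markov_ge0 P mE (fun=> expR_ge0 _) (expR_gt0 _)) _.
apply: (@le_trans _ _ ((expR (2 * m%:R))^-1%:E * (2 ^+ m)%:E)%E).
  by apply: lee_wpmul2l; rewrite ?lee_fin ?invr_ge0 ?expR_ge0.
rewrite -EFinM lee_fin.
have h2 : 2 ^+ m <= expR m%:R :> R.
  by rewrite -[m%:R]mul1r expRM_natr lerXn2r ?nnegrE ?expR_ge0//; exact: expR_ge1Dx.
have h3 : m%:R <= expR m%:R :> R.
  by apply: le_trans (expR_ge1Dx _); rewrite lerDr.
have e0 : 0 < expR m%:R :> R by exact: expR_gt0.
rewrite mulrC ler_pdivrMr ?expR_gt0// mulrC ler_pdivlMr//.
have -> : 2 * m%:R = m%:R + m%:R :> R by ring.
by rewrite expRD; apply: ler_pM.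
Qed.

Lemma prob_bad : (P [set t | ~ good_vector (X ^~ t)] <= (3 / n%:R + m%:R^-1)%:E)%E.
Proof.
have := prob_loo_ge; have := prob_noise_ge; have := prob_frobenius_ge.
set A1 := [set t | _]; set A2 := [set t | _]; set A3 := [set t | _] => h1 h2 h3.
have mA1 : measurable A1 by exact: measurable_ge.
have mA2 : measurable A2 by exact: measurable_ge.
have mA3 : measurable A3 by exact: measurable_ge.
apply: (@le_trans _ _ (P (A1 `|` (A2 `|` A3)))).
  apply: le_measure; rewrite ?inE.
  - by rewrite (_ : [set t | _] = ~` [set t | good_vector (X ^~ t)])//;
      apply: measurableC; exact: measurable_good.
  - by apply: measurableU => //; exact: measurableU.
  move=> t /= ng; apply: contrapT => nu; apply: ng.
  by split; rewrite leNgt; apply/negP => /ltW h; apply: nu; [right; right|right; left|left].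
apply: le_trans (measureU2 _ mA1 (measurableU _ _ mA2 mA3)) _.
apply: (@le_trans _ _ (n%:R^-1%:E + (m%:R^-1%:E + (2 / n%:R)%:E))%E).
  by apply: leeD => //; apply: le_trans (measureU2 _ mA2 mA3) _; exact: leeD.
by rewrite -!EFinD lee_fin; lra.
Qed.

End probability_of_good.
Section consequences_of_good.
Variables (tau M2 M : R) (x : I -> R).
Hypotheses (t0 : 0 < tau) (nm : tau * n%:R <= m%:R) (M20 : 0 < M2)
  (mu2 : enorm mu ^+ 2 <= M2 * n%:R) (muM : forall j, `|mu j 0| <= M)
  (good : good_vector x).

Let w := ridge_error lambda mu (design_of x) (noise_of x).
Let m0' : (0 : R) < m%:R. Proof. by rewrite ltr0n. Qed.
Let n0' : (0 : R) < n%:R. Proof. by rewrite ltr0n. Qed.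

Let mu2m : enorm mu ^+ 2 <= M2 / tau * m%:R.
Proof.
apply: le_trans mu2 _; rewrite -mulrA ler_wpM2l ?(ltW M20)//.
by rewrite mulrC ler_pdivlMr// mulrC.
Qed.

(** Since [n^2 = e^(2 ln n)] and every [loo_exp] is nonnegative, the bound on their sum bounds each
    score by [2 ln n] plus its normalization, which is O(1) by the energy bound on the leave-one-out
    residual. *)
Lemma good_ridge_error_coord j :
  `|w j 0| <= M + (2 * ln n%:R + v * (2 * D + lambda * (M2 / tau))) / lambda.
Proof.
have [gl gn _] := good.
apply: le_trans (ridge_error_coord m0 l0 j _ _ _) _; apply: lerD; first exact: muM.
rewrite ler_wpM2r ?invr_ge0 ?(ltW l0)//.
set S := \sum_i _; have SE : S = loo_score lambda mu j x.
  by apply: eq_bigr => i _; rewrite mxE.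
have lj : loo_exp lambda v mu j x <= expR (2 * ln n%:R).
  rewrite (_ : expR _ = n%:R ^+ 2); last by rewrite mulrC expRM_natr lnK.
  apply: le_trans gl; rewrite (bigD1 j)//= lerDl sumr_ge0// => k _.
  exact: loo_exp_ge0.
have rn : v / m%:R * enorm (loo_of lambda mu j x) ^+ 2 <= v * (2 * D + lambda * (M2 / tau)).
  have h : enorm (loo_of lambda mu j x) ^+ 2 <= (2 * D + lambda * (M2 / tau)) * m%:R.
    apply: le_trans (loo_residual_norm m0 l0 j _ _ _) _; rewrite mulrDl.
    by apply: lerD => //; rewrite -mulrA ler_pM2l.
  rewrite -mulrA ler_wpM2l//.
  by rewrite [leLHS]mulrC ler_pdivrMr.
have h1 : S <= 2 * ln n%:R + v / m%:R * enorm (loo_of lambda mu j x) ^+ 2.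
  rewrite -lerBlDr -ler_expR SE; apply: le_trans lj.
  by rewrite lerDl expR_ge0.
have h2 : - S <= 2 * ln n%:R + v / m%:R * enorm (loo_of lambda mu j x) ^+ 2.
  rewrite -lerBlDr -ler_expR SE; apply: le_trans lj.
  by rewrite lerDr expR_ge0.
by rewrite ler_norml; apply/andP; split; lra.
Qed.

Lemma good_ridge_error_norm :
  \sum_j w j 0 ^+ 2 <= (4 * D / lambda + 4 * (M2 / tau)) * m%:R.
Proof.
have [_ gn _] := good.
rewrite -enorm_sqr; apply: le_trans (ridge_error_norm m0 l0 _ _ _) _.
rewrite [leRHS]mulrDl; apply: lerD; last by rewrite -mulrA ler_wpM2l.
rewrite (_ : 4 * D / lambda * _ = 2 / lambda * (2 * D * m%:R)); last by field; rewrite gt_eqF.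
by rewrite ler_wpM2l// divr_ge0// ltW.
Qed.

Let absum i := \sum_j `|x (inl (i, j))|.

Let absum_sqr i : absum i ^+ 2 <= n%:R * \sum_j x (inl (i, j)) ^+ 2.
Proof.
rewrite expr2 /absum big_distrlr/=.
apply: (@le_trans _ _ (\sum_(j < n) \sum_(k < n)
   (2^-1 * x (inl (i, j)) ^+ 2 + 2^-1 * x (inl (i, k)) ^+ 2))).
  apply: ler_sum => j _; apply: ler_sum => k _.
  rewrite -(real_normK (num_real (x (inl (i, j))))) -(real_normK (num_real (x (inl (i, k))))).
  by have := sqr_ge0 (`|x (inl (i, j))| - `|x (inl (i, k))|); lra.
set h := fun j : 'I_n => 2^-1 * x (inl (i, j)) ^+ 2.
rewrite (eq_bigr (fun j => n%:R * h j + \sum_k h k)) => [|j _]; last first.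
  by rewrite big_split/= sumr_const card_ord mulr_natl.
rewrite big_split/= sumr_const card_ord -[_ *+ n]mulr_natl -mulr_sumr /h -mulr_sumr; lra.
Qed.

(* Crude Lipschitz bound: polynomial in [n], hence harmless for a mesh that is a
   large negative power of [n]. *)
Lemma good_ridge_cost_lipschitz (L delta : R) (w1 w2 : 'cV[R]_n) : 1 <= L -> M <= L ->
  0 <= delta ->
  (forall j, `|w1 j 0| <= L) -> (forall j, `|w2 j 0| <= L) ->
  (forall j, `|w1 j 0 - w2 j 0| <= delta) ->
  ridge_cost lambda mu w1 (design_of x) (noise_of x)
  <= ridge_cost lambda mu w2 (design_of x) (noise_of x)
     + delta * L * n%:R ^+ 2 * (3 / (2 * tau) + D + 2 * lambda / tau).
Proof.
move=> L1 ML d0 w1L w2L w12; have [_ gn gf] := good.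
have L0 : 0 <= L by exact: le_trans L1.
rewrite /ridge_cost -lerBlDl -mulrBr mulrC ler_pdivrMr//.
have r12 : enorm (design_of x *m w1 - noise_of x) ^+ 2 <=
    enorm (design_of x *m w2 - noise_of x) ^+ 2 +
    delta * (3 * L * (n%:R * frobenius_sqr x) + enorm (noise_of x) ^+ 2).
  rewrite (_ : frobenius_sqr x = \sum_i \sum_j x (inl (i, j)) ^+ 2); last first.
    by rewrite pair_big; apply: eq_bigr => -[].
  rewrite !enorm_sqr mulr_sumr mulr_sumr -big_split/= mulr_sumr -big_split/=.
  apply: ler_sum => i _; rewrite [noise_of x i 0]mxE.
  rewrite -!row_residualE; set r1 := row_residual _ i x; set r2 := row_residual _ i x.
  have d12 : `|r1 - r2| <= delta * absum i.
    rewrite (_ : r1 - r2 = \sum_j x (inl (i, j)) * w1 j 0 - \sum_j x (inl (i, j)) * w2 j 0); last first.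
      by rewrite /r1 /r2 /row_residual; ring.
    rewrite -sumrB.
    apply: le_trans (ler_norm_sum _ _ _) _; rewrite mulr_sumr; apply: ler_sum => j _.
    by rewrite -mulrBr normrM mulrC ler_wpM2r.
  have rb (u : 'cV[R]_n) : (forall j, `|u j 0| <= L) ->
      `|row_residual (fun j => u j 0) i x| <= L * absum i + `|x (inr i)|.
    move=> uL; apply: norm_sub_le => //.
    apply: le_trans (ler_norm_sum _ _ _) _; rewrite mulr_sumr; apply: ler_sum => j _.
    by rewrite normrM mulrC ler_wpM2r.
  have s12 : `|r1 + r2| <= 2 * (L * absum i + `|x (inr i)|).
    by apply: le_trans (norm_add_le (rb _ w1L) (rb _ w2L)) _; lra.
  have p12 := norm_mul_le d12 s12.
  have a0 : 0 <= absum i by rewrite sumr_ge0.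
  have aq := absum_sqr i.
  have x2 : `|x (inr i)| ^+ 2 = x (inr i) ^+ 2 by rewrite real_normK ?num_real.
  have q : 2 * absum i * (L * absum i + `|x (inr i)|) <= 
      3 * L * absum i ^+ 2 + x (inr i) ^+ 2.
    rewrite -x2; have := sqr_ge0 (absum i - `|x (inr i)|).
    have : 0 <= (L - 1) * absum i ^+ 2 by rewrite mulr_ge0 ?sqr_ge0//; lra.
    lra.
  have q2 : 3 * L * absum i ^+ 2 <= 3 * L * (n%:R * \sum_j x (inl (i, j)) ^+ 2).
    by rewrite ler_wpM2l// mulr_ge0.
  have : r1 ^+ 2 - r2 ^+ 2 <= delta * (3 * L * (n%:R * \sum_j x (inl (i, j)) ^+ 2) + x (inr i) ^+ 2).
    rewrite subr_sqr; apply: le_trans (ler_norm _) _; apply: le_trans p12 _.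
    rewrite -mulrA ler_wpM2l//; lra.
  rewrite mulrA in q q2 *; lra.
have c12 : enorm (w1 + mu) ^+ 2 <= enorm (w2 + mu) ^+ 2 + delta * (4 * L * n%:R).
  rewrite !enorm_sqr (_ : delta * (4 * L * n%:R) = \sum_(j < n) delta * (4 * L)); last first.
    by rewrite sumr_const card_ord -[RHS]mulr_natr mulrA.
  rewrite -big_split/=; apply: ler_sum => j _; rewrite !mxE.
  have h1 : `|w1 j 0 + mu j 0| <= 2 * L.
    by apply: le_trans (norm_add_le (w1L j) (muM j)) _; lra.
  have h2 : `|w2 j 0 + mu j 0| <= 2 * L.
    by apply: le_trans (norm_add_le (w2L j) (muM j)) _; lra.
  have := norm_mul_le (w12 j) (norm_add_le h1 h2) => /(le_trans (ler_norm _)); lra.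
have mn1 : 1 <= n%:R :> R by rewrite ler1n.
have nm' := nm; have Npos := n0'.
set N := n%:R in gf gn mn1 nm' Npos r12 c12 *.
have nf : 3 * L * (N * frobenius_sqr x) <= 3 * L * N ^+ 3.
  by rewrite ler_wpM2l ?mulr_ge0// [leRHS]exprS ler_wpM2l// ltW.
have step : delta * (3 * L * (N * frobenius_sqr x) + enorm (noise_of x) ^+ 2)
    <= delta * (3 * L * N ^+ 3 + 2 * D * m%:R).
  by rewrite ler_wpM2l//; lra.
have lstep : lambda * enorm (w1 + mu) ^+ 2 <= 
    lambda * enorm (w2 + mu) ^+ 2 + lambda * (delta * (4 * L * N)).
  by rewrite -mulrDr ler_pM2l.
apply: (@le_trans _ _ (delta * (3 / 2 * L * N ^+ 3 + D * m%:R + 2 * lambda * L * N))).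
  lra.
(* [N <= m / tau] turns a power of [N] into the factor [m] that multiplies the cost; the remaining
   gaps are filled by [1 <= L] and [1 <= N]. *)
rewrite (_ : delta * L * N ^+ 2 * _ * _ =
  delta * (3 / 2 * L * N ^+ 2 * (m%:R / tau) + D * L * N ^+ 2 * m%:R
    + 2 * lambda * L * N ^+ 2 * (m%:R / tau))); last by field; rewrite gt_eqF.
have Nm : N <= m%:R / tau by rewrite ler_pdivlMr// mulrC.
have LN2 : 1 <= L * N ^+ 2.
  by rewrite -[1]mulr1; apply: ler_pM => //; rewrite exprn_ege1.
have N2 : 1 <= N ^+ 2 by rewrite exprn_ege1.
rewrite ler_wpM2l//; apply: lerD; first apply: lerD.
- rewrite (_ : 3 / 2 * L * N ^+ 3 = 3 / 2 * L * N ^+ 2 * N); last by ring.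
  apply: ler_wpM2l => //; apply: mulr_ge0; last by rewrite exprn_ge0// ltW.
  by apply: mulr_ge0 => //; lra.
- rewrite (_ : D * L * N ^+ 2 * m%:R = D * m%:R * (L * N ^+ 2)); last by ring.
  by apply: ler_peMr => //; apply: mulr_ge0 => //; exact: ltW.
- rewrite -[leRHS]mulrA; apply: ler_wpM2l.
    by apply: mulr_ge0 => //; apply: mulr_ge0 => //; exact: ltW.
  by apply: le_trans Nm _; apply: ler_peMl => //; apply: divr_ge0 => //; exact: ltW.
Qed.

End consequences_of_good.

End good_event.

(** * Infima over arbitrary sets and nets *)

Section countable_dense.
Context (R : realType) (n : nat) (S : set 'cV[R]_n).

(* One representative of [S] in each nonempty rational ball. *)
Lemma countable_dense_subset : exists r : nat -> option 'cV[R]_n,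
  (forall p w, r p = Some w -> S w) /\
  forall w e, S w -> 0 < e -> exists p w', r p = Some w' /\ forall j, `|w' j 0 - w j 0| < e.
Proof.
pose cell (u : {ffun 'I_n -> rat} * nat) : set 'cV[R]_n :=
  [set w | S w /\ forall j, `|w j 0 - ratr (u.1 j)| < u.2.+1%:R^-1].
pose r p := if (unpickle p : option ({ffun 'I_n -> rat} * nat)) is Some u then
  (if `[< cell u !=set0 >] then Some (get (cell u)) else None) else None.
exists r; split.
  move=> p w; rewrite /r; case: (unpickle p) => // u; case: asboolP => // -[w' w'u] [<-].
  by have [] : cell u (get (cell u)) by exact: getI w'u.
move=> w e Sw e0.
have e20 : 0 < e / 2 by rewrite divr_gt0.
have [k ke] := ltr_add_invr e20; rewrite add0r in ke.
have k0 : (0 : R) < k.+1%:R^-1 by rewrite invr_gt0.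
have /choice[q qE] j : exists q : rat, ratr q \in `]w j 0 - k.+1%:R^-1, w j 0 + k.+1%:R^-1[.
  by apply: rat_in_itvoo; rewrite ltrBlDr -addrA ltrDl addr_gt0.
pose u := ([ffun j => q j], k).
have wu : cell u w.
  split=> // j; have := qE j; rewrite ffunE in_itv/= => /andP[h1 h2].
  by rewrite ltr_distlC -ltrBlDr h1 ltrBlDr -ltrBlDr; rewrite ltrBlDr.
have [Sg gu] : cell u (get (cell u)) by exact: getI wu.
exists (pickle u), (get (cell u)); split.
  by rewrite /r pickleK; case: asboolP => // -[]; exists w.
move=> j; have := gu j; have := wu.2 j.
move: ke; rewrite /=; set h := _^-1; set a := ratr _; set b := fun_of_matrix _ j 0 => ke.
by rewrite !ltr_norml => /andP[h1 h2] /andP[h3 h4]; apply/andP; split; lra.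
Qed.

End countable_dense.

(** * Measurability of the constrained minimum *)

Section measurable_ridge_min.
Context (R : realType) (m n : nat) (lambda : R) (mu : 'cV[R]_n).

Lemma continuous_sum_sqr p (f : 'I_p -> 'cV[R]_n -> R) : (forall i, continuous (f i)) ->
  continuous (fun w => \sum_i f i w ^+ 2).
Proof.
move=> cf; elim: p f cf => [|p IH] f cf.
  by rewrite (_ : (fun _ => _) = (fun=> 0)); [exact: cst_continuous|apply/funext => w; rewrite big_ord0].
rewrite (_ : (fun _ => _) = (fun w => f ord0 w * f ord0 w + \sum_(i < p) f (lift ord0 i) w ^+ 2)).
  move=> w; apply: (@continuousD _ _ _ (fun w => f ord0 w * f ord0 w)).
    by apply: (@continuousM _ _ (f ord0) (f ord0)); exact: cf.
  exact: (IH (fun i => f (lift ord0 i)) (fun i => cf _) w).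
by apply/funext => w; rewrite big_ord_recl expr2.
Qed.

Lemma continuous_ridge_cost (A : 'M[R]_(m, n)) xi :
  continuous (fun w => ridge_cost lambda mu w A xi).
Proof.
have clin p (a : 'I_p -> R) (u : 'I_p -> 'I_n) : continuous (fun w : 'cV[R]_n => \sum_i a i * w (u i) 0).
  elim: p a u => [|p IH] a u.
    by rewrite (_ : (fun _ => _) = (fun=> 0)); [exact: cst_continuous|apply/funext => w; rewrite big_ord0].
  rewrite (_ : (fun _ => _) = (fun w : 'cV[R]_n => a ord0 * w (u ord0) 0 +
      \sum_(i < p) a (lift ord0 i) * w (u (lift ord0 i)) 0)).
    move=> w; apply: (@continuousD _ _ _ (fun w : 'cV[R]_n => a ord0 * w (u ord0) 0)).
      by apply: (@continuousM _ _ (fun=> a ord0) (fun w : 'cV[R]_n => w (u ord0) 0)); [exact: cst_continuous|exact: coord_continuous].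
    exact: (IH (fun i => a (lift ord0 i)) (fun i => u (lift ord0 i)) w).
  by apply/funext => w; rewrite big_ord_recl.
rewrite (_ : (fun w => _) = (fun w : 'cV[R]_n => m%:R^-1 * (2^-1 * (\sum_i (\sum_j A i j * w j 0 - xi i 0) ^+ 2)
    + lambda / 2 * (\sum_j (w j 0 + mu j 0) ^+ 2)))); last first.
  apply/funext => w; rewrite /ridge_cost !enorm_sqr; congr (_ * (_ * _ + _ * _)).
    by apply: eq_bigr => i _; rewrite !mxE.
  by apply: eq_bigr => i _; rewrite !mxE.
pose f i (w : 'cV[R]_n) := \sum_j A i j * w j 0 - xi i 0.
pose g j (w : 'cV[R]_n) := w j 0 + mu j 0.
have cf i : continuous (f i).
  move=> w; apply: (@continuousB _ _ _ (fun w : 'cV[R]_n => \sum_j A i j * w j 0) (fun=> xi i 0)).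
    exact: (clin _ (A i) id).
  exact: cst_continuous.
have cg j : continuous (g j).
  move=> w; apply: (@continuousD _ _ _ (fun w : 'cV[R]_n => w j 0) (fun=> mu j 0)).
    exact: coord_continuous.
  exact: cst_continuous.
have cM (c : R) (h : 'cV[R]_n -> R) : continuous h -> continuous (fun w => c * h w).
  by move=> ch w; apply: (@continuousM _ _ (fun=> c) h); [exact: cst_continuous|exact: ch].
apply: (cM _ (fun w => 2^-1 * \sum_i f i w ^+ 2 + lambda / 2 * \sum_j g j w ^+ 2)) => w.
apply: (@continuousD _ _ _ (fun w => 2^-1 * \sum_i f i w ^+ 2)
  (fun w => lambda / 2 * \sum_j g j w ^+ 2)).
  exact: (cM _ _ (continuous_sum_sqr cf)).
exact: (cM _ _ (continuous_sum_sqr cg)).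
Qed.

Context d (U : measurableType d) (A : U -> 'M[R]_(m, n)) (xi : U -> 'cV[R]_m).
Hypotheses (mA : measurable_entries A) (mxi : measurable_entries xi).

Lemma measurable_ridge_cost w : measurable_fun setT (fun t => ridge_cost lambda mu w (A t) (xi t)).
Proof.
rewrite /ridge_cost; apply: measurable_funM => //; apply: measurable_funD => //.
apply: measurable_funM => //; apply: measurable_enorm_sqr.
apply: measurable_addmx; last exact: measurable_oppmx.
by apply: measurable_mulmx => //; exact: measurable_cstmx.
Qed.

(** By continuity of the cost, a value below [c] somewhere in [S] persists at some point of a
    countable dense part of [S]. The event is a countable union even though [S] is arbitrary. *)
Lemma measurable_ridge_min_lt (S : set 'cV[R]_n) c :
  measurable [set t | (ridge_min lambda mu S (A t) (xi t) < c%:E)%E].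
Proof.
have [r [rS rd]] := countable_dense_subset S.
rewrite (_ : [set t | _] = \bigcup_p (if r p is Some w then
    [set t | ridge_cost lambda mu w (A t) (xi t) < c] else set0)).
  apply: bigcupT_measurable => p; case: (r p) => // w.
  rewrite -[X in measurable X]setTI (_ : [set t | _] =
    (fun t => ridge_cost lambda mu w (A t) (xi t)) @^-1` `]-oo, c[%classic).
    by apply: measurable_ridge_cost => //; exact: measurable_itv.
  by rewrite predeqE => t; split; rewrite /= in_itv.
rewrite predeqE => t; split => [/ereal_inf_ltP[_ [w Sw <-]]|[p _]].
  rewrite lte_fin => wc.
  have := @continuous_ridge_cost (A t) (xi t) w; move/cvgrPdist_lt => /(_ (c - ridge_cost lambda mu w (A t) (xi t))).
  rewrite subr_gt0 => /(_ wc)/nbhs_ballP[e /= e0 eb].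
  have [p [w' [rp w'w]]] := rd w e Sw e0.
  exists p => //; rewrite rp /=.
  have : ball w e w'.
    by split => // i j; rewrite (ord1 j) /ball/= distrC; exact: w'w.
  move=> /eb /=; rewrite ltr_norml => /andP[h1 h2]; lra.
case E : (r p) => [w|//] /= wc; apply/ereal_inf_ltP.
exists (ridge_cost lambda mu w (A t) (xi t))%:E; last by rewrite lte_fin.
by exists w => //; exact: rS E.
Qed.

Lemma measurable_ridge_min_ge (S : set 'cV[R]_n) c :
  measurable [set t | (c%:E <= ridge_min lambda mu S (A t) (xi t))%E].
Proof.
rewrite (_ : [set t | _] = ~` [set t | (ridge_min lambda mu S (A t) (xi t) < c%:E)%E]).
  by apply: measurableC; exact: measurable_ridge_min_lt.
by rewrite predeqE => t; split => /=; [rewrite leNgt => /negP|move=> /negP; rewrite -leNgt].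
Qed.

Lemma measurable_ridge_min_le (S : set 'cV[R]_n) c :
  measurable [set t | (ridge_min lambda mu S (A t) (xi t) <= c%:E)%E].
Proof.
rewrite (_ : [set t | _] = \bigcap_p
    [set t | (ridge_min lambda mu S (A t) (xi t) < (c + p.+1%:R^-1)%:E)%E]).
  by apply: bigcapT_measurable => p; exact: measurable_ridge_min_lt.
rewrite predeqE => t; split => [/= h p _ /=|h /=].
  by apply: le_lt_trans h _; rewrite lte_fin ltrDl invr_gt0.
apply/lee_addgt0Pr => e e0; have [k ke] := ltr_add_invr e0; rewrite add0r in ke.
apply/ltW; apply: lt_trans (h k Logic.I) _.
by rewrite -EFinD lte_fin ltrD2l.
Qed.

End measurable_ridge_min.

(** One point of [S] is chosen in each occupied cell of side [delta]. The net consists of points of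
    [S] itself, so a lower bound for the cost on [S] holds on the net. *)
Lemma finite_net (R : realType) n (S : set 'cV[R]_n) (L delta : R) (N : nat) :
  0 < delta -> 2 * L < delta * N.+1%:R -> S !=set0 ->
  (forall w, S w -> forall j, `|w j 0| <= L) ->
  exists (C : finType) (r : C -> 'cV[R]_n),
    [/\ (0 < #|C| <= N.+1 ^ n)%N, forall c, S (r c) &
        forall w, S w -> exists c, forall j, `|w j 0 - r c j 0| <= delta].
Proof.
move=> d0 LN [w0 Sw0] SL.
pose code (w : 'cV[R]_n) : {ffun 'I_n -> 'I_N.+1} :=
  [ffun j => inord (Num.truncn ((w j 0 + L) / delta))].
have codeE w j : S w -> delta * (code w j)%:R <= w j 0 + L < delta * (code w j)%:R + delta.
  move=> Sw; have := SL w Sw j; rewrite ler_norml => /andP[h1 h2].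
  have x0 : 0 <= (w j 0 + L) / delta by apply: divr_ge0; [lra|exact: ltW].
  have /andP[t1 t2] := truncn_itv x0.
  rewrite ffunE inordK; last first.
    rewrite -(ltr_nat R); apply: le_lt_trans t1 _; rewrite ltr_pdivrMr// mulrC; lra.
  move: t1 t2; rewrite ler_pdivlMr// ltr_pdivrMr// -natr1.
  by set k := (Num.truncn _)%:R => h3 h4; apply/andP; split; lra.
pose occ (c : {ffun 'I_n -> 'I_N.+1}) := `[< exists w, S w /\ code w = c >].
pose C : finType := {c | occ c}.
have rP (c : C) : exists w, S w /\ code w = val c by apply/asboolP; exact: (valP c).
have /choice[r rE] := rP.
have occc w : S w -> occ (code w) by move=> Sw; apply/asboolP; exists w.
exists C, r; split.
- apply/andP; split; first by apply/card_gt0P; exists (Sub (code w0) (occc _ Sw0)).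
  rewrite card_sig; apply: leq_trans (max_card _) _.
  by rewrite card_ffun !card_ord.
- by move=> c; case: (rE c).
- move=> w Sw; exists (Sub (code w) (occc _ Sw)) => j.
  have [] := rE (Sub (code w) (occc _ Sw)); rewrite SubK => Sr cr.
  have := codeE _ j Sw; have := codeE _ j Sr; rewrite cr => /andP[h1 h2] /andP[h3 h4].
  by rewrite ler_norml; apply/andP; split; lra.
Qed.

(** * Matrix designs *)

Section orlicz.
Context (R : realType) d (T : measurableType d) (P : probability T R).

Lemma psi2_norm_ge0 (X : T -> R) : (0 <= psi2_norm P X)%E.
Proof. by apply/ereal_infP => _ [t /= [t0 _] <-]; rewrite lee_fin ltW. Qed.

(** The infimum need not be attained: the strict [L < t] provides an admissible parameter below [t],
    and the expectation decreases in the parameter. *)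
Lemma psi2_norm_exp (X : T -> R) (L t : R) : measurable_fun setT X ->
  (psi2_norm P X <= L%:E)%E -> L < t ->
  (\int[P]_w (expR (X w ^+ 2 / t ^+ 2))%:E <= 2%:E)%E.
Proof.
move=> mX XL Lt.
have /ereal_inf_ltP[_ [s /= [s0 s2] <-]] : (psi2_norm P X < t%:E)%E.
  by apply: le_lt_trans XL _; rewrite lte_fin.
rewrite lte_fin => st; rewrite unlock in s2; apply: le_trans s2.
have mE (u : R) : measurable_fun setT (fun w => expR (X w ^+ 2 / u ^+ 2)).
  by apply: measurableT_comp => //; apply: measurable_funM => //; exact: measurable_funX.
apply: ge0_le_integral => //.
- by apply/measurable_EFinP; exact: mE.
- by apply/measurable_EFinP; exact: mE.
move=> w _; rewrite lee_fin ler_expR ler_wpM2l ?sqr_ge0//.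
have t0 : 0 < t by exact: lt_trans s0 st.
by rewrite lef_pV2 ?posrE ?exprn_gt0// ltW// ltrXn2r// ?nnegrE ltW.
Qed.

Lemma centered_variance (X : T -> R) : ('E_P[X] = 0)%E ->
  ('V_P[X] = \int[P]_t (X t ^+ 2)%:E)%E.
Proof.
move=> EX; rewrite /variance unlock EX /= unlock.
apply: eq_integral => t _; congr (_%:E).
by transitivity ((X t - 0) * (X t - 0)) => //; rewrite subr0 expr2.
Qed.

Lemma mutually_independent_comp (I : finType) (X : I -> T -> R) (f : I -> R -> R) :
  mutually_independent P X -> (forall k, measurable_fun setT (f k)) ->
  mutually_independent P (fun k t => f k (X k t)).
Proof.
move=> iX mf J B mB; apply: (iX J (fun k => f k @^-1` B k)) => k.
by rewrite -[X in measurable X]setTI; exact: mf.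
Qed.

Lemma measurable_preim_coord (I : finType) (X : I -> T -> R) (B : I -> set R) :
  (forall i, measurable (B i)) -> sigma_of X [set t | forall i, B i (X i t)].
Proof.
move=> mB; rewrite (_ : [set t | _] = \bigcap_(i in [set: I]) (X i @^-1` B i)); last first.
  by rewrite predeqE => t; split => [h i _|h i]; exact: h.
apply: (@fin_bigcap_measurable _ (g_sigma_algebraType
   [set E | exists i (B : set R), measurable B /\ E = X i @^-1` B])).
  exact: finite_finset.
by move=> i _; apply: sub_sigma_algebra; exists i, (B i).
Qed.

End orlicz.

Section designs.
Context (R : realType) (m n : nat) d (T : measurableType d) (P : probability T R).
Hypotheses (m0 : (0 < m)%N) (n0 : (0 < n)%N).
Variables (sigma L : R).
Hypothesis s0 : 0 < sigma.

(** Positive and strictly above [L], whatever the sign of [L]. *)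
Let t := `|L| + 1.
Let t0 : 0 < t. Proof. by rewrite ltr_wpDl. Qed.
Let m0' : (0 : R) < m%:R. Proof. by rewrite ltr0n. Qed.

(** A single proxy for all entries: [2 t^2] for the design, [2 t^2 sigma^2] for the noise, and 1,
    which exceeds the 1/2 of the normal entries. For design and normal entries the scale [1/m] is
    split off in [entry_proxy]. *)
Definition design_proxy : R := 2 * t ^+ 2 + 2 * t ^+ 2 * sigma ^+ 2 + 1.

Lemma design_proxy_ge0 : 0 <= design_proxy.
Proof.
rewrite /design_proxy; have := sqr_ge0 t; have := mulr_ge0 (sqr_ge0 t) (sqr_ge0 sigma); lra.
Qed.

Definition noise_scale : R := t ^+ 2 * sigma ^+ 2.

Lemma noise_scale_gt0 : 0 < noise_scale.
Proof. by rewrite mulr_gt0// exprn_gt0. Qed.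

Section subgaussian_design.
Variables (A : T -> 'M[R]_(m, n)) (xi : T -> 'cV[R]_m).
Hypothesis dA : design_condition P sigma L A xi.

Let A0 (u : T) := Num.sqrt m%:R *: A u.
Let xi0 (u : T) := sigma^-1 *: xi u.
Let X0 := entries_pair A0 xi0.
Let c (k : entry_index m n) := if k is inl _ then (Num.sqrt m%:R)^-1 else sigma.

Let sm0 : 0 < Num.sqrt m%:R :> R. Proof. by rewrite sqrtr_gt0. Qed.

Let pairE k u : entries_pair A xi k u = c k * X0 k u.
Proof.
case: k => [ij|i] /=; rewrite mxE mulrA ?mulVf ?mulfV ?mul1r// gt_eqF//.
Qed.

Lemma measurable_pair k : measurable_fun setT (entries_pair A xi k).
Proof. by have [[mA mxi] _ _ _ _] := dA; case: k => [ij|i]; [exact: mA|exact: mxi]. Qed.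

Let mX0 k : measurable_fun setT (X0 k).
Proof.
have [[mA mxi] _ _ _ _] := dA.
case: k => [ij|i].
  rewrite (_ : X0 _ = fun u => Num.sqrt m%:R * A u ij.1 ij.2).
    by apply: measurable_funM => //; exact: mA.
  by apply/funext => u; rewrite /X0 /= mxE.
rewrite (_ : X0 _ = fun u => sigma^-1 * xi u i 0).
  by apply: measurable_funM => //; exact: mxi.
by apply/funext => u; rewrite /X0 /= mxE.
Qed.

Let EX0 k : (\int[P]_u (X0 k u)%:E = 0)%E.
Proof. by have [_ _ + _ _] := dA => /(_ k); rewrite unlock. Qed.

Let VX0 k : (\int[P]_u (X0 k u ^+ 2)%:E = 1%:E)%E.
Proof. by have [_ _ /(_ k) e /(_ k) + _] := dA; rewrite centered_variance. Qed.

Let psi2X0 k : (psi2_norm P (X0 k) <= L%:E)%E.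
Proof.
have [_ _ _ _ h] := dA; case: k => [[i j]|i].
  by apply: le_trans (h i j); rewrite leeDl// psi2_norm_ge0.
by apply: le_trans (h i (Ordinal n0)); rewrite leeDr// psi2_norm_ge0.
Qed.

Let expX0 k : (\int[P]_u (expR (X0 k u ^+ 2 / t ^+ 2))%:E <= 2%:E)%E.
Proof.
apply: psi2_norm_exp (psi2X0 k) _ => //.
by apply: le_lt_trans (ler_norm L) _; rewrite ltrDl.
Qed.

Lemma subgaussian_family_design : subgaussian_family P design_proxy (entries_pair A xi).
Proof.
split=> [k||k]; first exact: measurable_pair.
- have [_ iX _ _ _] := dA.
  rewrite (_ : entries_pair A xi = fun k u => c k * X0 k u).
    by apply: (mutually_independent_comp iX (f := fun k x => c k * x)) => k; exact: measurable_funM.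
  by apply/funext => k; apply/funext => u.
- rewrite (_ : entries_pair A xi k = fun u => c k * X0 k u); last by apply/funext.
  apply: subgaussian_le (subgaussian_scale (c k) (subgaussian_psi2 (mX0 k) t0 (expX0 k) (EX0 k))).
  have p1 : 0 <= t ^+ 2 * sigma ^+ 2 by rewrite mulr_ge0// sqr_ge0.
  have p2 : 0 <= t ^+ 2 by rewrite sqr_ge0.
  case: k => [ij|i] /=; rewrite /design_proxy; last by lra.
  rewrite exprVn sqr_sqrtr ?ler0n// ler_wpM2r ?invr_ge0 ?ler0n//; lra.
Qed.

Lemma standardized_design : standardized_entries P (entries_pair A xi).
Proof.
move=> ij; have sX := subgaussian_psi2 (mX0 (inl ij)) t0 (expX0 _) (EX0 _).
have iX : P.-integrable setT (EFin \o X0 (inl ij)).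
  have := subgaussian_integrable 1 (mX0 (inl ij)) sX.
  by congr (_.-integrable _ _); apply/funext => u /=; rewrite expr1.
split.
  under eq_integral do rewrite pairE EFinM.
  by rewrite integralZl// EX0 mule0.
under eq_integral do rewrite pairE exprMn.
rewrite integral_mulrl ?sqr_ge0//; last 2 first.
- exact: measurable_funX.
- by move=> u; exact: sqr_ge0.
by rewrite VX0 mule1 /= exprVn sqr_sqrtr ?ler0n.
Qed.

Lemma noise_exp_moment i :
  (\int[P]_u (expR (entries_pair A xi (inr i) u ^+ 2 / noise_scale))%:E <= 2%:E)%E.
Proof.
under eq_integral => u _.
  rewrite pairE [c _]/= (_ : _ / _ = X0 (inr i) u ^+ 2 / t ^+ 2); last first.
    by rewrite /noise_scale; field; rewrite !gt_eqF.
  over.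
exact: expX0.
Qed.

Lemma mutually_independent_noise : mutually_independent P (fun i => entries_pair A xi (inr i)).
Proof.
have [_ iX _] := subgaussian_family_design.
apply: mutually_independentE => B mB.
have := mutually_independentT iX (B := fun k => if k is inr i then B i else setT).
rewrite big_sumType/= [X in (X * _)%E]big1 ?mul1e => [<-|ij _]; last 2 first.
- by case.
- by rewrite preimage_setT probability_setT.
congr (P _); rewrite predeqE => u; split => [h [ij|i]//=|h i]; exact: (h (inr i)).
Qed.

Section gaussian.
Variable G : T -> 'M[R]_(m, n).
Hypothesis dG : gaussian_design P G xi.

Let sq0 : 0 < Num.sqrt m%:R^-1 :> R. Proof. by rewrite sqrtr_gt0 invr_gt0. Qed.

Let mG i j : measurable_fun setT (fun u => G u i j). Proof. by case: dG. Qed.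

(** A box factors first between [G] and [xi], by independence of the generated sigma-algebras, and
    then inside each block; independence inside [xi] is inherited from the design condition on
    [A]. *)
Lemma mutually_independent_gaussian_pair : mutually_independent P (entries_pair G xi).
Proof.
have [_ iG _ ind] := dG; apply: mutually_independentE => B mB.
rewrite (_ : [set u | _] = [set u | forall k, B (inl k) (entries G k u)] `&`
   [set u | forall k : 'I_m * 'I_1, B (inr k.1) (entries xi k u)]); last first.
  rewrite predeqE => u; split => [h|[h1 h2] [k|i]].
  - split=> [k|[i j]]; first exact: (h (inl k)).
    by rewrite /entries /= (ord1 j); exact: (h (inr i)).
  - exact: h1.
  - exact: (h2 (i, 0)).
rewrite ind; last 2 first.
- exact: (measurable_preim_coord _ (B := fun k => B (inl k))).
- exact: (measurable_preim_coord _ (B := fun k => B (inr k.1))).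
rewrite (mutually_independentT iG (B := fun k => B (inl k)))// big_sumType/=; congr (_ * _)%E.
rewrite -(mutually_independentT mutually_independent_noise (B := fun k => B (inr k)))//.
congr (P _); rewrite predeqE => u; split => h; first by move=> i; exact: (h (i, 0)).
by move=> [i j]; rewrite /entries /= (ord1 j); exact: (h i).
Qed.

Lemma subgaussian_family_gaussian : subgaussian_family P design_proxy (entries_pair G xi).
Proof.
have [_ _ lG _] := dG; split.
- by case=> [ij|i]; [exact: mG|exact: (measurable_pair (inr i))].
- exact: mutually_independent_gaussian_pair.
case=> [ij|i]; last by have [_ _ h] := subgaussian_family_design; exact: (h (inr i)).
apply: subgaussian_le (gaussian_subgaussian (mG _ _) sq0 (lG ij.1 ij.2)).
rewrite sqr_sqrtr ?invr_ge0 ?ler0n//= mulrC ler_wpM2r ?invr_ge0 ?ler0n// /design_proxy.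
have p1 : 0 <= t ^+ 2 * sigma ^+ 2 by rewrite mulr_ge0// sqr_ge0.
have p2 : 0 <= t ^+ 2 by rewrite sqr_ge0.
lra.
Qed.

Lemma standardized_gaussian : standardized_entries P (entries_pair G xi).
Proof.
have [_ _ lG _] := dG; move=> ij; split; first exact: gaussian_mean (mG _ _) sq0 (lG _ _).
rewrite (_ : m%:R^-1 = Num.sqrt m%:R^-1 ^+ 2 :> R).
  exact: gaussian_variance (mG _ _) sq0 (lG _ _).
by rewrite sqr_sqrtr// invr_ge0 ler0n.
Qed.

End gaussian.
End subgaussian_design.

Lemma design_of_pair (A : T -> 'M[R]_(m, n)) xi u : design_of (entries_pair A xi ^~ u) = A u.
Proof. by apply/matrixP => i j; rewrite mxE. Qed.

Lemma noise_of_pair (A : T -> 'M[R]_(m, n)) (xi : T -> 'cV[R]_m) u :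
  noise_of (entries_pair A xi ^~ u) = xi u.
Proof. by apply/matrixP => i j; rewrite mxE (ord1 j). Qed.

End designs.

(** * Comparison of the two designs *)

Section softmin_of_net.
Context (R : realType) (m n : nat).
Local Notation I := (entry_index m n).
Variables (lambda : R) (mu : 'cV[R]_n) (C : finType) (r : C -> 'cV[R]_n) (b : R).
Hypotheses (m0 : (0 < m)%N) (b0 : 0 <= b) (C0 : (0 < #|C|)%N).

Let m0' : (0 : R) < m%:R. Proof. by rewrite ltr0n. Qed.

Definition sample_cost (w : 'cV[R]_n) (x : I -> R) : R :=
  ridge_cost lambda mu w (design_of x) (noise_of x).

Definition net_row (c : C) (j : 'I_n) : R := r c j 0.
Definition net_penalty (c : C) : R := lambda / 2 * enorm (r c + mu) ^+ 2.
Local Notation Z := (partition_sum net_row net_penalty b).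

Lemma gibbs_energyE c x : gibbs_energy net_row net_penalty b c x = b * (m%:R * sample_cost (r c) x).
Proof.
rewrite /gibbs_energy /sample_cost /ridge_cost mulVKf ?gt_eqF//; congr (_ * (_ * _ + _)).
by rewrite enorm_sqr; apply: eq_bigr => i _; rewrite -row_residualE.
Qed.

(** One term of the sum suffices: the soft minimum never exceeds a cost on the net. *)
Lemma ln_partition_ge c x y : sample_cost (r c) x <= y -> - (b * m%:R * y) <= ln (Z x).
Proof.
move=> cy; rewrite -ler_expR lnK ?posrE; last exact: partition_sum_gt0.
rewrite /partition_sum (bigD1 c)//=; apply: (@le_trans _ _ (expR (- gibbs_energy net_row net_penalty b c x))).
  rewrite ler_expR lerN2 gibbs_energyE -mulrA ler_wpM2l// ler_pM2l//.
by rewrite lerDl sumr_ge0// => c' _; exact: expR_ge0.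
Qed.

(** Bounding all terms alike: the soft minimum falls short of the minimum over the net by at most
    [ln #|C| / (b m)], the entropy cost. *)
Lemma ln_partition_le x y : (forall c, y <= sample_cost (r c) x) ->
  ln (Z x) <= ln #|C|%:R - b * m%:R * y.
Proof.
move=> yc; have C0' : (0 : R) < #|C|%:R by rewrite ltr0n.
have /card_gt0P[c0 _] := C0.
rewrite -ler_expR lnK ?posrE; last exact: partition_sum_gt0.
rewrite expRD lnK ?posrE// mulr_natl -sumr_const; apply: ler_sum => c _.
by rewrite ler_expR lerN2 gibbs_energyE -mulrA ler_wpM2l// ler_pM2l.
Qed.

Section transfer.
Context d (T : measurableType d) (P : probability T R) (X Y : I -> T -> R) (v C1 L : R).
Hypotheses (v0 : 0 <= v) (b1 : 1 <= b) (L1 : 1 <= L) (Lm : L ^+ 2 <= m%:R)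
  (rL : forall c j, `|r c j 0| <= L) (rC1 : forall c, \sum_j r c j 0 ^+ 2 <= C1 * m%:R)
  (fX : subgaussian_family P v X) (fY : subgaussian_family P v Y)
  (sX : standardized_entries P X) (sY : standardized_entries P Y)
  (XY : forall i, X (inr i) = Y (inr i)).

Definition lindeberg_error (th : R) : R :=
  (m * n)%:R * (2 * swap_moment m v * swap_constant v C1 L b th).

Lemma measurable_test_family (Y' : I -> T -> R) (th a : R) : (forall k, measurable_fun setT (Y' k)) ->
  measurable_fun setT (fun t => softmin_test net_row net_penalty b th a (Y' ^~ t)).
Proof.
move=> mY; apply: (measurableT_comp (@measurable_softmin_test R m n C net_row net_penalty b th a)).
exact: measurable_fvec.
Qed.

(** Markov at level 1/2 gives the factor 2, and the exchange passes from [X] to [Y]. There the test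
    is at most 1 on [E] and at most [e^(-l)] off it. *)
Lemma softmin_transfer (th a l : R) (E : set T) : measurable E -> `|th| <= 1 ->
  (forall t, ~ E t -> th * ln (Z (Y ^~ t)) + a <= - l) ->
  (P [set t | (2^-1 <= softmin_test net_row net_penalty b th a (X ^~ t))%R]
   <= 2%:E * (P E + (expR (- l) + lindeberg_error th)%:E))%E.
Proof.
move=> mE th1 EY; have [mX _ _] := fX; have [mY _ _] := fY.
have /card_gt0P[c0 _] := C0.
have h20 : (0 : R) < 2^-1 by rewrite invr_gt0.
have s0 (y : I -> R) : 0 <= softmin_test net_row net_penalty b th a y by rewrite ltW// sigmoid_gt0.
have mk := markov_ge0 P (measurable_test_family th a mX) (fun=> s0 _) h20.
apply: le_trans mk _.
rewrite invrK; apply: lee_wpmul2l; first by rewrite lee_fin.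
apply: le_trans (ridge_lindeberg a m0 v0 b1 L1 Lm th1 c0 net_penalty rL rC1 fX fY sX sY _) _.
  by move=> i B mB; rewrite XY.
rewrite EFinD addeA -/(lindeberg_error th); apply: leeD => //.
pose g t := \1_E t + expR (- l) : R.
have mg : measurable_fun setT g by apply: measurable_funD => //; exact: measurable_indic.
have fg t : softmin_test net_row net_penalty b th a (Y ^~ t) <= g t.
  rewrite /g indicE; case: (boolP (t \in E)) => [_|/negP nE].
    by apply: le_trans (sigmoid_le1 _) _; rewrite lerDl expR_ge0.
  rewrite add0r; apply: le_trans (sigmoid_le_expR _) _.
  by rewrite ler_expR; apply: EY => Et; apply: nE; exact: mem_set.
apply: le_trans (integral_ler P (measurable_test_family th a mY) mg (fun=> s0 _) fg) _.
rewrite /g integral_addr//.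
by rewrite integral_cstr integral_indic// setIT.
Qed.

End transfer.
End softmin_of_net.

(** * From the test functions to the event of the theorem *)

Section universality_of_the_event.
Context (R : realType) (m n : nat) d (T : measurableType d) (P : probability T R).
Local Notation I := (entry_index m n).
Variables (lambda tau v D M2 M L delta b th : R) (N : nat) (mu : 'cV[R]_n).
Variables (X Y : I -> T -> R) (S : set 'cV[R]_n) (z rho eps : R).

(* [C1] is the constant of [good_ridge_error_norm] and [C4] that of
   [good_ridge_cost_lipschitz]. *)
Local Notation C1 := (4 * D / lambda + 4 * (M2 / tau)).
Local Notation C4 := (3 / (2 * tau) + D + 2 * lambda / tau).
Local Notation hmin S x := (ridge_min lambda mu S (design_of x) (noise_of x)).
Local Notation what x := (ridge_error lambda mu (design_of x) (noise_of x)).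
Local Notation H := (sample_cost lambda mu).

Hypotheses (m0 : (0 < m)%N) (n0 : (0 < n)%N) (l0 : 0 < lambda) (t0 : 0 < tau)
  (v0 : 0 <= v) (D0 : 0 < D) (M20 : 0 < M2) (rho0 : 0 < rho).
Hypotheses (nm : tau * n%:R <= m%:R) (mu2 : enorm mu ^+ 2 <= M2 * n%:R)
  (muM : forall j, `|mu j 0| <= M).
Hypotheses (fX : subgaussian_family P v X) (fY : subgaussian_family P v Y)
  (sX : standardized_entries P X) (sY : standardized_entries P Y)
  (XY : forall i, X (inr i) = Y (inr i))
  (eX : forall i, (\int[P]_t (expR (X (inr i) t ^+ 2 / D))%:E <= 2%:E)%E).
Hypotheses (L1 : 1 <= L) (ML : M <= L) (Lm : L ^+ 2 <= m%:R)
  (Ln : M + (2 * ln n%:R + v * (2 * D + lambda * (M2 / tau))) / lambda <= L).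
Hypotheses (d0 : 0 < delta) (LN : 2 * L < delta * N.+1%:R)
  (dr : delta * L * n%:R ^+ 2 * C4 <= rho / 10).
Hypotheses (b1 : 1 <= b) (bN : n%:R * ln N.+1%:R <= rho / 10 * (b * m%:R))
  (th0 : 0 <= th) (th1 : th <= 1) (thn : ln n%:R <= 3 / 10 * (th * (b * m%:R) * rho)).
Hypotheses
  (PY : (P [set t | ((z + rho)%:E <= hmin setT (Y ^~ t))%E] <= eps%:E)%E)
  (PS : (P [set t | (hmin S (Y ^~ t) <= (z + 2 * rho)%:E)%E] <= eps%:E)%E).

Local Notation err := (lindeberg_error m n b v C1 L th).
Local Notation bad := (3 / n%:R + m%:R^-1 : R).
Let m0' : (0 : R) < m%:R. Proof. by rewrite ltr0n. Qed.
Let n0' : (0 : R) < n%:R. Proof. by rewrite ltr0n. Qed.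
Let b0 : 0 <= b. Proof. exact: le_trans b1. Qed.

(** The sup bound enters the derivatives of the test function, the Euclidean bound the sub-Gaussian
    proxy of the row residuals. *)
Let box : set 'cV[R]_n := [set w | (forall j, `|w j 0| <= L) /\ \sum_j w j 0 ^+ 2 <= C1 * m%:R].

Let good_box (x : I -> R) : good_vector lambda v D mu x -> box (what x).
Proof.
move=> g; split=> [j|]; last by have h := good_ridge_error_norm m0 l0 t0 nm M20 mu2 g; exact: h.
by apply: le_trans (good_ridge_error_coord m0 n0 l0 v0 t0 nm M20 mu2 muM g j) Ln.
Qed.

(** Two budgets of [rho / 10]: the entropy of the net measured in units of [b m], and the mesh
    error, which is controlled on good vectors only. *)
Let netP (S' : set 'cV[R]_n) : S' !=set0 -> S' `<=` box ->
  exists (C : finType) (r : C -> 'cV[R]_n),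
    [/\ (0 < #|C|)%N, ln #|C|%:R <= rho / 10 * (b * m%:R), forall c, S' (r c) &
      forall (x : I -> R) w, good_vector lambda v D mu x -> S' w -> exists c, H (r c) x <= H w x + rho / 10].
Proof.
move=> S'0 S'b; have SL w : S' w -> forall j, `|w j 0| <= L by move=> /S'b[].
have [C [r [/andP[C0 CN] rS rN]]] := finite_net d0 LN S'0 SL.
exists C, r; split=> //.
  apply: le_trans bN; rewrite mulr_natl -lnXn ?ltr0n// ler_ln ?posrE ?ltr0n ?exprn_gt0//.
  by rewrite -natrX ler_nat.
move=> x w g S'w; have [c cd] := rN w S'w; exists c.
apply: (le_trans (good_ridge_cost_lipschitz m0 n0 l0 D0 t0 nm muM g L1 ML (ltW d0) _ _ _)).
- exact: SL (rS c).
- exact: SL S'w.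
- by move=> j; rewrite distrC.
by rewrite lerD2l.
Qed.

Let mfam (Y' : I -> T -> R) : subgaussian_family P v Y' ->
  measurable_entries (fun t => design_of (Y' ^~ t)) /\ measurable_entries (fun t => noise_of (Y' ^~ t)).
Proof.
case=> mY' _ _; split=> i j.
  by rewrite (_ : (fun t => _) = Y' (inl (i, j)))//; apply/funext => t; rewrite mxE.
by rewrite (_ : (fun t => _) = Y' (inr i))//; apply/funext => t; rewrite mxE.
Qed.

Let expRln : expR (- (3 / 10 * (th * (b * m%:R) * rho))) <= n%:R^-1.
Proof. by rewrite expRN lef_pV2 ?posrE ?expR_gt0// -[n%:R]lnK ?posrE// ler_expR. Qed.

(* [E] is the set where the softmin test over a net of the box is at least 1/2. *)
Let large_minimum : exists E : set T, [/\ measurable E,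
  forall t, good_vector lambda v D mu (X ^~ t) -> z + 3 / 2 * rho <= H (what (X ^~ t)) (X ^~ t) -> E t &
  (P E <= (2 * (eps + bad + n%:R^-1 + err))%:E)%E].
Proof.
have box0 : box !=set0.
  exists 0; split=> [j|]; first by rewrite mxE normr0 (le_trans _ L1).
  rewrite big1; last by move=> j _; rewrite mxE expr0n.
  by rewrite mulr_ge0 ?ler0n// addr_ge0// ?divr_ge0 ?mulr_ge0 ?invr_ge0// ltW.
have [C [r [C0 CN rb rN]]] := netP box0 (@subset_refl _ _).
have [mD mnz] := mfam fY; have [mX _ _] := fX.
pose k := th * (b * m%:R).
have k0 : 0 <= k by rewrite mulr_ge0// mulr_ge0.
(* For [X] the minimum is at least [z + 15/10 rho] and entropy costs 1/10. For [Y], off the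
   exceptional sets, some net point has cost at most [z + 11/10 rho]. The threshold 14/10 leaves a
   gap of 3/10. The tilt is [- th] because the test must be large when the soft minimum is. *)
pose a := - (k * (z + 14 / 10 * rho)).
(* The net sees the unconstrained minimum for [Y] only if the minimizer lies in the box. The
   constrained case needs no such event for [Y], since there the net is only bounded from below. *)
pose Eb := [set t | ~ good_vector lambda v D mu (Y ^~ t)].
pose Em := [set t | ((z + rho)%:E <= hmin setT (Y ^~ t))%E].
have mEb : measurable Eb by apply: measurableC; exact: (measurable_good D mu m0 l0 fY).
have mEm : measurable Em by exact: measurable_ridge_min_ge.
have PE : (P (Em `|` Eb) <= (eps + bad)%:E)%E.
  rewrite EFinD; apply: le_trans (measureU2 P mEm mEb) _; apply: leeD => //.
  by apply: (prob_bad mu m0 n0 l0 D0 fY sY) => i; rewrite -XY.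
exists [set t | 2^-1 <= softmin_test (net_row r) (net_penalty lambda mu r) b (- th) a (X ^~ t)]; split.
- rewrite -[X in measurable X]setTI (_ : [set t | _] =
    (fun t => softmin_test (net_row r) (net_penalty lambda mu r) b (- th) a (X ^~ t)) @^-1` `[2^-1, +oo[%classic).
    by apply: (measurable_test_family lambda mu r b (- th) a mX) => //; exact: measurable_itv.
  by rewrite predeqE => t; split; rewrite /= in_itv/= andbT.
- move=> t g zt /=; apply: sigmoid_ge_half.
  have := ln_partition_le m0 b0 C0 (x := X ^~ t) (y := z + 3 / 2 * rho) (r := r) (mu := mu) (lambda := lambda).
  move=> /(_ (fun c => le_trans zt (ridge_error_min m0 l0 _ _ _ _))).
  move=> /(ler_wpM2l th0) h.
  have h2 := ler_wpM2l th0 CN.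
  rewrite /a /k mulNr; move: h h2; set lz := ln _ => h h2; lra.
- apply: (@le_trans _ _ (2%:E * (P (Em `|` Eb) + (n%:R^-1 + err)%:E))%E); last first.
    rewrite -addrA EFinM; apply: lee_wpmul2l; first by rewrite lee_fin.
    by rewrite [leRHS]EFinD; apply: leeD.
  have thN : `|- th| <= 1 by rewrite normrN ger0_norm.
  apply: le_trans (softmin_transfer m0 C0 v0 b1 L1 Lm (fun c => (rb c).1) (fun c => (rb c).2)
    fX fY sX sY XY (a := a) (l := 3 / 10 * (k * rho)) (measurableU _ _ mEm mEb) thN _) _.
    move=> t /not_orP[/negP + /contrapT g]; rewrite -ltNge => /ereal_inf_ltP[_ [w _ <-]].
    rewrite lte_fin => wz.
    have [c cH] := rN (Y ^~ t) _ g (good_box g).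
    have cz : H (r c) (Y ^~ t) <= z + 11 / 10 * rho.
      apply: (le_trans cH); have := ridge_error_min m0 l0 (design_of (Y ^~ t)) (noise_of (Y ^~ t)) mu w.
      rewrite /sample_cost; lra.
    have /(ler_wpM2l th0) := ln_partition_ge m0 b0 cz.
    rewrite /a /k mulNr; set lz := ln _ => h; lra.
  apply: lee_wpmul2l; first by rewrite lee_fin.
  apply: leeD => //; rewrite lee_fin; apply: lerD; first exact: expRln.
  by rewrite /lindeberg_error /swap_constant normrN.
Qed.

(* [E] is the set where the softmin test over a net of [S `&` box] is at least 1/2. *)
Let small_constrained_minimum : S `&` box !=set0 -> exists E : set T, [/\ measurable E,
  forall t, good_vector lambda v D mu (X ^~ t) -> S (what (X ^~ t)) ->
    H (what (X ^~ t)) (X ^~ t) < z + 3 / 2 * rho -> E t &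
  (P E <= (2 * (eps + n%:R^-1 + err))%:E)%E].
Proof.
move=> Sb0; have [C [r [C0 CN rb rN]]] := netP Sb0 (@subIsetr _ _ _).
have [mD mnz] := mfam fY; have [mX _ _] := fX.
pose k := th * (b * m%:R).
have k0 : 0 <= k by rewrite mulr_ge0// mulr_ge0.
(* For [X] the mesh raises [15/10] to [16/10]; for [Y] the entropy lowers [20/10] to [19/10]. The
   gap is again 3/10. *)
pose a := k * (z + 16 / 10 * rho).
pose Em := [set t | (hmin S (Y ^~ t) <= (z + 2 * rho)%:E)%E].
have mEm : measurable Em by exact: measurable_ridge_min_le.
exists [set t | 2^-1 <= softmin_test (net_row r) (net_penalty lambda mu r) b th a (X ^~ t)]; split.
- rewrite -[X in measurable X]setTI (_ : [set t | _] =
    (fun t => softmin_test (net_row r) (net_penalty lambda mu r) b th a (X ^~ t)) @^-1` `[2^-1, +oo[%classic).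
    by apply: (measurable_test_family lambda mu r b th a mX) => //; exact: measurable_itv.
  by rewrite predeqE => t; split; rewrite /= in_itv/= andbT.
- move=> t g St zt /=; apply: sigmoid_ge_half.
  have [c cH] := rN (X ^~ t) _ g (conj St (good_box g)).
  have cz : H (r c) (X ^~ t) <= z + 16 / 10 * rho by apply: (le_trans cH); lra.
  have /(ler_wpM2l th0) := ln_partition_ge m0 b0 cz.
  rewrite /a /k; set lz := ln _ => h; lra.
- apply: (@le_trans _ _ (2%:E * (P Em + (n%:R^-1 + err)%:E))%E); last first.
    rewrite -addrA EFinM; apply: lee_wpmul2l; first by rewrite lee_fin.
    by rewrite [leRHS]EFinD; apply: leeD.
  have thN : `|th| <= 1 by rewrite ger0_norm.
  apply: le_trans (softmin_transfer m0 C0 v0 b1 L1 Lm (fun c => (rb c).2.1) (fun c => (rb c).2.2)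
    fX fY sX sY XY (a := a) (l := 3 / 10 * (k * rho)) mEm thN _) _.
    move=> t /negP; rewrite -ltNge => zt.
    have zc c : z + 2 * rho <= H (r c) (Y ^~ t).
      rewrite -lee_fin; apply: le_trans (ltW zt) _; apply: ereal_inf_lbound.
      by exists (r c) => //; exact: (rb c).1.
    have := ln_partition_le m0 b0 C0 zc => /(ler_wpM2l th0) h.
    have h2 := ler_wpM2l th0 CN.
    rewrite /a /k; move: h h2; set lz := ln _ => h h2; lra.
  apply: lee_wpmul2l; first by rewrite lee_fin.
  by apply: leeD => //; rewrite lee_fin; apply: lerD; first exact: expRln.
Qed.

(** The event may fail to be measurable because [S] is arbitrary, so it is covered by three
    measurable sets. [bad] is paid once for [X] and, doubled by Markov, for [Y] in
    [large_minimum]. *)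
Lemma ridge_error_event :
  (mu_ext P [set t | S (what (X ^~ t))]
   <= (4 * eps + 3 * bad + 4 * n%:R^-1 + 4 * err)%:E)%E.
Proof.
have eps0 : 0 <= eps by rewrite -lee_fin; apply: le_trans PS; exact: measure_ge0.
have err0 : 0 <= err.
  rewrite /lindeberg_error mulr_ge0// mulr_ge0//.
    by rewrite mulr_ge0// /swap_moment divr_ge0 ?exprn_ge0 ?sqrtr_ge0// !mulr_ge0 ?expR_ge0.
  by rewrite /swap_constant !mulr_ge0// ?exprn_ge0 ?(le_trans _ L1)//.
have n10 : 0 <= n%:R^-1 :> R by rewrite invr_ge0 ltW.
pose Eb := [set t | ~ good_vector lambda v D mu (X ^~ t)].
have mEb : measurable Eb by apply: measurableC; exact: (measurable_good D mu m0 l0 fX).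
have PEb : (P Eb <= bad%:E)%E by have h := prob_bad mu m0 n0 l0 D0 fX sX eX; exact: h.
have bad0 : 0 <= bad by rewrite -lee_fin; apply: le_trans PEb; exact: measure_ge0.
have [E1 [mE1 E1P PE1]] := large_minimum.
(* When [S] misses the box there is no net, but then no good vector has its ridge error in [S] and
   the empty set works. *)
have [E2 [mE2 E2P PE2]] : exists E : set T, [/\ measurable E,
    forall t, good_vector lambda v D mu (X ^~ t) -> S (what (X ^~ t)) ->
      H (what (X ^~ t)) (X ^~ t) < z + 3 / 2 * rho -> E t &
    (P E <= (2 * (eps + n%:R^-1 + err))%:E)%E].
  have [/small_constrained_minimum//|Sb0] := pselect (S `&` box !=set0).
  exists set0; split=> //.
    by move=> t g St _; apply: Sb0; exists (what (X ^~ t)); split => //; exact: good_box.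
  by rewrite measure0 lee_fin mulr_ge0// !addr_ge0.
apply: (@le_trans _ _ (mu_ext P (Eb `|` (E1 `|` E2)))).
  apply: le_mu_ext => t /= St.
  have [g|] := pselect (good_vector lambda v D mu (X ^~ t)); last by left.
  by right; case: (leP (z + 3 / 2 * rho) (H (what (X ^~ t)) (X ^~ t))) => h;
    [left; exact: E1P|right; exact: E2P].
have mE12 := measurableU _ _ mE1 mE2.
rewrite measurable_mu_extE; last exact: measurableU.
apply: le_trans (measureU2 P mEb mE12) _.
apply: (@le_trans _ _ (bad%:E + ((2 * (eps + bad + n%:R^-1 + err))%:E + (2 * (eps + n%:R^-1 + err))%:E))%E).
  by apply: leeD => //; apply: le_trans (measureU2 P mE1 mE2) _; exact: leeD.
by rewrite -!EFinD lee_fin; lra.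
Qed.

End universality_of_the_event.

(** * Choice of the parameters and size of the errors *)

Section choice_of_parameters.
Context (R : realType) (m n : nat).
Variables (lambda tau v D M2 M q rho : R).

Local Notation l := (ln n%:R : R).
Local Notation r := (n%:R `^ 24^-1 : R).
Local Notation C3 := (2 * (1 + (2 / lambda + 2 * (v * (2 * D + lambda * (M2 / tau))) / lambda)) : R).
Local Notation C4 := (3 / (2 * tau) + D + 2 * lambda / tau : R).

(* All quantities are compared with powers of the root [r] of [n], for which
   [ln n <= 24 * r]; the theorem is trivial unless [q] and [M ^+ 2] are at most [r ^+ 4]. *)
Definition box_radius : R := C3 * M * l.
(** The summands ensure, in order, [1 <= r], [L^2 <= m] and the mesh bound; in the last two a spare
    power of [r] absorbs the constants. *)
Definition root_threshold : R := 1 + (24 * C3) ^+ 2 / tau + 30 * C4 * (24 * C3) ^+ 2.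
(** A net with [n^6] cells per coordinate has entropy at most [6 n ln n]. The factor [60 = 6 * 10]
    fits it into [rho / 10] of energy, using [n <= m / tau] and [1 <= q * rho]. *)
Definition inverse_temperature : R := 60 * l * q / tau.
(** Chosen so that [tilt * b * m = 10 q ln n]: across the gap [3/10 rho] the test then drops below
    [1/n], while the order [1/m] makes the sum of all exchange errors small. *)
Definition tilt : R := tau / (6 * m%:R).

Hypotheses (m0 : (0 < m)%N) (n2 : (2 <= n)%N) (l0 : 0 < lambda) (t0 : 0 < tau) (t1 : tau < 1)
  (v0 : 0 <= v) (D0 : 0 < D) (M20 : 0 < M2) (rho0 : 0 < rho)
  (M1 : 1 <= M) (q1 : 1 <= q) (qrho : 1 <= q * rho)
  (nm : tau * n%:R <= m%:R).

Let m0' : (0 : R) < m%:R. Proof. by rewrite ltr0n. Qed.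
Let n0' : (0 : R) < n%:R. Proof. by rewrite ltr0n (leq_trans _ n2). Qed.

Lemma ln_ge_half : 2^-1 <= l.
Proof.
apply: (@le_trans _ _ (ln 2)); last by rewrite ler_ln ?posrE// ler_nat.
have h : ln (1 + (- 2^-1)) <= - 2^-1 :> R by apply: le_ln1Dx; lra.
have e : 1 + (- 2^-1) = 2^-1 :> R by lra.
by rewrite e lnV ?posrE// in h; lra.
Qed.

Let r0 : 0 < r. Proof. exact: powR_gt0. Qed.

Lemma root_exprn : r ^+ 24 = n%:R.
Proof. by rewrite -powR_mulrn ?ltW// -powRrM mulVf ?powRr1// ltW. Qed.

Lemma root_inv4 : n%:R `^ (- (1 / 6)) = r ^- 4.
Proof. by rewrite -powR_invn ?ltW// -powRrM; congr (_ `^ _); field. Qed.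

Lemma ln_le_root : l <= 24 * r.
Proof.
have -> : l = 24 * ln r by rewrite ln_powR mulVKf.
by rewrite ler_pM2l// ltW// ln_sublinear.
Qed.

Let proxy0 : 0 <= v * (2 * D + lambda * (M2 / tau)) / lambda.
Proof.
apply: divr_ge0; last exact: ltW.
apply: mulr_ge0 => //; apply: addr_ge0; first by apply: mulr_ge0 => //; exact: ltW.
by apply: mulr_ge0; [exact: ltW|apply: divr_ge0; exact: ltW].
Qed.

Let C30 : 2 <= C3.
Proof.
have p1 : 0 <= 2 / lambda by rewrite divr_ge0// ltW.
have := proxy0; rewrite -[2 * (v * _) / _]mulrA; move: p1.
set a := 2 / lambda; set b := _ / lambda; lra.
Qed.

(** The leave-one-out estimate is a sum of [M] and a multiple of [ln n] plus a constant. It is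
    rounded up to a product, using [1 <= M] and [1/2 <= ln n], so that powers of the radius
    split. *)
Lemma box_radius_ge : M + (2 * l + v * (2 * D + lambda * (M2 / tau))) / lambda <= box_radius.
Proof.
rewrite /box_radius; have lh := ln_ge_half.
have p1 : 0 <= lambda^-1 by rewrite invr_ge0 ltW.
have p2 := proxy0.
rewrite mulrDl; move: p2; rewrite -[2 * (v * _) / _]mulrA.
set a := v * _ / lambda => p2.
have l00 : 0 <= l by lra.
have h1 : M <= 2 * M * l by have := ler_wpM2l (le_trans ler01 M1) lh; lra.
have h2 : 2 * l / lambda <= 2 * (2 / lambda) * M * l.
  have : 0 <= 2 * lambda^-1 * l by rewrite !mulr_ge0.
  by move=> h; have := ler_wpM2l h M1; rewrite mulr1; lra.
have h3 : a <= 2 * (2 * a) * M * l.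
  have h : 2^-1 * 1 <= l * M by apply: ler_pM.
  have := ler_wpM2l p2 h; lra.
lra.
Qed.

Lemma box_radius_ge1 : M <= box_radius.
Proof.
have lh := ln_ge_half; rewrite /box_radius mulrAC; apply: ler_peMl; first exact: le_trans M1.
have : 2 * 2^-1 <= C3 * l by apply: ler_pM.
by rewrite mulfV.
Qed.

Hypotheses (rr : root_threshold <= r) (Mr : M ^+ 2 <= r ^+ 4) (qr : q <= r ^+ 4).

Let C40 : 0 <= C4.
Proof. by rewrite !addr_ge0// ?divr_ge0 ?mulr_ge0// ltW. Qed.

Let X0 : 0 <= (24 * C3) ^+ 2.
Proof. exact: sqr_ge0. Qed.

Let r1 : 1 <= r.
Proof.
apply: le_trans rr; rewrite /root_threshold -addrA lerDl addr_ge0//.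
  by rewrite divr_ge0// ltW.
by rewrite mulr_ge0// mulr_ge0.
Qed.

Let rX : (24 * C3) ^+ 2 / tau <= r.
Proof.
apply: le_trans rr; rewrite /root_threshold addrAC lerDr addr_ge0//.
by rewrite mulr_ge0// mulr_ge0.
Qed.

Let rC4 : 30 * C4 * (24 * C3) ^+ 2 <= r.
Proof. by apply: le_trans rr; rewrite /root_threshold lerDr addr_ge0// divr_ge0// ltW. Qed.

Let radius_sqr : box_radius ^+ 2 <= (24 * C3) ^+ 2 * r ^+ 6.
Proof.
rewrite /box_radius; set c := C3.
have l2 : l ^+ 2 <= (24 * r) ^+ 2.
  by rewrite lerXn2r ?nnegrE ?ln_le_root//; have := ln_ge_half; lra.
rewrite (_ : _ ^+ 2 = c ^+ 2 * (M ^+ 2 * l ^+ 2)); last by ring.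
rewrite (_ : _ * r ^+ 6 = c ^+ 2 * (r ^+ 4 * (24 * r) ^+ 2)); last by ring.
by rewrite ler_wpM2l ?sqr_ge0//; apply: ler_pM => //; exact: sqr_ge0.
Qed.

Lemma box_radius_sqr : box_radius ^+ 2 <= m%:R.
Proof.
apply: le_trans radius_sqr _; apply: le_trans nm.
apply: (@le_trans _ _ (tau * r ^+ 24)); last by rewrite root_exprn.
have h : (24 * C3) ^+ 2 <= tau * r by rewrite [leRHS]mulrC -ler_pdivrMr.
apply: le_trans (ler_wpM2r (exprn_ge0 6 (ltW r0)) h) _.
by rewrite -mulrA -exprS ler_pM2l// ler_weXn2l.
Qed.

(** With mesh [3 L / n^6] the Lipschitz error is [3 C4 L^2 / n^4]. Here [30 C4 L^2 <= r^7], six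
    powers from [L^2] and one for the constants, and [q <= r^4] gives [1 <= rho * r^4]; this uses
    only a small part of [n^4 = r^96]. *)
Lemma mesh_lipschitz : 3 * box_radius / n%:R ^+ 6 * box_radius * n%:R ^+ 2 * C4 <= rho / 10.
Proof.
rewrite (_ : _ * C4 = 3 * C4 * box_radius ^+ 2 / n%:R ^+ 4); last first.
  by field; rewrite !gt_eqF.
rewrite ler_pdivrMr ?exprn_gt0//.
have h1 : 30 * C4 * box_radius ^+ 2 <= r ^+ 7.
  apply: le_trans (ler_wpM2l _ radius_sqr) _; first by rewrite mulr_ge0.
  rewrite [r ^+ 7]exprS [leLHS]mulrA; exact: ler_wpM2r.
have h2 : 1 <= rho * r ^+ 4.
  by apply: le_trans qrho _; rewrite mulrC ler_pM2l.
have h3 : r ^+ 7 <= rho * n%:R ^+ 4.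
  apply: (@le_trans _ _ (rho * r ^+ 24)).
    rewrite (_ : rho * r ^+ 24 = rho * r ^+ 4 * r ^+ 20); last by ring.
    apply: (@le_trans _ _ (r ^+ 20)); first by rewrite ler_weXn2l.
    by rewrite ler_peMl// exprn_ge0// ltW.
  by rewrite ler_pM2l// root_exprn ler_eXnr// ler1n (leq_trans _ n2).
lra.
Qed.

Let q0 : 0 < q. Proof. exact: lt_le_trans q1. Qed.

Lemma inverse_temperature_ge1 : 1 <= inverse_temperature.
Proof.
rewrite /inverse_temperature ler_pdivlMr// mul1r; apply: le_trans (ltW t1) _.
have lh := ln_ge_half.
have : 2^-1 * 1 <= l * q by apply: ler_pM.
lra.
Qed.

Lemma tilt_ge0 : 0 <= tilt. Proof. by rewrite divr_ge0// ltW. Qed.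

Lemma tilt_le1 : tilt <= 1.
Proof.
rewrite /tilt ler_pdivrMr ?mulr_gt0// mul1r; have : 1 <= m%:R :> R by rewrite ler1n.
by move: t1; lra.
Qed.

Lemma tilt_energy : tilt * (inverse_temperature * m%:R) = 10 * l * q.
Proof. by rewrite /tilt /inverse_temperature; field; rewrite !gt_eqF. Qed.

Lemma tilt_gap : l <= 3 / 10 * (tilt * (inverse_temperature * m%:R) * rho).
Proof.
rewrite tilt_energy (_ : _ * (_ * rho) = 3 * (l * (q * rho))); last by field.
have lh := ln_ge_half; have : l * 1 <= l * (q * rho) by rewrite ler_wpM2l//; lra.
lra.
Qed.

Lemma net_entropy : n%:R * ln (n%:R ^+ 6) <= rho / 10 * (inverse_temperature * m%:R).
Proof.
rewrite lnXn// (_ : rho / 10 * _ = 6 * l * (q * rho) * (m%:R / tau)); last first.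
  by rewrite /inverse_temperature; field; rewrite gt_eqF.
have lh := ln_ge_half; have nt : n%:R <= m%:R / tau by rewrite ler_pdivlMr// mulrC.
rewrite -[_ *+ 6]mulr_natl mulrC; apply: ler_pM => //; first by rewrite mulr_ge0//; lra.
by rewrite ler_peMr// mulr_ge0//; lra.
Qed.

Variable C1 : R.

Definition lindeberg_constant : R := 2 * ((3 ^+ 3 + 6 ^+ 6) * (2 * expR v))
  * (136 * (1 + 54 * expR (v * (C1 + 1)))) * (60 ^+ 3 * C3 ^+ 3) / (6 * tau ^+ 3 * Num.sqrt tau)
  * 24 ^+ 4.

(** The error has order [q^3 M^3 l^6 n^(-1/2)], and [n^(-1/2) = r^(-12)]. The surplus over the claim
    is [M l^4 <= r^4 (24 r)^4], which brings the power down to [r^(-4) = n^(-1/6)] and produces the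
    factor [24^4]. *)
Lemma lindeberg_error_le :
  lindeberg_error m n inverse_temperature v C1 box_radius tilt
  <= lindeberg_constant * (q ^+ 3 * M ^+ 2 * r ^- 4 * l ^+ 2).
Proof.
rewrite /lindeberg_error /swap_moment /swap_constant ger0_norm ?tilt_ge0//.
set s := Num.sqrt m%:R; set st := Num.sqrt tau.
have s0 : 0 < s by rewrite sqrtr_gt0.
have st0 : 0 < st by rewrite sqrtr_gt0.
have s2 : m%:R = s ^+ 2 by rewrite sqr_sqrtr// ltW.
have st2 : tau = st ^+ 2 by rewrite sqr_sqrtr// ltW.
have sr : st * r ^+ 12 <= s.
  rewrite -(@ler_pXn2r _ 2) ?nnegrE ?(ltW s0) ?mulr_ge0 ?exprn_ge0 ?(ltW st0) ?(ltW r0)//.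
  by rewrite exprMn -exprM root_exprn -st2 -s2.
rewrite /lindeberg_constant /tilt /inverse_temperature /box_radius natrM s2 -/st.
set A := (_ + _) * (2 * expR v); set B := 1 + 54 * _; set c := C3.
have A0 : 0 <= A by rewrite mulr_ge0 ?mulr_ge0 ?expR_ge0// addr_ge0 ?exprn_ge0.
have B0 : 0 <= B by rewrite addr_ge0// mulr_ge0// expR_ge0.
have c0 : 0 <= c by apply: le_trans C30.
have lh := ln_ge_half.
have M0 : 0 <= M by exact: le_trans M1.
have q00 := ltW q0.
pose W := 2 * A * (136 * B) * (60 ^+ 3 * c ^+ 3) / (6 * tau ^+ 3).
have W0 : 0 <= W.
  have h1 : 0 <= 2 * A by apply: mulr_ge0.
  have h2 : 0 <= 136 * B by apply: mulr_ge0.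
  have h3 : 0 <= 60 ^+ 3 * c ^+ 3 by apply: mulr_ge0; exact: exprn_ge0.
  have h4 : 0 <= 6 * tau ^+ 3 by apply: mulr_ge0 => //; apply: exprn_ge0; exact: ltW.
  by apply: divr_ge0 => //; apply: mulr_ge0 => //; exact: mulr_ge0.
rewrite (_ : _ * _ = W * (q ^+ 3 * M ^+ 2 * l ^+ 2) * (tau * n%:R / s ^+ 3 * (M * l ^+ 4))); last first.
  by rewrite /W; field; rewrite !gt_eqF.
rewrite (_ : _ * 24 ^+ 4 * _ = W * (q ^+ 3 * M ^+ 2 * l ^+ 2) * (24 ^+ 4 / (st * r ^+ 4))); last first.
  by rewrite /W; field; rewrite !gt_eqF.
have l00 : 0 <= l by lra.
have l40 : 0 <= l ^+ 4 by exact: exprn_ge0.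
apply: ler_wpM2l.
  apply: mulr_ge0 => //; apply: mulr_ge0; last exact: sqr_ge0.
  by apply: mulr_ge0; [exact: exprn_ge0|exact: sqr_ge0].
have h1 : tau * n%:R / s ^+ 3 <= (st * r ^+ 12)^-1.
  apply: (@le_trans _ _ s^-1).
    have e : s^-1 * s ^+ 3 = s ^+ 2 by field; rewrite gt_eqF.
    by rewrite ler_pdivrMr ?exprn_gt0// e -s2.
  by rewrite lef_pV2 ?posrE// mulr_gt0// exprn_gt0.
have h2 : M * l ^+ 4 <= r ^+ 4 * (24 * r) ^+ 4.
  apply: ler_pM => //.
    by apply: le_trans Mr; rewrite expr2 ler_peMl.
  by rewrite lerXn2r ?nnegrE ?ln_le_root//; lra.
apply: le_trans (ler_pM _ _ h1 h2) _.
- by apply: divr_ge0; [rewrite mulr_ge0// ltW|rewrite exprn_ge0// ltW].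
- exact: mulr_ge0.
by rewrite le_eqVlt; apply/orP; left; apply/eqP; field; rewrite !gt_eqF.
Qed.

Lemma inv_natr_le : n%:R^-1 <= 4 * (q ^+ 3 * M ^+ 2 * r ^- 4 * l ^+ 2).
Proof.
have h1 : n%:R^-1 <= r ^- 4.
  rewrite lef_pV2 ?posrE ?exprn_gt0//; apply: (@le_trans _ _ (r ^+ 24)); last by rewrite root_exprn.
  by rewrite ler_weXn2l.
have lh := ln_ge_half; have l2 : 4^-1 <= l ^+ 2.
  rewrite (_ : 4^-1 = 2^-1 ^+ 2); last by field.
  by rewrite lerXn2r ?nnegrE//; lra.
have qM : 1 <= q ^+ 3 * M ^+ 2 by rewrite mulr_ege1// exprn_ege1.
apply: le_trans h1 _.
rewrite (_ : 4 * _ = r ^- 4 * ((q ^+ 3 * M ^+ 2) * (4 * l ^+ 2))); last by ring.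
by rewrite ler_peMr ?invr_ge0 ?exprn_ge0 ?(ltW r0)// mulr_ege1//; lra.
Qed.

End choice_of_parameters.

Lemma max1_exprn (R : realType) (a : R) k : 0 <= a -> Num.max 1 a ^+ k = Num.max 1 (a ^+ k).
Proof.
move=> a0; have [a1|a1] := leP a 1.
  by rewrite max_l ?exprn_ile1// expr1n.
by rewrite max_r// exprn_ege1// ltW.
Qed.

Lemma mx_norm_coord (R : realType) n (mu : 'cV[R]_n) j : `|mu j 0| <= mx_norm mu.
Proof.
by rewrite mx_normrE; exact: (le_bigmax 0 (fun ij : 'I_n * 'I_1 => `|mu ij.1 ij.2|) (j, 0)).
Qed.

Lemma mu_ext_probability_le1 (R : realType) d (T : measurableType d) (P : probability T R)
  (E : set T) : (mu_ext P E <= 1)%E.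
Proof.
apply: (@le_trans _ _ (mu_ext P setT)); first exact: le_mu_ext.
by rewrite measurable_mu_extE//; exact: probability_le1.
Qed.

(** * From the event bound to the stated rate *)

Theorem theorem3p2 (R : realType) (sigma lambda tau M2 L : R)
    (sigma_gt0 : 0 < sigma) (lambda_gt0 : 0 < lambda)
    (tau_gt0 : 0 < tau) (tau_lt1 : tau < 1) (M2_gt0 : 0 < M2) :
  exists2 K : R, 0 < K &
  forall (m n : nat) (d : measure_display) (T : measurableType d)
    (P : probability T R) (mu0 : 'cV[R]_n)
    (A G : T -> 'M[R]_(m, n)) (xi : T -> 'cV[R]_m),
  (2 <= n)%N ->
  tau <= m%:R / n%:R <= tau^-1 ->
  enorm mu0 ^+ 2 / n%:R <= M2 ->
  design_condition P sigma L A xi ->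
  gaussian_design P G xi ->
  forall (S : set 'cV[R]_n) (z rho0 eps : R),
  0 < rho0 ->
  0 <= eps < 4^-1 ->
  (maxe (P [set t | (z + rho0)%:E <= ridge_min lambda mu0 setT (G t) (xi t)])
        (P [set t | ridge_min lambda mu0 S (G t) (xi t) <= (z + 2 * rho0)%:E])
     <= eps%:E)%E ->
  (mu_ext P [set t | S (ridge_error lambda mu0 (A t) (xi t))]
     <= (4 * eps + K * Num.max 1 (rho0 ^- 3) * Num.max 1 (mx_norm mu0 ^+ 2)
                   * n%:R `^ (- (1 / 6)) * ln n%:R ^+ 2)%:E)%E.
Proof.
pose v := design_proxy sigma L; pose D := noise_scale sigma L.
have v0 : 0 <= v by exact: design_proxy_ge0.
have D0 : 0 < D by exact: noise_scale_gt0.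
pose Kl := lindeberg_constant lambda tau v D M2 (4 * D / lambda + 4 * (M2 / tau)).
pose R0 := root_threshold lambda tau v D M2.
(* [13 + 3 / tau] counts [3 (3/n + 1/m) + 4/n] with [1/m <= 1/(tau n)], and its factor 4 comes from
   [inv_natr_le]. Next come four exchange errors; the last term makes the bound exceed 1 in the
   trivial cases. *)
pose K0 := 4 * (13 + 3 / tau); pose K := K0 + 4 * `|Kl| + (4 + 4 * R0 ^+ 4).
have R40 : 0 <= R0 ^+ 4 by rewrite exprn_even_ge0.
have K00 : 0 < K0 by rewrite mulr_gt0// addr_gt0// divr_gt0.
have KR : 4 + 4 * R0 ^+ 4 <= K by rewrite /K lerDr addr_ge0 ?(ltW K00)// mulr_ge0.
have K_gt0 : 0 < K by apply: lt_le_trans KR; rewrite ltr_wpDr// mulr_ge0.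
exists K => // m n d T P mu A G xi n2 /andP[tm mt] muM2 dA dG S z rho eps rho_gt0 /andP[eps0 _].
rewrite ge_max => /andP[PY PS].
have n0 : (0 < n)%N by exact: leq_trans n2.
have n0' : (0 : R) < n%:R by rewrite ltr0n.
have nm : tau * n%:R <= m%:R by rewrite -ler_pdivlMr.
have m0 : (0 < m)%N by rewrite -(ltr0n R); apply: lt_le_trans nm; rewrite mulr_gt0.
have m0' : (0 : R) < m%:R by rewrite ltr0n.
rewrite ler_pdivrMr// in muM2.
pose q := Num.max 1 rho^-1; pose M := Num.max 1 (mx_norm mu).
have q1 : 1 <= q by rewrite le_max lexx.
have M1 : 1 <= M by rewrite le_max lexx.
have qrho : 1 <= q * rho by rewrite -ler_pdivrMr// mul1r le_max lexx orbT.
have muM j : `|mu j 0| <= M by rewrite le_max mx_norm_coord orbT.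
pose r : R := n%:R `^ 24^-1; have r0 : 0 < r by exact: powR_gt0.
have lh := ln_ge_half R n2; set l := ln n%:R in lh *.
rewrite -exprVn -!max1_exprn ?invr_ge0 ?(ltW rho_gt0)//; last first.
  by rewrite mx_normrE; elim/big_ind : _ => // x y x0 y0; rewrite le_max x0.
rewrite root_inv4// -/q -/M -/r.
have q3 : 1 <= q ^+ 3 by exact: exprn_ege1.
have MM : 1 <= M ^+ 2 by exact: exprn_ege1.
have ll : 1 <= 4 * l ^+ 2.
  have : 2^-1 ^+ 2 <= l ^+ 2 by rewrite lerXn2r ?nnegrE//; lra.
  by rewrite (_ : 2^-1 ^+ 2 = 4^-1); [lra|field].
have r4 : 0 < r ^+ 4 by exact: exprn_gt0.
pose B := q ^+ 3 * M ^+ 2 / r ^+ 4 * l ^+ 2.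
have B0 : 0 <= B.
  by apply: mulr_ge0; [apply: divr_ge0; [apply: mulr_ge0; lra|exact: ltW]|exact: sqr_ge0].
rewrite (_ : K * _ * _ * _ * _ = K * B); last by rewrite /B; ring.
have trivial_case : 1 <= (4 + 4 * R0 ^+ 4) * B ->
    (mu_ext P [set t | S (ridge_error lambda mu (A t) (xi t))] <= (4 * eps + K * B)%:E)%E.
  move=> h; apply: le_trans (mu_ext_probability_le1 _ _) _; rewrite lee_fin.
  by have := ler_wpM2r B0 KR; lra.
(* If [M^2] or [q^3] exceeds [r^4], that factor alone outweighs [n^(-1/6)], and [1 <= 4 l^2] takes
   care of the logarithm. *)
have large_factor (a : R) : 1 <= a / r ^+ 4 * 4 * l ^+ 2 -> a <= q ^+ 3 * M ^+ 2 -> 1 <= 4 * B.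
  move=> h aq; apply: (le_trans h); rewrite /B.
  rewrite (_ : a / _ * _ * _ = a * (4 * l ^+ 2 / r ^+ 4)); last by ring.
  rewrite (_ : 4 * _ = (q ^+ 3 * M ^+ 2) * (4 * l ^+ 2 / r ^+ 4)); last by ring.
  by rewrite ler_wpM2r// divr_ge0 ?(ltW r4)//; lra.
have [rr|rr] := leP R0 r; last first.
  apply: trivial_case.
  have h : r ^+ 4 <= R0 ^+ 4 by rewrite lerXn2r ?nnegrE ?(ltW r0) ?(ltW (lt_trans r0 rr))// ltW.
  have Br : 1 <= 4 * R0 ^+ 4 * B.
    rewrite (_ : _ * B = (q ^+ 3 * M ^+ 2) * (4 * l ^+ 2) * (R0 ^+ 4 / r ^+ 4)); last by rewrite /B; ring.
    apply: mulr_ege1; first by apply: mulr_ege1 => //; exact: mulr_ege1.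
    by rewrite ler_pdivlMr// mul1r.
  lra.
have [Mr|Mr] := leP (M ^+ 2) (r ^+ 4); last first.
  apply: trivial_case; have : 1 <= 4 * B.
    apply: (large_factor (M ^+ 2)); last by rewrite ler_peMl//; lra.
    by rewrite -mulrA mulr_ege1// ler_pdivlMr// mul1r ltW.
  by have := mulr_ge0 R40 B0; lra.
have [qr|qr] := leP (q ^+ 3) (r ^+ 4); last first.
  apply: trivial_case; have : 1 <= 4 * B.
    apply: (large_factor (q ^+ 3)); last by rewrite ler_peMr//; lra.
    by rewrite -mulrA mulr_ege1// ler_pdivlMr// mul1r ltW.
  by have := mulr_ge0 R40 B0; lra.
have {}qr : q <= r ^+ 4 by apply: le_trans qr; rewrite ler_eXnr.
pose Lw := box_radius n lambda tau v D M2 M.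
have ML : M <= Lw by exact: box_radius_ge1.
have L1 : 1 <= Lw by exact: le_trans ML.
(* [finite_net] uses [N.+1] cells per coordinate, hence [N = n^6 - 1]; with mesh [3 L / n^6] they
   cover length [3 L], more than the side [2 L] of the box. *)
have Npred : (n ^ 6).-1.+1%:R = n%:R ^+ 6 :> R by rewrite prednK ?expn_gt0 ?n0// natrX.
have n6 : (0 : R) < n%:R ^+ 6 by exact: exprn_gt0.
have delta0 : 0 < 3 * Lw / n%:R ^+ 6 by rewrite divr_gt0// mulr_gt0//; lra.
have LN : 2 * Lw < 3 * Lw / n%:R ^+ 6 * (n ^ 6).-1.+1%:R.
  by rewrite Npred divfK ?gt_eqF//; lra.
have bN : n%:R * ln (n ^ 6).-1.+1%:R <= rho / 10 * (inverse_temperature n tau q * m%:R).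
  by rewrite Npred; exact: net_entropy.
have fX := subgaussian_family_design m0 n0 sigma_gt0 dA.
have fY := subgaussian_family_gaussian m0 n0 sigma_gt0 dA dG.
have sX := standardized_design m0 n0 sigma_gt0 dA.
have sY := standardized_gaussian m0 dG.
have eX := noise_exp_moment m0 n0 sigma_gt0 dA.
have PY' : (P [set t | ((z + rho)%:E <= ridge_min lambda mu setT
    (design_of (entries_pair G xi ^~ t)) (noise_of (entries_pair G xi ^~ t)))%E] <= eps%:E)%E.
  apply: le_trans PY; rewrite le_eqVlt; apply/orP; left; apply/eqP; congr (P _).
  by apply/seteqP; split => t /=; rewrite design_of_pair noise_of_pair.
have PS' : (P [set t | (ridge_min lambda mu S
    (design_of (entries_pair G xi ^~ t)) (noise_of (entries_pair G xi ^~ t)) <= (z + 2 * rho)%:E)%E] <= eps%:E)%E.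
  apply: le_trans PS; rewrite le_eqVlt; apply/orP; left; apply/eqP; congr (P _).
  by apply/seteqP; split => t /=; rewrite design_of_pair noise_of_pair.
have := ridge_error_event m0 n0 lambda_gt0 tau_gt0 v0 D0 M2_gt0 nm muM2 muM fX fY sX sY
  (fun _ => erefl) eX L1 ML (box_radius_sqr n2 lambda_gt0 tau_gt0 D0 nm rr Mr)
  (box_radius_ge n2 lambda_gt0 tau_gt0 v0 D0 M2_gt0 M1) delta0 LN
  (mesh_lipschitz n2 lambda_gt0 tau_gt0 D0 rho_gt0 qrho rr Mr qr)
  (inverse_temperature_ge1 n2 tau_gt0 tau_lt1 q1) bN (tilt_ge0 m tau_gt0) (tilt_le1 m0 tau_lt1)
  (tilt_gap m0 n2 tau_gt0 qrho) PY' PS'.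
rewrite (_ : [set t | _] = [set t | S (ridge_error lambda mu (A t) (xi t))]); last first.
  by apply/seteqP; split => t /=; rewrite design_of_pair noise_of_pair.
move=> /le_trans; apply; rewrite lee_fin.
have nB : n%:R^-1 <= 4 * B := inv_natr_le n2 lambda_gt0 tau_gt0 D0 M1 q1 rr.
have mB : m%:R^-1 <= tau^-1 * n%:R^-1.
  by rewrite -invfM lef_pV2 ?posrE// mulr_gt0.
have eB := lindeberg_error_le m0 n2 lambda_gt0 tau_gt0 v0 D0 M2_gt0 M1 q1 nm Mr
  (4 * D / lambda + 4 * (M2 / tau)).
rewrite -/Kl -/r -/l -/B in eB.
have {}eB : lindeberg_error m n (inverse_temperature n tau q) v (4 * D / lambda + 4 * (M2 / tau)) Lw
    (tilt m tau) <= `|Kl| * B by apply: (le_trans eB); rewrite ler_wpM2r// ler_norm.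
have h1 : (13 + 3 / tau) * n%:R^-1 <= K0 * B.
  by rewrite /K0 mulrAC [leRHS]mulrC ler_wpM2l// ltW// addr_gt0// divr_gt0.
have h2 : 0 <= (4 + 4 * R0 ^+ 4) * B by apply: mulr_ge0 => //; lra.
rewrite /K; move: eB h1 h2 mB.
set E := lindeberg_error _ _ _ _ _ _ _; set ni := n%:R^-1; set mi := m%:R^-1; set ti := tau^-1.
move=> eB h1 h2 mB; rewrite !mulrDl; lra.
Qed.
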